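(* Let $\rho>0$, $T>0$, $\theta\ge0$ and $x,y\in\mathbb{R}$, and consider the continuous-time game described in the context. (a) If $\theta=1/4$, there exists a unique Nash equilibrium $(X^*,Y^* )$ in $\mathscr X(x,[0,T])\times\mathscr X(y,[0,T])$. The strategies $X^*,Y^*$ are deterministic and given by $X^*_t=\frac12(x+y)V_t+\frac12(x-y)W_t$ and $Y^*_t=\frac12(x+y)V_t-\frac12(x-y)W_t$, where $V_{0-}=1$, $$V_t=\frac{e^{3\rho T}(6\rho(T-t)+4)-4e^{3\rho t}}{2e^{3\rho T}(3\rho T+5)-1}\quad(t\in[0,T]),$$ and $W_{0-}=1$, $W_t=\frac{\rho(T-t)+1}{\rho T+1}$ for $t\in[0,T)$, $W_T=0$ (and $V_t=W_t=0$ for $t>T$). (b) If $\theta\neq1/4$, a Nash equilibrium exists if and only if $x=y=0$; in that case the Nash equilibrium is unique and both equilibrium strategies vanish identically.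
   Context: Let $(\Omega,(\mathscr F_t)_{t\ge0},\mathscr F,\mathbb P)$ be a filtered probability space with right-continuous filtration and $\mathbb P$-trivial $\mathscr F_0$. An admissible strategy with initial value $z$ and horizon $T$ is a process $(Z_t)_{t\ge0-}$ with $Z_{0-}=z$ such that $(Z_t)_{t\ge0}$ is adapted, $t\mapsto Z_t$ is a.s. right-continuous and bounded, has finite total variation which is a.s. bounded (uniformly in $\omega$), and $Z_t=0$ a.s. for all $t\ge T$. The class of these is $\mathscr X(z,[0,T])$; deterministic ones form $\mathscr X_{\det}(z,[0,T])$. For $X\in\mathscr X(x,[0,T])$, $Y\in\mathscr X(y,[0,T])$ the liquidation costs are $$\mathscr C(X|Y)=\frac12\int_{[0,T]}\int_{[0,T]}e^{-\rho|t-s|}\,dX_s\,dX_t+\int_{[0,T]}\int_{[0,t)}e^{-\rho(t-s)}\,dY_s\,dX_t+\frac12\sum_{t\in[0,T]}\Delta X_t\Delta Y_t+\theta\sum_{t\in[0,T]}(\Delta X_t)^2,$$ with Stieltjes integrals, where $dX$ charges the initial jump $\Delta X_0=X_0-X_{0-}$; $\mathscr C(Y|X)$ is defined by interchanging $X$ and $Y$. A Nash equilibrium is a pair $(X^*,Y^* )\in\mathscr X(x,[0,T])\times\mathscr X(y,[0,T])$ with $\mathbb E[\mathscr C(X^*|Y^* )]=\inf_{X\in\mathscr X(x,[0,T])}\mathbb E[\mathscr C(X|Y^* )]$ and $\mathbb E[\mathscr C(Y^*|X^* )]=\inf_{Y\in\mathscr X(y,[0,T])}\mathbb E[\mathscr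 C(Y|X^* )]$. *)

(* Defs.v *)
From HB Require Import structures.
From mathcomp Require Import all_boot all_order all_algebra.
From mathcomp Require Import all_classical all_reals all_analysis.

Set Implicit Arguments.
Unset Strict Implicit.
Unset Printing Implicit Defensive.

Import Order.TTheory GRing.Theory Num.Theory.
Import numFieldNormedType.Exports.

Local Open Scope classical_set_scope.
Local Open Scope ring_scope.

(* The Lebesgue-Stieltjes measure of f when f is nondecreasing and
   right-continuous (the only case used below); otherwise a dummy
   (the Lebesgue-Stieltjes measure of the identity). *)
Definition cum_of (R : realType) (f : R -> R) : cumulative R R :=
  match pselect (nondecreasing f /\ right_continuous f) with
  | left h => HB.pack f (isCumulative.Build R _ R f (proj1 h) (proj2 h))
  | right _ => HB.pack (@idfun R)
      (isCumulative.Build R _ R (@idfun R) (fun x y (xy : x <= y) => xy)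
         (right_continuousW (fun x : R => @cvg_id _ (nbhs x))))
  end.

Definition LSmeasure (R : realType) (f : R -> R) :=
  lebesgue_stieltjes_measure (cum_of f).

(* Jordan decomposition F = jpos F - jneg F of a function F which is
   constant on (-oo, 0); variation counted from the point -1 < 0. *)
Definition jpos (R : realType) (F : R -> R) (x : R) : R :=
  fine (pos_tv (-1) F (Num.max x (-1))).
Definition jneg (R : realType) (F : R -> R) (x : R) : R :=
  fine (neg_tv (-1) F (Num.max x (-1))).

Definition sint (R : realType) (F : R -> R) (g : R -> R) (A : set R) : R :=
  fine (\int[LSmeasure (jpos F)]_(s in A) (g s)%:E)
  - fine (\int[LSmeasure (jneg F)]_(s in A) (g s)%:E).

Definition rsum (R : realType) (A : set R) (a : R -> R) : R :=
  fine (\esum_(t in A) (Num.max (a t) 0)%:E)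
  - fine (\esum_(t in A) (Num.max (- a t) 0)%:E).

Definition jump (R : realType) (F : R -> R) (t : R) : R :=
  F t - lim (F @ t^'-).

(* A strategy is a process Z : R -> Omega -> R (only t >= 0 matters);
   its path, extended by Z_{0-} = z on (-oo,0). *)
Definition path (d : measure_display) (Omega : measurableType d)
  (R : realType) (z : R) (Z : R -> Omega -> R) (w : Omega) : R -> R :=
  fun t => if t < 0 then z else Z t w.

Definition filtration (d : measure_display) (Omega : measurableType d)
  (R : realType) (P : probability Omega R) (F : R -> set (set Omega)) : Prop :=
  [/\ forall t, 0 <= t -> sigma_algebra setT (F t),
      forall t, 0 <= t -> F t `<=` measurable,
      forall s t, 0 <= s -> s <= t -> F s `<=` F t,
      forall t, 0 <= t -> F t = \bigcap_(s in `]t, +oo[) F s &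
      forall A, F 0 A -> P A = 0%E \/ P A = 1%E].

Definition admissible (d : measure_display) (Omega : measurableType d)
  (R : realType) (P : probability Omega R) (F : R -> set (set Omega))
  (T z : R) (Z : R -> Omega -> R) : Prop :=
  [/\
      forall t, 0 <= t -> forall B : set R, measurable B -> F t (Z t @^-1` B),
      {ae P, forall w, forall t, 0 <= t -> Z^~ w @ t^'+ --> Z t w},
      {ae P, forall w, exists M : R, forall t, 0 <= t -> `|Z t w| <= M},
      (* total variation (including the initial jump from Z_{0-} = z)
         bounded by a deterministic constant, a.s. *)
      exists C : R, {ae P, forall w, forall b : R,
                       (total_variation (-1) b (path z Z w) <= C%:E)%E} &
      forall t, T <= t -> {ae P, forall w, Z t w = 0}].

Definition deterministic (d : measure_display) (Omega : measurableType d)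
  (R : realType) (Z : R -> Omega -> R) : Prop :=
  exists f : R -> R, forall t w, 0 <= t -> Z t w = f t.

Definition cost (d : measure_display) (Omega : measurableType d)
  (R : realType) (rho theta T x y : R) (X Y : R -> Omega -> R) (w : Omega) : R :=
  let pX := path x X w in
  let pY := path y Y w in
  2^-1 * sint pX (fun t => sint pX (fun s => expR (- rho * `|t - s|)) `[0, T])
               `[0, T]
  + sint pX (fun t => sint pY (fun s => expR (- rho * (t - s))) `[0, t[) `[0, T]
  + 2^-1 * rsum `[0, T] (fun t => jump pX t * jump pY t)
  + theta * rsum `[0, T] (fun t => jump pX t ^+ 2).

Definition expected_cost (d : measure_display) (Omega : measurableType d)
  (R : realType) (P : probability Omega R)
  (rho theta T x y : R) (X Y : R -> Omega -> R) : \bar R :=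
  (\int[P]_w (cost rho theta T x y X Y w)%:E)%E.

Definition nash (d : measure_display) (Omega : measurableType d)
  (R : realType) (P : probability Omega R) (F : R -> set (set Omega))
  (rho theta T x y : R) (X Y : R -> Omega -> R) : Prop :=
  [/\ admissible P F T x X, admissible P F T y Y,
      expected_cost P rho theta T x y X Y
        = ereal_inf [set expected_cost P rho theta T x y X' Y
                    | X' in admissible P F T x] &
      expected_cost P rho theta T y x Y X
        = ereal_inf [set expected_cost P rho theta T y x Y' X
                    | Y' in admissible P F T y]].

Definition indist (d : measure_display) (Omega : measurableType d)
  (R : realType) (P : probability Omega R) (X X' : R -> Omega -> R) : Prop :=
  {ae P, forall w, forall t, 0 <= t -> X t w = X' t w}.

(* the equilibrium profiles V and W of the theorem, for t >= 0 *)
Definition Vfun (R : realType) (rho T t : R) : R :=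
  if t <= T then
    (expR (3 * rho * T) * (6 * rho * (T - t) + 4) - 4 * expR (3 * rho * t))
    / (2 * expR (3 * rho * T) * (3 * rho * T + 5) - 1)
  else 0.

Definition Wfun (R : realType) (rho T t : R) : R :=
  if t < T then (rho * (T - t) + 1) / (rho * T + 1) else 0.

(* Main.v *)
(* Almost surely the paths of an admissible strategy are right-continuous with variation bounded
   by a constant, so the cost is a combination of the double Stieltjes integrals of dX dX and
   dX dY against the kernels e^(-rho|t-s|), 1_{s<t} e^(-rho(t-s)) and 1_{s=t}.  These integrals
   are limits of double Riemann sums along uniform partitions, hence bilinear in the paths,
   measurable in omega, and nonnegative on the diagonal for e^(-rho|t-s|); in fact they vanish
   there only for constant paths.  An equilibrium is a pair at which both first variations have
   zero mean, and the sum and the difference of these two conditions involve only X + Y and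
   only X - Y.  Varying the strategies by a jump at 0 and the opposite jump at T/(n+1), resp. at T
   and T - T/(n+1), gives in the limit (theta - 1/4) E[jump] = 0 for the jump of X + Y at 0,
   resp. of X - Y at T.  The profile V, resp. W, solves the first-order condition for
   theta = 1/4 and jumps only at 0, resp. T; testing with X + Y - (x + y) V, resp.
   X - Y - (x - y) W, and using definiteness shows that this difference vanishes and that
   (x + y)(theta - 1/4) = 0, resp. (x - y)(theta - 1/4) = 0. *)

Require Import Defs.
From HB Require Import structures.
From mathcomp Require Import all_boot all_order all_algebra finmap.
From mathcomp Require Import all_classical all_reals all_analysis.
From mathcomp Require Import measurable_realfun.
From mathcomp Require Import ring lra.
Import Order.TTheory GRing.Theory Num.Theory.
Import numFieldNormedType.Exports.
Local Open Scope classical_set_scope.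
Local Open Scope ring_scope.
Set Implicit Arguments.
Unset Strict Implicit.
Unset Printing Implicit Defensive.

(** [sint] integrates against the two parts of a Jordan decomposition, and these parts are not
    additive in the path; moreover the kernels break on the diagonal, where two paths may share
    atoms. Linearity in the integrator and the exchange of integrals are therefore proved for finite
    sums and carried over by uniqueness of limits. Both variables run over the same grid, which is
    what lets a break at s = t survive the limit. The kernel [klow + kdiag / 2] of the cross cost
    has symmetric part [kabs / 2]. On X + sg Y the first-order form is thus (1 + sg / 2) times that
    of [kabs], plus jump terms, and it stays definite for sg = -1. Definiteness is elementary: a
    path that is null for [kabs] has zero potential at every point, neighbouring potentials combine
    to a one-sided exponential, and differences of these recover the increments of the path. The
    value 1/4 is the theta at which the diagonal value of the signed kernel equals its limit from
    one side: from s < t for sg = 1, from s > t for sg = -1. For other theta the defect is a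
    multiple of one random jump, which is controlled by completing a square. *)

(* The path of a strategy with initial value z is extended by z to the negative half-line, so
   that z is its value at -1 and dF charges the initial jump on ]-1, T]. *)
Definition bv_path (R : realType) (C : R) (F : R -> R) : Prop :=
  [/\ forall t, t < 0 -> F t = F (-1), right_continuous F &
      forall b, (total_variation (-1) b F <= C%:E)%E].

(** * Stieltjes integrals *)

Section jordan.
Context {R : realType}.
Implicit Types (C : R) (F G : R -> R).

Lemma bv_path_BV C F b : bv_path C F -> -1 <= b -> bounded_variation (-1) b F.
Proof.
move=> [_ _ tv] b1; apply/bounded_variationP => //.
by rewrite ge0_fin_numE ?total_variation_ge0// (le_lt_trans (tv b)) ?ltry.
Qed.

Lemma bv_pathN C F : bv_path C F -> bv_path C (\- F).
Proof.
move=> [c r tv]; split.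
- by move=> t t0 /=; rewrite c.
- by move=> x; apply: cvgN; exact: r.
- by move=> b; rewrite total_variationN.
Qed.

Lemma jneg_nondecreasing C F : bv_path C F -> nondecreasing (jneg F).
Proof.
move=> gF x y xy; rewrite /jneg.
have h : Num.max x (-1) <= Num.max y (-1) by rewrite ge_max !le_max lexx xy orbT.
have m1 z : -1 <= Num.max z (-1) :> R by rewrite le_max lexx orbT.
apply: (fine_neg_tv_nondecreasing (bv_path_BV gF (m1 y))) => //.
  by rewrite in_itv/= m1.
by rewrite in_itv/= m1 lexx.
Qed.

Lemma jneg_right_continuous C F : bv_path C F -> right_continuous (jneg F).
Proof.
move=> gF x.
have [x1|x1] := ltP x (-1).
  rewrite /jneg (max_idPr (ltW x1)).
  apply: (@cvg_near_cst _ _ _ _ _ _) => /=.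
  near=> y; rewrite (max_idPr _)//.
  by near: y; apply: nbhs_right_le.
rewrite /jneg (max_idPl x1).
have -> : fine (neg_tv (-1) F x) = (fine \o neg_tv (-1) F) x by [].
have := @neg_tv_right_continuous R (-1) x (x+1) F x1 _ (bv_path_BV gF _).
have [_ rF _] := gF.
move=> /(_ _ _ (rF x)) h.
apply: cvg_trans (h _ _); [|by lra|by lra].
apply: near_eq_cvg; near=> y => /=.
rewrite (max_idPl _)//.
by rewrite (le_trans x1)//; near: y; exact: nbhs_right_ge.
Unshelve. all: by end_near. Qed.

(** Through this identity every fact about the positive part is the one about [jneg] for the
    opposite path, so only [jneg] is studied. *)
Lemma jposE F : jpos F = jneg (\- F). Proof. by []. Qed.

Lemma jpos_jneg C F x : bv_path C F -> -1 <= x -> F x = jpos F x - jneg F x.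
Proof.
move=> gF x1; rewrite /jpos /jneg (max_idPl x1).
apply: (bounded_variation_pos_neg_tvE (bv_path_BV gF x1)).
by rewrite in_itv/= x1 lexx.
Qed.

Lemma jneg_lt0 C F x : bv_path C F -> x < 0 -> jneg F x = jneg F (-1).
Proof.
move=> gF x0; rewrite /jneg; congr fine; rewrite (max_idPl (lexx (-1))).
have [x1|x1] := leP x (-1) => //.
have tv0 : total_variation (-1) x F = 0%E.
  rewrite nondecreasing_total_variation ?ltW//.
    by have [c _ _] := gF; rewrite c// subrr.
  move=> y z; rewrite !in_itv/= => /andP[_ yx] /andP[_ zx] _.
  have [c _ _] := gF.
  by rewrite (c y) ?(c z)// (le_lt_trans _ x0).
rewrite /neg_tv tv0 total_variationxx.
by have [c _ _] := gF; rewrite c.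
Qed.

Lemma cum_ofE F : nondecreasing F -> right_continuous F -> cum_of F = F :> (R -> R).
Proof. by move=> h1 h2; rewrite /cum_of; case: pselect => // -[]. Qed.

Lemma LSmeasure_itv F a b : nondecreasing F -> right_continuous F -> a <= b ->
  LSmeasure F `]a, b] = (F b - F a)%:E.
Proof.
move=> h1 h2 ab; rewrite /LSmeasure /lebesgue_stieltjes_measure.
rewrite /measure_extension measurable_mu_extE /=; last exact: is_ocitv.
by rewrite wlength_itv_bnd// cum_ofE.
Qed.

Definition LSm F : {measure set (measurableTypeR R) -> \bar R} :=
  lebesgue_stieltjes_measure (cum_of F).

(** The half-open intervals ending at -1/(n+1) exhaust the open one and have no mass. This permits
    charging the jump at 0 by computing with ]-1, b] instead of [0, b]. *)
Lemma LSm_open_lt0 F : nondecreasing F -> right_continuous F ->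
  (forall t, t < 0 -> F t = F (-1)) -> LSm F `](-1), 0[%classic = 0%E.
Proof.
move=> nF rF cF; rewrite itv_bnd_open_bigcup.
apply: (measure_negligible (mu := LSm F)).
  by apply: bigcup_measurable => n _; exact: measurable_itv.
apply: negligible_bigcup => n.
exists `](-1), (0 - n.+1%:R^-1)]%classic; split => //.
have n1 : -1 <= 0 - n.+1%:R^-1 :> R by rewrite sub0r lerN2 invf_le1// ler1n.
by rewrite /LSm/= -/(LSmeasure F) LSmeasure_itv// cF ?subrr// sub0r oppr_lt0 invr_gt0 ltr0n.
Qed.

End jordan.

Lemma cvg_norm_bound {R : realType} (u : nat -> R) l M :
  u @ \oo --> l -> (forall n, `|u n| <= M) -> `|l| <= M.
Proof.
move=> ul uM; apply: (cvgr_to_le (cvg_norm ul)).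
by near=> n.
Unshelve. all: by end_near.
Qed.

Section bounded_measurable.
Context {R : realType}.
Context d (U : measurableType d).
Implicit Types (D : set U) (g h : U -> R).

(** A class stable under linear combinations and uniformly bounded limits, and integrable for every
    finite measure. It serves both for integrands on [0, T] and for random variables. *)
Definition bm D g := measurable_fun D g
  /\ exists M, forall t, D t -> `|g t| <= M.

Variable mu : {measure set U -> \bar R}.
Variable D : set U.
Hypothesis mD : measurable D.
Hypothesis muD : (mu D < +oo)%E.

Lemma bm_cst c : bm D (fun=> c).
Proof. by split; [exact: measurable_cst|exists `|c|]. Qed.

Lemma bm_indic (A : set U) : measurable A -> bm D (\1_A : U -> R).
Proof.
move=> mA; split; first exact: measurable_indic.
by exists 1 => t _; rewrite indicE; case: (_ \in _); rewrite ?normr1 ?normr0.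
Qed.

Lemma bm_integrable g : bm D g -> mu.-integrable D (EFin \o g).
Proof.
move=> [mg [M gM]]; apply: measurable_bounded_integrable => //.
exists M; split; first exact: num_real.
move=> x Mx t Dt /=; rewrite (le_trans _ (ltW Mx))//; exact: gM.
Qed.

Lemma bm_lin (a : R) g h : bm D g -> bm D h -> bm D (fun t => a * g t + h t).
Proof.
move=> [mg [M gM]] [mh [N hN]]; split.
  by apply: measurable_funD => //; apply: measurable_funM.
exists (`|a| * M + N) => t Dt; rewrite (le_trans (ler_normD _ _))// lerD//; last exact: hN.
by rewrite normrM ler_wpM2l//; exact: gM.
Qed.

Lemma bm_Rint_lin (a : R) g h : bm D g -> bm D h ->
  Rintegral mu D (fun t => a * g t + h t) = a * Rintegral mu D g + Rintegral mu D h.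
Proof.
move=> bg bh; rewrite RintegralD//; last 2 first.
- have := integrableZl mD a (bm_integrable bg).
  by apply: eq_integrable.
- exact: bm_integrable.
by rewrite RintegralZl//; exact: bm_integrable.
Qed.

Lemma bm_cvg (g_ : nat -> U -> R) g M :
  (forall n, measurable_fun D (g_ n)) ->
  (forall n t, D t -> `|g_ n t| <= M) ->
  (forall t, D t -> g_ n t @[n --> \oo] --> g t) -> bm D g.
Proof.
move=> mg gM gg; split; first exact: (measurable_fun_cvg mg).
by exists M => t Dt; apply: (cvg_norm_bound (gg t Dt)) => n; exact: gM.
Qed.

Lemma bm_Rint_cvg (g_ : nat -> U -> R) g M :
  (forall n, measurable_fun D (g_ n)) ->
  (forall n t, D t -> `|g_ n t| <= M) ->
  (forall t, D t -> g_ n t @[n --> \oo] --> g t) ->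
  Rintegral mu D (g_ n) @[n --> \oo] --> Rintegral mu D g.
Proof.
move=> mg gM gg.
have bg : bm D g by exact: (bm_cvg mg gM).
apply: fine_cvg; rewrite fineK; last first.
  by apply: integrable_fin_num => //; exact: (bm_integrable bg).
apply: (@dominated_cvg _ _ _ mu D mD (fun n t => (g_ n t)%:E) (EFin \o g) (cst M%:E)) => //=.
- by move=> n; exact/measurable_EFinP.
- move=> t Dt; apply: cvg_EFin; first exact: nearW.
  by apply: gg.
- apply: (bm_integrable (g := cst M)); split; first exact: measurable_cst.
  by exists `|M| => t _.
Qed.

End bounded_measurable.

Section stieltjes.
Context {R : realType}.
Local Notation mR := (measurableTypeR R).
Variables (T C : R) (F : R -> R).
Hypothesis (gF : bv_path C F).
Hypothesis T0 : 0 <= T.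
Implicit Types (a b s t M : R) (g h G H : R -> R).
Local Notation D := (`[0, T]%classic : set mR).

Lemma LSm_fin H C' : bv_path C' H -> (LSm (jneg H) D < +oo)%E.
Proof.
move=> gH; apply: (@le_lt_trans _ _ (LSm (jneg H) (`]-1, T]%classic))).
  apply: le_measure; rewrite ?inE; [exact: measurable_itv|exact: measurable_itv|].
  by move=> x/=; rewrite !in_itv/= => /andP[x0 ->]; rewrite andbT (lt_le_trans _ x0).
rewrite /LSm/= -/(LSmeasure (jneg H)) LSmeasure_itv ?ltry//.
- exact: (jneg_nondecreasing gH).
- exact: (jneg_right_continuous gH).
- by rewrite (le_trans _ T0).
Qed.

Lemma sintE g : sint F g D = Rintegral (LSm (jneg (\- F))) D (g : mR ->
  R) - Rintegral (LSm (jneg F)) D (g : mR -> R).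
Proof. by []. Qed.

Let mD : measurable D. Proof. exact: measurable_itv. Qed.

Lemma sint_lin (a : R) g h : bm D g -> bm D h ->
  sint F (fun t => a * g t + h t) D = a * sint F g D + sint F h D.
Proof.
move=> bg bh.
have e1 := bm_Rint_lin mD (LSm_fin (bv_pathN gF)) a bg bh.
have e2 := bm_Rint_lin mD (LSm_fin gF) a bg bh.
have gen (p q r s : R) : a * p + q - (a * r + s) = a * (p - r) + (q - s) by ring.
exact: (etrans (sintE _) (etrans (f_equal2 (fun u v => u - v) e1 e2)
  (etrans (gen _ _ _ _) (esym (f_equal2 (fun u v => a * u + v) (sintE g) (sintE h)))))).
Qed.

Lemma sint0 : sint F (fun=> 0) D = 0.
Proof.
have z G : Rintegral (LSm (jneg G)) D (fun=> 0) = 0.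
  by rewrite /Rintegral integral0.
exact: (etrans (sintE _) (etrans (f_equal2 (fun u v => u - v) (z (\- F)) (z F)) (subrr 0))).
Qed.

Lemma sint_cvg (g_ : nat -> R -> R) g M :
  (forall n, measurable_fun D (g_ n : mR -> R)) ->
  (forall n t, D t -> `|g_ n t| <= M) ->
  (forall t, D t -> g_ n t @[n --> \oo] --> g t) ->
  sint F (g_ n) D @[n --> \oo] --> sint F g D.
Proof.
move=> mg gM gg.
under eq_fun do rewrite sintE.
rewrite sintE; apply: cvgB.
  by apply: (bm_Rint_cvg mD (LSm_fin (bv_pathN gF)) mg gM gg).
by apply: (bm_Rint_cvg mD (LSm_fin gF) mg gM gg).
Qed.

(** The integral sees only [0, T], whereas ]a, b] may begin before 0. Nothing is lost: the path is
    constant there, and for a < 0 <= b the mass is that of ]-1, b] less the null set ]-1, 0[. *)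
Lemma Rint_itv H C' (a b : R) : bv_path C' H -> -1 <= a -> a <= b -> b <= T ->
  Rintegral (LSm (jneg H)) D (\1_(`]a, b]%classic : set mR) : mR -> R) = jneg H b - jneg H a.
Proof.
move=> gH a1 ab bT; rewrite /Rintegral integral_indic//.
have nH := jneg_nondecreasing gH.
have rH := jneg_right_continuous gH.
have [b0|b0] := ltP b 0.
  rewrite (jneg_lt0 gH b0) (jneg_lt0 gH (le_lt_trans ab b0)) subrr.
  rewrite (_ : _ `&` _ = set0) ?measure0//.
  apply/seteqP; split => x //=; rewrite !in_itv/= => -[/andP[_ xb] /andP[x0 _]].
  lra.
have E (a' : R) : 0 <= a' -> a' <= b -> `]a', b]%classic `&` D = `]a', b]%classic.
  move=> a0 ab'; apply/seteqP; split => x /=; rewrite !in_itv/=; first by case.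
  by move=> /andP[h1 h2]; split; lra.
have [a0|a0] := leP 0 a.
  by rewrite E// /LSm/= -/(LSmeasure (jneg H)) LSmeasure_itv.
have I : (`]a, b]%classic `&` D : set mR) = `]-1, b]%classic `\` `]-1, 0[%classic.
  apply/seteqP; split => x /=; rewrite !in_itv/=.
    by move=> [/andP[h1 h2] /andP[h3 h4]]; split; lra.
  by move=> [/andP[h1 h2] /negP]; rewrite h1/= -leNgt => h3; split; lra.
rewrite I measureD; [|exact: measurable_itv|exact: measurable_itv|]; last first.
  rewrite /LSm/= -/(LSmeasure (jneg H)) LSmeasure_itv// ?ltry//; lra.
rewrite (_ : _ `&` _ = `]-1, 0[%classic); last first.
  apply/setIidPr => x /=; rewrite !in_itv/=; lra.
rewrite [X in (_ - X)%E](_ : _ = 0%E); last first.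
  exact: (LSm_open_lt0 nH rH (fun t => @jneg_lt0 _ _ _ t gH)).
rewrite sube0 /LSm/= -/(LSmeasure (jneg H)) LSmeasure_itv//; last by lra.
by rewrite /= (jneg_lt0 gH a0).
Qed.

Lemma sint_itv (a b : R) : -1 <= a -> a <= b -> b <= T ->
  sint F (\1_(`]a, b]%classic : set mR)) D = F b - F a.
Proof.
move=> a1 ab bT; rewrite sintE (Rint_itv (bv_pathN gF))// (Rint_itv gF)//.
have b1 : -1 <= b by lra.
rewrite (jpos_jneg gF a1) (jpos_jneg gF b1) jposE.
suff gen (p q r s : R) : p - q - (r - s) = p - r - (q - s) by exact: gen.
by ring.
Qed.

Lemma eq_sint g h : (forall t, 0 <= t <= T -> g t = h t) -> sint F g D = sint F h D.
Proof.
move=> gh; rewrite /sint; have E (mu : {measure set mR -> \bar R}) :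
    (\int[mu]_(s in D) (g s)%:E = \int[mu]_(s in D) (h s)%:E)%E.
  by apply: eq_integral => t /set_mem/=; rewrite in_itv/= => /gh ->.
by congr (fine _ - fine _); exact: E.
Qed.

(** Moves the variable domain of the inner integral into the kernel, so that the cross term of the
    cost becomes a double integral over a fixed square. *)
Lemma sint_co g t : t <= T ->
  sint F g `[0, t[%classic = sint F (fun s => (s < t)%R%:R * g s) D.
Proof.
move=> tT; rewrite /sint.
have E (mu : {measure set mR -> \bar R}) :
    (\int[mu]_(s in `[0%R, t[%classic) (g s)%:E = \int[mu]_(s in D) ((s < t)%R%:R * g s)%:E)%E.
  rewrite (_ : `[0, t[%classic = D `&` `[0, t[%classic); last first.
    apply/esym/setIidPr => x /=; rewrite !in_itv/=; lra.
  rewrite integral_mkcondr; apply: eq_integral => s /set_mem/=; rewrite in_itv/= => /andP[s0 sT].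
  rewrite patchE (_ : (s \in `[0, t[%classic) = (s < t)); last first.
    by rewrite mem_setE in_itv/= s0.
  by case: (s < t); rewrite ?mul1r ?mul0r.
by congr (fine _ - fine _); exact: E.
Qed.

End stieltjes.

(* Locked: unfolding the integral makes unification diverge. *)
HB.lock Definition stint (R : realType) (T : R) (F g : R -> R) : R :=
  sint F g `[0, T]%classic.

Section stint_theory.
Context {R : realType}.
Local Notation mR := (measurableTypeR R).
Variables (T C : R) (F : R -> R).
Hypothesis (gF : bv_path C F).
Hypothesis T0 : 0 <= T.
Implicit Types (a b s t M : R) (g h : R -> R).
Local Notation D := (`[0, T]%classic : set mR).

Lemma stint_lin a g h : bm D g -> bm D h ->
  stint T F (fun t => a * g t + h t) = a * stint T F g + stint T F h.
Proof. by rewrite unlock; exact: (sint_lin gF T0). Qed.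

Lemma stint_cvg (g_ : nat -> R -> R) g M :
  (forall n, measurable_fun D (g_ n : mR -> R)) ->
  (forall n t, D t -> `|g_ n t| <= M) ->
  (forall t, D t -> g_ n t @[n --> \oo] --> g t) ->
  stint T F (g_ n) @[n --> \oo] --> stint T F g.
Proof. by rewrite unlock; exact: (sint_cvg gF T0). Qed.

Lemma stint_itv a b : -1 <= a -> a <= b -> b <= T ->
  stint T F (\1_(`]a, b]%classic : set mR)) = F b - F a.
Proof. by rewrite unlock; exact: (sint_itv gF). Qed.

(** The bound is the total mass on [0, T] of the two Jordan measures. *)
Lemma stint_bound : exists B, forall h, bm D h -> (forall t, D t -> `|h t| <= 1) ->
  `|stint T F h| <= B.
Proof.
have mD : measurable D by exact: measurable_itv.
have bd H C' h : bv_path C' H -> bm D h -> (forall t, D t -> `|h t| <= 1) ->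
    `|Rintegral (LSm (jneg H)) D (h : mR -> R)| <= fine (LSm (jneg H) D).
  move=> gH bh h1; have fD := LSm_fin T0 gH.
  apply: (le_trans (le_normr_Rintegral mD (bm_integrable mD fD bh))).
  have -> : fine (LSm (jneg H) D) = Rintegral (LSm (jneg H)) D (cst 1).
    by rewrite Rintegral_cst// mul1r.
  apply: le_Rintegral => //.
  - have [mh [M hM]] := bh; apply: (bm_integrable mD fD (g := fun t => `|h t|)); split.
      by apply: measurableT_comp.
    by exists M => t Dt; rewrite normr_id hM.
  - exact: (bm_integrable mD fD (bm_cst D 1)).
exists (fine (LSm (jneg (\- F)) D) + fine (LSm (jneg F) D)) => h bh h1.
rewrite unlock sintE (le_trans (ler_normB _ _))// lerD//.
  exact: (bd _ _ _ (bv_pathN gF)).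
exact: (bd _ _ _ gF).
Qed.

Lemma stint0 : stint T F (fun=> 0) = 0.
Proof. by rewrite unlock; exact: sint0. Qed.

Lemma eq_stj g h : (forall t, 0 <= t <= T -> g t = h t) -> stint T F g = stint T F h.
Proof. by rewrite unlock; exact: eq_sint. Qed.

End stint_theory.

HB.lock Definition dint (R : realType) (T : R) (K : R -> R -> R) (F G : R -> R) : R :=
  stint T F (fun t => stint T G (K t)).

(** * Double integrals as limits of Riemann sums *)

Section grid.
Context {R : realType}.
Local Notation mR := (measurableTypeR R).
Implicit Types (a b s t M C : R) (F G g h : R -> R) (K : R -> R -> R).

Definition grid a b (N k : nat) : R := a + k%:R * ((b - a) / N.+1%:R).

Definition dgrid a b N F k := F (grid a b N k.+1) - F (grid a b N k).

(* The right endpoint of the cell containing t, and 0 outside ]a, b]. *)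
Definition grid_ceil a b N t : R :=
  \sum_(k < N.+1) grid a b N k.+1 * \1_(`]grid a b N k, grid a b N k.+1]%classic) t.

Lemma grid0 a b N : grid a b N 0 = a. Proof. by rewrite /grid mul0r addr0. Qed.

Lemma gridN a b N : grid a b N N.+1 = b.
Proof. by rewrite /grid mulrC divfK ?pnatr_eq0// addrC subrK. Qed.

Lemma gridS a b N k : grid a b N k.+1 = grid a b N k + (b - a) / N.+1%:R.
Proof. by rewrite /grid -natr1; ring. Qed.

Lemma le_grid a b N j k : a <= b -> (j <= k)%N -> grid a b N j <= grid a b N k.
Proof.
move=> ab jk; rewrite /grid lerD2l ler_wpM2r ?ler_nat//.
by rewrite divr_ge0 ?subr_ge0.
Qed.

Lemma grid_cell a b N t : a < t <= b ->
  exists2 k : 'I_N.+1, grid a b N k < t & t <= grid a b N k.+1.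
Proof.
move=> /andP[at_ tb].
have ex : exists k, (t <= grid a b N k.+1) by exists N; rewrite gridN.
case: (ex_minnP ex) => k tk kmin.
have kN : (k < N.+1)%N by rewrite ltnS kmin// gridN.
exists (Ordinal kN) => //=.
case: k tk kmin kN => [|k] tk kmin kN; first by rewrite grid0.
by rewrite ltNge; apply/negP => /kmin; rewrite ltnn.
Qed.

Lemma sum_cell a b N t (c : nat -> R) (k : 'I_N.+1) : a <= b ->
  grid a b N k < t -> t <= grid a b N k.+1 ->
  \sum_(j < N.+1) c j * \1_(`]grid a b N j, grid a b N j.+1]%classic) t = c k.
Proof.
move=> ab k1 k2; rewrite (bigD1 k)//= big1 ?addr0.
  by rewrite indicE mem_set ?mulr1//= in_itv/= k1 k2.
move=> j jk; rewrite indicE memNset ?mulr0//= in_itv/= => /andP[j1 j2].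
have /orP[h|h] : (j < k)%N || (k < j)%N by rewrite -neq_ltn.
  by have := le_grid N ab h; rewrite leNgt (lt_le_trans k1).
by have := le_grid N ab h; rewrite leNgt (lt_le_trans j1).
Qed.

Lemma sum_cell_out a b N t (c : nat -> R) : a <= b -> ~~ (a < t <= b) ->
  \sum_(j < N.+1) c j * \1_(`]grid a b N j, grid a b N j.+1]%classic) t = 0.
Proof.
move=> ab nt; rewrite big1// => j _; rewrite indicE memNset ?mulr0//= in_itv/=.
move=> /andP[j1 j2]; move/negP: nt; apply; apply/andP; split.
  by rewrite -(grid0 a b N) (le_lt_trans _ j1)// le_grid.
by rewrite (le_trans j2)// -[leRHS](gridN a b N) le_grid.
Qed.

Lemma grid_ceil_cell a b N t (k : 'I_N.+1) : a <= b ->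
  grid a b N k < t -> t <= grid a b N k.+1 -> grid_ceil a b N t = grid a b N k.+1.
Proof. by move=> ab k1 k2; rewrite /grid_ceil (sum_cell (fun k => grid a b N k.+1) ab k1 k2). Qed.

Lemma sum_grid_ceil a b N t (g : R -> R) : a < t <= b ->
  \sum_(j < N.+1) g (grid a b N j.+1) * \1_(`]grid a b N j, grid a b N j.+1]%classic) t
  = g (grid_ceil a b N t).
Proof.
move=> tab; have [k k1 k2] := grid_cell N tab.
have ab : a <= b by lra.
by rewrite (grid_ceil_cell ab k1 k2) (sum_cell (fun k => g (grid a b N k.+1)) ab k1 k2).
Qed.

Lemma grid_ceil_ge a b N t : a < t <= b -> t <= grid_ceil a b N t.
Proof.
move=> tab; have [k k1 k2] := grid_cell N tab.
by rewrite (grid_ceil_cell _ k1 k2)//; lra.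
Qed.

Lemma grid_ceil_le a b N t : a < t <= b -> grid_ceil a b N t <= b.
Proof.
move=> tab; have [k k1 k2] := grid_cell N tab; have ab : a <= b by lra.
by rewrite (grid_ceil_cell _ k1 k2)// -[leRHS](gridN a b N) le_grid.
Qed.

Lemma grid_ceil_lt a b N t : a < t <= b -> grid_ceil a b N t < t + (b - a) / N.+1%:R.
Proof.
move=> tab; have [k k1 k2] := grid_cell N tab; have ab : a <= b by lra.
by rewrite (grid_ceil_cell _ k1 k2)// gridS ltrD2r.
Qed.

Lemma mesh_cvg0 (c : R) : (c / N.+1%:R) @[N --> \oo] --> 0.
Proof.
rewrite -[X in _ --> X](mulr0 c); apply: cvgM; first exact: cvg_cst.
exact: cvg_harmonic.
Qed.

Lemma grid_ceil_cvg a b t : a < t <= b -> grid_ceil a b N t @[N --> \oo] --> t.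
Proof.
move=> tab; apply: (@squeeze_cvgr _ _ _ _ (cst t) (fun N => t + (b - a) / N.+1%:R)).
- by apply: nearW => N; rewrite grid_ceil_ge//= ltW// grid_ceil_lt.
- exact: cvg_cst.
- rewrite -[X in _ --> X](addr0 t); apply: cvgD; first exact: cvg_cst.
  exact: mesh_cvg0.
Qed.

Lemma grid_ceil_near_lt a b s t : a < s <= b -> a < t <= b -> s < t ->
  \forall N \near \oo, grid_ceil a b N s < grid_ceil a b N t.
Proof.
move=> sab tab st.
have /cvgr_lt /(_ t) := grid_ceil_cvg sab; move=> /(_ st) h.
near=> N; apply: (@lt_le_trans _ _ t); last exact: grid_ceil_ge.
by near: N.
Unshelve. all: by end_near. Qed.

Lemma dgrid_le_TV C F T N n : -1 <= T -> bv_path C F ->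
  \sum_(k < n) `|dgrid (-1) T N F k| <= C.
Proof.
move=> T1 [_ _ tv]; rewrite -lee_fin (le_trans _ (tv (grid (-1) T N n)))//.
elim: n => [|n IH].
  by rewrite big_ord0 total_variation_ge0// grid0.
rewrite big_ord_recr/= EFinD (@total_variationD _ _ _ (grid (-1) T N n)).
- by apply: leeD => //; apply: total_variation_ge; exact: le_grid.
- by rewrite -{1}(grid0 (-1) T N); apply: le_grid.
- exact: le_grid.
Qed.

Variable T : R.
Hypothesis T0 : 0 <= T.
Local Notation D := (`[0, T]%classic : set mR).

Lemma bm_cell (c : nat -> R) a b N n : bm D (fun t =>
  \sum_(j < n) c j * \1_(`]grid a b N j, grid a b N j.+1]%classic) t).
Proof.
split.
  apply: measurable_sum => j; apply: measurable_funM; first exact: measurable_cst.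
  by apply: measurable_indic; exact: measurable_itv.
exists (\sum_(j < n) `|c j|) => t _; rewrite (le_trans (ler_norm_sum _ _ _))//.
apply: ler_sum => j _; rewrite normrM ler_piMr// indicE.
by case: (_ \in _); rewrite ?normr1 ?normr0.
Qed.

Lemma stint_cell C F (c : nat -> R) a b N n : bv_path C F -> (n <= N.+1)%N ->
  -1 <= a -> a <= b -> b <= T ->
  stint T F (fun t => \sum_(j < n) c j * \1_(`]grid a b N j, grid a b N j.+1]%classic) t)
  = \sum_(j < n) c j * dgrid a b N F j.
Proof.
move=> gF + a1 ab bT; elim: n => [_|n IH nN].
  rewrite big_ord0 -[RHS](stint0 T F); congr stint; apply: funext => t.
  by rewrite big_ord0.
have E : (fun t => \sum_(j < n.+1) c j * \1_(`]grid a b N j, grid a b N j.+1]%classic) t)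
  = (fun t => c n * \1_(`]grid a b N n, grid a b N n.+1]%classic) t +
      \sum_(j < n) c j * \1_(`]grid a b N j, grid a b N j.+1]%classic) t).
  by apply: funext => t; rewrite big_ord_recr/= addrC.
rewrite E (stint_lin gF)//; last 2 first.
- by apply: bm_indic; exact: measurable_itv.
- exact: bm_cell.
rewrite IH ?(ltnW nN)// big_ord_recr/= addrC (stint_itv gF)//.
- by rewrite (le_trans a1)// -{1}(grid0 a b N) le_grid.
- exact: le_grid.
- by rewrite (le_trans _ bT)// -[leRHS](gridN a b N) le_grid.
Qed.

(** A Riemann sum is the exact integral of the step function [g_ N] composed with [grid_ceil], so
    dominated convergence applies. The integrand may depend on [N] because it will itself be an
    inner Riemann sum. *)
Lemma grid_cvg C F (g_ : nat -> R -> R) g a b M : bv_path C F ->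
  -1 <= a -> a < b -> b <= T ->
  (forall N t, `|g_ N t| <= M) ->
  (forall t, 0 <= t <= T -> a < t <= b -> g_ N (grid_ceil a b N t) @[N --> \oo] --> g t) ->
  \sum_(k < N.+1) g_ N (grid a b N k.+1) * dgrid a b N F k @[N --> \oo] -->
  stint T F (fun t => g t * \1_(`]a, b]%classic) t).
Proof.
move=> gF a1 ab bT gM gg.
under eq_fun do rewrite -(stint_cell (fun k => g_ _ (grid a b _ k.+1)) gF (leqnn _) a1 (ltW ab) bT).
apply: (stint_cvg (M := M) gF T0).
- by move=> N; case: (bm_cell (fun k => g_ N (grid a b N k.+1)) a b N N.+1).
- move=> N t Dt.
  have [tab|tab] := boolP (a < t <= b); first by rewrite sum_grid_ceil.
  rewrite (sum_cell_out _ (fun k => g_ N (grid a b N k.+1)) (ltW ab) tab) normr0.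
  by rewrite (le_trans _ (gM 0 0))//.
- move=> t; rewrite /= in_itv/= => Dt; have [tab|tab] := boolP (a < t <= b).
    rewrite indicE mem_set ?mulr1/= ?in_itv/= ?tab//.
    under eq_fun do rewrite sum_grid_ceil//.
    exact: gg.
  rewrite indicE memNset ?mulr0/= ?in_itv/= ?(negbTE tab)//.
  under eq_fun do rewrite (sum_cell_out _ (fun k => g_ _ (grid a b _ k.+1)) (ltW ab) tab).
  exact: cvg_cst.
Qed.

Lemma bv_path_ge0 C F : bv_path C F -> 0 <= C.
Proof.
move=> [_ _ tv]; rewrite -lee_fin (le_trans _ (tv (-1)))//.
by rewrite total_variation_ge0.
Qed.

Definition regular g := (exists M, forall t, `|g t| <= M) /\
  forall t, 0 <= t <= T -> g (grid_ceil (-1) T N t) @[N --> \oo] --> g t.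

(* Indicators of s < t and of s = t qualify: distinct points eventually lie in different cells
   of the partition, equal points always in the same one. *)
Definition kernel_regular (K : R -> R -> R) := (exists M, forall t s, `|K t s| <= M) /\
  forall t s, 0 <= t <= T -> 0 <= s <= T ->
  K (grid_ceil (-1) T N t) (grid_ceil (-1) T N s) @[N --> \oo] --> K t s.

Definition dsum N (K : R -> R -> R) F G :=
  \sum_(k < N.+1) (\sum_(l < N.+1) K (grid (-1) T N k.+1) (grid (-1) T N l.+1) * dgrid (-1) T N G l)
    * dgrid (-1) T N F k.

Let T1 : -1 < T. Proof. by rewrite (lt_le_trans _ T0)// ltrN10. Qed.

Let stint_oc1 F g : stint T F (fun t => g t * \1_(`]-1, T]%classic) t) = stint T F g.
Proof.
apply: eq_stj => t Dt; rewrite indicE mem_set ?mulr1//= in_itv/=.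
lra.
Qed.

Lemma regular_cvg C F g : bv_path C F -> regular g ->
  \sum_(k < N.+1) g (grid (-1) T N k.+1) * dgrid (-1) T N F k @[N --> \oo] --> stint T F g.
Proof.
move=> gF [[M gM] gg]; rewrite -stint_oc1.
by apply: (grid_cvg (M := M) (g_ := fun=> g) gF) => // t Dt _; exact: gg.
Qed.

Lemma inner_cvg C G K t : bv_path C G -> kernel_regular K -> 0 <= t <= T ->
  \sum_(l < N.+1) K (grid_ceil (-1) T N t) (grid (-1) T N l.+1) * dgrid (-1) T N G l
    @[N --> \oo] --> stint T G (K t).
Proof.
move=> gG [[M KM] KK] Dt; rewrite -stint_oc1.
by apply: (grid_cvg (M := M) (g_ := fun N => K (grid_ceil (-1) T N t)) gG) => // s Ds _; exact: KK.
Qed.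

Lemma inner_bound C G K M N t : bv_path C G -> (forall t s, `|K t s| <= M) ->
  `|\sum_(l < N.+1) K t (grid (-1) T N l.+1) * dgrid (-1) T N G l| <= M * C.
Proof.
move=> gG KM; rewrite (le_trans (ler_norm_sum _ _ _))//.
apply: (@le_trans _ _ (\sum_(l < N.+1) M * `|dgrid (-1) T N G l|)).
  by apply: ler_sum => l _; rewrite normrM ler_wpM2r.
rewrite -mulr_sumr ler_wpM2l//; first by rewrite (le_trans _ (KM 0 0)).
by apply: dgrid_le_TV => //; exact: ltW.
Qed.

(** [grid_cvg] is applied to the inner sums on the same grid, which they follow with the outer point
    already rounded up. The result is a single limit in N, not an iterated one. *)
Lemma dint_cvg C C' F G K : bv_path C F -> bv_path C' G -> kernel_regular K ->
  dsum N K F G @[N --> \oo] --> dint T K F G.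
Proof.
move=> gF gG rK; have [[M KM] _] := rK; rewrite dint.unlock -stint_oc1.
apply: (grid_cvg (M := M * C') (g_ := fun N t =>
   \sum_(l < N.+1) K t (grid (-1) T N l.+1) * dgrid (-1) T N G l) gF) => //.
- by move=> N t; exact: inner_bound.
- by move=> t Dt _; apply: (inner_cvg gG).
Qed.

Lemma dsum_bound C C' F G K M N : bv_path C F -> bv_path C' G ->
  (forall t s, `|K t s| <= M) -> `|dsum N K F G| <= M * C * C'.
Proof.
move=> gF gG KM; rewrite (le_trans (ler_norm_sum _ _ _))//.
apply: (@le_trans _ _ (\sum_(l < N.+1) (M * C') * `|dgrid (-1) T N F l|)).
  by apply: ler_sum => l _; rewrite normrM ler_wpM2r//; exact: inner_bound.
rewrite -mulr_sumr [M * C * C']mulrAC ler_wpM2l//.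
  by rewrite mulr_ge0 ?(bv_path_ge0 gG)// (le_trans _ (KM 0 0)).
by apply: dgrid_le_TV => //; exact: ltW.
Qed.

Lemma dint_bound C C' F G K M : bv_path C F -> bv_path C' G -> kernel_regular K ->
  (forall t s, `|K t s| <= M) -> `|dint T K F G| <= M * C * C'.
Proof.
move=> gF gG rK KM; apply: (cvg_norm_bound (dint_cvg gF gG rK)) => N.
exact: dsum_bound.
Qed.

End grid.

(** The device that turns identities between finite sums into identities between integrals. *)
Lemma cvg_unique_ext {R : realType} (u v : nat -> R) (l l' : R) :
  u @ \oo --> l -> v @ \oo --> l' -> u =1 v -> l = l'.
Proof.
move=> ul vl /funext uv; rewrite uv in ul.
by rewrite -(cvg_lim _ ul)// -(cvg_lim _ vl).
Qed.

Lemma cvg_lin {R : realType} (a : R) (u v : nat -> R) (l m : R) :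
  u @ \oo --> l -> v @ \oo --> m -> a * u n + v n @[n --> \oo] --> a * l + m.
Proof. by move=> ul vm; apply: cvgD vm; apply: cvgM ul; exact: cvg_cst. Qed.

Section bv_path_closure.
Context {R : realType}.
Implicit Types (a b s t M C : R) (F G g h : R -> R) (K : R -> R -> R).

Lemma total_variation_ub a b F C :
  (forall s : seq R, itv_partition a b s -> variation a b F s <= C) ->
  (total_variation a b F <= C%:E)%E.
Proof.
move=> h; apply: ge_ereal_sup => _ [_ [s ps <-] <-].
by rewrite lee_fin h.
Qed.

Lemma bv_path_variation C F b (s : seq R) : bv_path C F -> itv_partition (-1) b s ->
  variation (-1) b F s <= C.
Proof.
move=> [_ _ tv] ps; rewrite -lee_fin (le_trans _ (tv b))//.
apply: ereal_sup_ubound; exists (variation (-1) b F s) => //.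
exact: variations_variation.
Qed.

Lemma variationZ a b c F (s : seq R) : variation a b (fun t => c * F t) s =
  `|c| * variation a b F s.
Proof.
rewrite /variation mulr_sumr; apply: eq_bigr => i _ /=.
by rewrite -mulrBr normrM.
Qed.

Lemma bv_path_lin c C C' F G : bv_path C F -> bv_path C' G ->
  bv_path (`|c| * C + C') (fun t => c * F t + G t).
Proof.
move=> gF gG; split.
- by case: gF gG => [hF _ _] [hG _ _] t t0; rewrite hF// hG.
- case: gF gG => [_ rF _] [_ rG _] t.
  by apply: cvgD; [apply: cvgM; [exact: cvg_cst|exact: rF]|exact: rG].
- move=> b; apply: total_variation_ub => s ps.
  apply: (le_trans (variation_le _ _ _ _ _)).
  by rewrite variationZ lerD ?ler_wpM2l// (bv_path_variation _ ps).
Qed.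

Lemma bv_path_nondecreasing C F : (forall t, t < 0 -> F t = F (-1)) ->
  right_continuous F -> nondecreasing F -> (forall t, F t <= F (-1) + C) -> bv_path C F.
Proof.
move=> cF rF nF FC; split=> // b; apply: total_variation_ub => s ps.
rewrite nondecreasing_variation//; first by have := FC b; lra.
by move=> x y _ _; exact: nF.
Qed.

Lemma bv_path_eq C F G : F =1 G -> bv_path C F -> bv_path C G.
Proof. by move=> /funext ->. Qed.

(** As an integrator this is a unit point mass at [b]. It is the building block of the deterministic
    test strategies and, in a double integral, it extracts the potential at [b]. *)
Definition step b t : R := (b <= t)%R%:R.

Lemma step_right_continuous b : right_continuous (step b).
Proof.
move=> t; rewrite /step; apply: (@cvg_near_cst _ _ _ _ _ _) => /=.
have [bt|tb] := leP b t.
  near=> u; suff -> : b <= u by [].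
  by rewrite (le_trans bt)//; near: u; exact: nbhs_right_ge.
near=> u; suff -> : (b <= u) = false by [].
by apply/negbTE; rewrite -ltNge; near: u; exact: nbhs_right_lt.
Unshelve. all: by end_near. Qed.

Lemma bv_path_step b : 0 <= b -> bv_path 1 (step b).
Proof.
move=> b0; apply: bv_path_nondecreasing.
- by move=> t t0; rewrite /step !leNgt (lt_le_trans t0 b0) (lt_le_trans _ b0)// ltrN10.
- exact: step_right_continuous.
- move=> s t st; rewrite /step ler_nat; case: (leP b s) => // bs.
  by rewrite (le_trans bs st).
- move=> t; rewrite (_ : step b (-1) = 0) ?add0r; first by rewrite /step; case: (b <= t).
  by rewrite /step leNgt (lt_le_trans _ b0)// ltrN10.
Qed.

Lemma jump_step b t : jump (step b) t = (t == b)%:R.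
Proof.
rewrite /jump; have -> : lim (step b @ t^'-) = (b < t)%R%:R.
  apply/cvg_lim => //; apply: (@cvg_near_cst _ _ _ _ _ _) => /=.
  rewrite /step; have [bt|tb] := ltP b t.
    near=> u; suff -> : b <= u by [].
    by near: u; apply: nbhs_left_ge.
  near=> u; suff -> : (b <= u) = false by [].
  apply/negbTE; rewrite -ltNge; apply: lt_le_trans tb.
  by near: u; exact: nbhs_left_lt.
rewrite /step le_eqVlt eq_sym; case: ltgtP => _ /=; lra.
Unshelve. all: by end_near. Qed.

End bv_path_closure.

(** * Bilinearity and symmetry of the double integrals *)

Section bilinear.
Context {R : realType}.
Implicit Types (a b s t M C : R) (F G g h : R -> R) (K : R -> R -> R).
Variable T : R.
Hypothesis T0 : 0 <= T.
Local Notation dint := (@dint R T).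
Local Notation dsum := (@dsum R T).
Local Notation kernel_regular := (@kernel_regular R T).
Local Notation regular := (@regular R T).

Lemma kernel_regular_lin a K K' : kernel_regular K -> kernel_regular K' ->
  kernel_regular (fun t s => a * K t s + K' t s).
Proof.
move=> [[M gM] gg] [[N hN] hh]; split.
  exists (`|a| * M + N) => t s; rewrite (le_trans (ler_normD _ _))// lerD//.
  by rewrite normrM ler_wpM2l.
move=> t s Dt Ds; apply: cvgD; last exact: hh.
by apply: cvgM; [exact: cvg_cst|exact: gg].
Qed.

Lemma kernel_regular_swap K : kernel_regular K -> kernel_regular (fun t s => K s t).
Proof.
by move=> [[M gM] gg]; split; [exists M => t s|move=> t s Dt Ds; exact: gg].
Qed.

Lemma eq_dint K K' F G :
  (forall t s, 0 <= t <= T -> 0 <= s <= T -> K t s = K' t s) -> dint K F G = dint K' F G.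
Proof.
move=> KK; rewrite dint.unlock; apply: eq_stj => t Dt; apply: eq_stj => s Ds; exact: KK.
Qed.

(** The increments [dgrid] are linear in the path although its Jordan parts are not, so linearity is
    inherited from the double sums. *)
Lemma dint_linl C1 C2 C3 a K F F' G : bv_path C1 F -> bv_path C2 F' -> bv_path C3 G ->
  kernel_regular K ->
  dint K (fun t => a * F t + F' t) G = a * dint K F G + dint K F' G.
Proof.
move=> gF gF' gG rK.
have h1 := dint_cvg T0 (bv_path_lin a gF gF') gG rK.
have h2 := cvg_lin (a := a) (dint_cvg T0 gF gG rK) (dint_cvg T0 gF' gG rK).
apply: (cvg_unique_ext h1 h2) => N /=.
rewrite /dsum mulr_sumr -big_split/=; apply: eq_bigr => k _; rewrite /dgrid; ring.
Qed.

(** Fubini's theorem for these kernels, obtained by exchanging two finite sums. *)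
Lemma dint_swap C1 C2 K F G : bv_path C1 F -> bv_path C2 G -> kernel_regular K ->
  dint (fun t s => K s t) F G = dint K G F.
Proof.
move=> gF gG rK.
have h1 := dint_cvg T0 gF gG (kernel_regular_swap rK).
have h2 := dint_cvg T0 gG gF rK.
apply: (cvg_unique_ext h1 h2) => N /=.
rewrite /dsum; under eq_bigr do rewrite mulr_suml.
rewrite exchange_big/=; apply: eq_bigr => k _; rewrite mulr_suml.
by apply: eq_bigr => l _; rewrite mulrAC.
Qed.

Lemma dint_linr C1 C2 C3 a K F G G' : bv_path C1 F -> bv_path C2 G -> bv_path C3 G' ->
  kernel_regular K ->
  dint K F (fun t => a * G t + G' t) = a * dint K F G + dint K F G'.
Proof.
move=> gF gG gG' rK; have rK' := kernel_regular_swap rK.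
rewrite -(dint_swap (bv_path_lin a gG gG') gF rK) (dint_linl a gG gG' gF rK').
by rewrite (dint_swap gG gF rK) (dint_swap gG' gF rK).
Qed.

Lemma dint_linK C1 C2 a K K' F G : bv_path C1 F -> bv_path C2 G ->
  kernel_regular K -> kernel_regular K' ->
  dint (fun t s => a * K t s + K' t s) F G = a * dint K F G + dint K' F G.
Proof.
move=> gF gG rK rK'.
have h1 := dint_cvg T0 gF gG (kernel_regular_lin a rK rK').
have h2 := cvg_lin (a := a) (dint_cvg T0 gF gG rK) (dint_cvg T0 gF gG rK').
apply: (cvg_unique_ext h1 h2) => N /=.
rewrite /dsum mulr_sumr -big_split/=; apply: eq_bigr => k _.
rewrite mulrA -mulrDl mulr_sumr -big_split/=; congr (_ * _).
by apply: eq_bigr => l _; ring.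
Qed.

Lemma dgrid_step b N k : dgrid (-1) T N (step b) k =
  \1_(`]grid (-1) T N k, grid (-1) T N k.+1]%classic) b.
Proof.
rewrite /dgrid /step indicE.
have gg : grid (-1) T N k <= grid (-1) T N k.+1.
  by apply: le_grid => //; rewrite (le_trans _ T0)// lerN10.
have -> : (b \in `]grid (-1) T N k, grid (-1) T N k.+1]%classic) =
  (grid (-1) T N k < b <= grid (-1) T N k.+1) by rewrite mem_setE in_itv.
have [h|h] := ltP (grid (-1) T N k) b => /=; first by rewrite subr0.
by rewrite (le_trans h gg) subrr.
Qed.

Lemma stint_step b g : 0 <= b <= T -> regular g -> stint T (step b) g = g b.
Proof.
move=> /[dup] Db /andP[b0 bT] rg.
apply: (cvg_unique_ext (regular_cvg T0 (bv_path_step b0) rg) (rg.2 _ Db)) => N /=.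
under eq_bigr do rewrite dgrid_step; rewrite sum_grid_ceil//; lra.
Qed.

Lemma dint_step C b K G : 0 <= b <= T -> bv_path C G -> kernel_regular K ->
  dint K (step b) G = stint T G (K b).
Proof.
move=> /[dup] Db /andP[b0 bT] gG rK.
apply: (cvg_unique_ext (dint_cvg T0 (bv_path_step b0) gG rK) (inner_cvg T0 gG rK Db)) => N /=.
rewrite /dsum; under [LHS]eq_bigr do rewrite dgrid_step.
rewrite (sum_grid_ceil N (fun u => \sum_(l < N.+1) K u (grid (-1) T N l.+1) * dgrid
  (-1) T N G l))//; lra.
Qed.

End bilinear.

(** * The kernels of the cost functional *)

Section kernels.
Context {R : realType}.
Implicit Types (a b s t M C : R) (F G g h : R -> R) (K : R -> R -> R).
Variables rho T : R.
Hypothesis T0 : 0 <= T.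
Hypothesis rho0 : 0 < rho.
Local Notation dint := (@dint R T).
Local Notation dsum := (@dsum R T).
Local Notation kernel_regular := (@kernel_regular R T).

Definition klow t s : R := (s < t)%R%:R * expR (- rho * (t - s)).
(** Integrating [kdiag t] against a path yields its jump at [t]; through this kernel the jump sums
    of the cost become double integrals like the other terms. *)
Definition kdiag t s : R := (s == t)%:R.
Definition kabs t s : R := expR (- rho * `|t - s|).

Lemma expN_le1 (u : R) : 0 <= u -> expR (- rho * u) <= 1.
Proof. by move=> u0; rewrite -expR0 ler_expR mulNr oppr_le0 mulr_ge0// ltW. Qed.

Lemma grid_ceil_cvgT t : 0 <= t <= T -> grid_ceil (-1) T N t @[N --> \oo] --> t.
Proof. by move=> /andP[t0 tT]; apply: grid_ceil_cvg; rewrite tT (lt_le_trans _ t0)// ltrN10. Qed.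

Lemma exp_cvg (u : nat -> R) l : u @ \oo --> l ->
  expR (- rho * u n) @[n --> \oo] --> expR (- rho * l).
Proof.
move=> ul; apply: (@cvg_comp _ _ _ (fun n => - rho * u n) expR _ (nbhs (- rho * l))).
  by apply: cvgM ul; exact: cvg_cst.
exact: continuous_expR.
Qed.

Lemma grid_ceil_near_ltT s t : 0 <= s <= T -> 0 <= t <= T -> s < t ->
  \forall N \near \oo, grid_ceil (-1) T N s < grid_ceil (-1) T N t.
Proof.
move=> /andP[s0 sT] /andP[t0 tT]; apply: grid_ceil_near_lt; rewrite ?sT ?tT andbT.
  by rewrite (lt_le_trans _ s0)// ltrN10.
by rewrite (lt_le_trans _ t0)// ltrN10.
Qed.

Lemma klow_regular : kernel_regular klow.
Proof.
split.
  exists 1 => t s; rewrite /klow; case: ltP => st; rewrite ?mul0r ?normr0// mul1r.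
  by rewrite ger0_norm ?expR_ge0// expN_le1// subr_ge0 ltW.
move=> t s Dt Ds; rewrite /klow.
have h : expR (- rho * (grid_ceil (-1) T N t - grid_ceil (-1) T N s)) @[N --> \oo]
    --> expR (- rho * (t - s)) by apply: exp_cvg; apply: cvgB; exact: grid_ceil_cvgT.
apply: cvgM => //; apply: (@cvg_near_cst _ _ _ _ _ _) => /=.
case: (ltgtP s t) => [st|ts|->].
- near=> N; suff -> : grid_ceil (-1) T N s < grid_ceil (-1) T N t by [].
  by near: N; exact: grid_ceil_near_ltT.
- near=> N; suff -> : (grid_ceil (-1) T N s < grid_ceil (-1) T N t) = false by [].
  by apply/negbTE; rewrite -leNgt ltW//; near: N; exact: grid_ceil_near_ltT.
- by apply: nearW => N; rewrite ltxx.
Unshelve. all: by end_near. Qed.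

Lemma kdiag_regular : kernel_regular kdiag.
Proof.
split; first by exists 1 => t s; rewrite /kdiag; case: eqP; rewrite ?normr1 ?normr0.
move=> t s Dt Ds; rewrite /kdiag.
apply: (@cvg_near_cst _ _ _ _ _ _) => /=.
case: (ltgtP s t) => [st|ts|->].
- near=> N; suff h : grid_ceil (-1) T N s < grid_ceil (-1) T N t by rewrite lt_eqF.
  by near: N; exact: grid_ceil_near_ltT.
- near=> N; suff h : grid_ceil (-1) T N t < grid_ceil (-1) T N s by rewrite gt_eqF.
  by near: N; exact: grid_ceil_near_ltT.
- by apply: nearW => N; rewrite eqxx.
Unshelve. all: by end_near. Qed.

Lemma kabs_regular : kernel_regular kabs.
Proof.
split.
  by exists 1 => t s; rewrite /kabs ger0_norm ?expR_ge0// expN_le1.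
move=> t s Dt Ds; apply: exp_cvg; apply: cvg_norm; apply: cvgB; exact: grid_ceil_cvgT.
Qed.

Lemma kabsE t s : kabs t s = klow t s + (klow s t + kdiag t s).
Proof.
rewrite /kabs /klow /kdiag; case: (ltgtP s t) => [st|ts|->].
- by rewrite gtr0_norm ?subr_gt0// mul1r mul0r !addr0.
- by rewrite ltr0_norm ?subr_lt0// mul1r mul0r add0r addr0 opprB.
- by rewrite subrr normr0 mulr0 expR0 mul0r !add0r.
Qed.

Lemma kabs_sym t s : kabs t s = kabs s t. Proof. by rewrite /kabs distrC. Qed.

Lemma kdiag_sym t s : kdiag t s = kdiag s t. Proof. by rewrite /kdiag eq_sym. Qed.

(* With r the one-step decay factor, the quadratic form at step N dominates the
   square of E N = r * E (N - 1) + x N, because r <= 1. *)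
Lemma kabs_psd N a b (x : nat -> R) : a <= b ->
  0 <= \sum_(k < N) (\sum_(l < N) kabs (grid a b N.-1 k.+1) (grid a b N.-1 l.+1) * x l) * x k.
Proof.
move=> ab; pose h := (b - a) / N.-1.+1%:R.
have h0 : 0 <= h by rewrite divr_ge0 ?subr_ge0.
pose e k l : R := expR (- rho * `|k%:R * h - l%:R * h|).
have -> : \sum_(k < N) (\sum_(l < N) kabs (grid a b N.-1 k.+1) (grid a b N.-1 l.+1) * x l) * x k
   = \sum_(k < N) \sum_(l < N) e k l * x l * x k.
  apply: eq_bigr => k _; rewrite mulr_suml; apply: eq_bigr => l _.
  congr (expR (_ * `|_|) * _ * _).
  by rewrite /grid -/h -!natr1; ring.
(* The mesh depends on the number of nodes. Replacing it by an arbitrary nonnegative number keeps it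
   fixed during the induction. *)
move: N h h0 @e => n h h0 e.
pose r := expR (- rho * h).
have r1 : r <= 1 by rewrite expN_le1.
have r0 : 0 <= r by rewrite expR_ge0.
pose E := fix E n := if n is m.+1 then r * E m + x m else 0.
have eE m : \sum_(l < m) e m l * x l = r * E m.
  elim: m => [|m IH]; first by rewrite big_ord0 mulr0.
  rewrite big_ord_recr/= mulrDr; congr (_ + _).
    rewrite -IH mulr_sumr; apply: eq_bigr => l _; rewrite mulrA; congr (_ * _).
    rewrite /e /r -expRD; congr expR.
    have lm : l%:R <= m%:R :> R by rewrite ler_nat ltnW.
    have lm1 : l%:R <= m.+1%:R :> R by rewrite ler_nat ltnW// ltnS ltnW.
    rewrite -!mulrBl !normrM (ger0_norm h0) !ger0_norm ?subr_ge0//.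
    by rewrite -natr1; ring.
  congr (_ * _); rewrite /e /r; congr expR.
  by rewrite -mulrBl -natr1 addrAC subrr add0r mul1r ger0_norm.
suff : E n ^+ 2 <= \sum_(k < n) \sum_(l < n) e k l * x l * x k.
  by apply: le_trans; exact: sqr_ge0.
elim: n => [|n IH]; first by rewrite big_ord0 expr0n.
have S1 : \sum_(k < n.+1) \sum_(l < n.+1) e k l * x l * x k =
    \sum_(k < n) \sum_(l < n) e k l * x l * x k + 2 * (r * E n) * x n + x n ^+ 2.
  rewrite big_ord_recr/=; under eq_bigr do rewrite big_ord_recr/=.
  rewrite big_split/= big_ord_recr/= -mulr_suml eE.
  have -> : \sum_(i < n) e i n * x n * x i = r * E n * x n.
    rewrite -eE mulr_suml; apply: eq_bigr => l _.
    by rewrite /e distrC mulrAC.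
  have -> : e n n = 1 by rewrite /e subrr normr0 mulr0 expR0.
  ring.
rewrite S1 /=.
have : r ^+ 2 * E n ^+ 2 <= E n ^+ 2 by rewrite ler_piMl ?sqr_ge0// expr_le1.
move: IH; set Q := \sum_(k < n) _; move: (E n) (x n) => En xn IH h1.
have -> : (r * En + xn) ^+ 2 = r ^+ 2 * En ^+ 2 + 2 * (r * En) * xn + xn ^+ 2 by ring.
lra.
Qed.

Lemma dint_kabs_ge0 C F : bv_path C F -> 0 <= dint kabs F F.
Proof.
move=> gF; have := dint_cvg T0 gF gF kabs_regular.
move=> /cvgr_to_ge; apply; apply: nearW => N.
by apply: (@kabs_psd N.+1 (-1) T (dgrid (-1) T N F)); rewrite (le_trans _ T0)// lerN10.
Qed.

(** Distinct indices give distinct nodes because the grid starts at -1 < T, so each double sum is a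
    sum of squared increments. *)
Lemma dint_kdiag_ge0 C F : bv_path C F -> 0 <= dint kdiag F F.
Proof.
move=> gF; have := dint_cvg T0 gF gF kdiag_regular.
move=> /cvgr_to_ge; apply; apply: nearW => N.
rewrite /dsum; apply: sumr_ge0 => k _.
have T1 : -1 < T by rewrite (lt_le_trans _ T0)// ltrN10.
rewrite (bigD1 k)//= {1}/kdiag eqxx mul1r big1 ?addr0 -?expr2 ?sqr_ge0// => l lk.
rewrite /kdiag; case: eqP => [|_]; rewrite ?mul0r// => /addrI e; move: e.
have h0 : (T - -1) / N.+1%:R != 0 :> R.
  by rewrite gt_eqF// divr_gt0 ?subr_gt0 ?ltr0n.
move=> /(mulIf h0)/eqP; rewrite eqr_nat eqSS => /eqP kl; move: lk.
by rewrite -(inj_eq val_inj) /= kl eqxx.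
Qed.

End kernels.

(** * Definiteness of the exponential kernel *)

Section definiteness.
Context {R : realType}.
Implicit Types (a b s t M C : R) (F G g h : R -> R) (K : R -> R -> R).
Variables rho T : R.
Hypothesis T0 : 0 <= T.
Hypothesis rho0 : 0 < rho.
Local Notation mR := (measurableTypeR R).
Local Notation D := (`[0, T]%classic : set mR).
Local Notation dint := (@dint R T).
Local Notation kernel_regular := (@kernel_regular R T).
Local Notation klow := (@klow R rho).
Local Notation kabs := (@kabs R rho).
Local Notation kdiag := (@kdiag R).

(** A slice of a regular kernel is the pointwise limit of its step approximations on the grid, hence
    measurable. *)
Lemma kernel_bm K t : kernel_regular K -> 0 <= t <= T -> bm D (K t).
Proof.
move=> [[M KM] KK] Dt.
pose c N k := K (grid_ceil (-1) T N t) (grid (-1) T N k.+1).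
apply: (bm_cvg (g_ := fun N s => \sum_(j < N.+1) c N j *
    \1_(`]grid (-1) T N j, grid (-1) T N j.+1]%classic) s) (M := M)).
- by move=> N; case: (bm_cell T (c N) (-1) T N N.+1).
- move=> N s; rewrite /= in_itv/= => /andP[s0 sT].
  by rewrite (sum_grid_ceil _ (K (grid_ceil (-1) T N t)))// sT andbT (lt_le_trans _ s0)// ltrN10.
- move=> s; rewrite /= in_itv/= => /[dup] Ds /andP[s0 sT].
  have : K (grid_ceil (-1) T N t) (grid_ceil (-1) T N s) @[N --> \oo] --> K t s by exact: KK.
  apply: cvg_trans; apply: near_eq_cvg; apply: nearW => N.
  by rewrite (sum_grid_ceil _ (K (grid_ceil (-1) T N t)))// sT andbT (lt_le_trans _ s0)// ltrN10.
Qed.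

Lemma stint_sum C F n (f : 'I_n -> R -> R) : bv_path C F -> (forall k, bm D (f k)) ->
  stint T F (fun s => \sum_(k < n) f k s) = \sum_(k < n) stint T F (f k).
Proof.
move=> gF; suff : (forall k, bm D (f k)) ->
  bm D (fun s => \sum_(k < n) f k s) /\
  stint T F (fun s => \sum_(k < n) f k s) = \sum_(k < n) stint T F (f k).
  by move=> h bf; case: (h bf).
elim: n f => [|n IH] f bf.
  have -> : (fun s => \sum_(k < 0) f k s) = (fun=> 0).
    by apply: funext => s; rewrite big_ord0.
  rewrite big_ord0 stint0; split=> //; exact: bm_cst.
have [b1 s1] := IH (fun k => f (lift ord0 k)) (fun k => bf _).
have E : (fun s => \sum_(k < n.+1) f k s) =
  (fun s => 1 * f ord0 s + \sum_(k < n) f (lift ord0 k) s).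
  by apply: funext => s; rewrite big_ord_recl mul1r.
rewrite E; split; first by apply: bm_lin => //; exact: measurable_itv.
by rewrite (stint_lin gF)// s1 mul1r big_ord_recl.
Qed.

Lemma bv_path_left_cvg C F t : bv_path C F -> 0 <= t -> cvg (F x @[x --> t^'-]).
Proof.
move=> gF t0.
have mono (H : R -> R) : nondecreasing H -> cvg (H x @[x --> t^'-]).
  move=> nH; apply: nondecreasing_at_left_is_cvgr.
    by apply: nearW => x y z _ _; exact: nH.
  apply: nearW => x; exists (H t) => _ [y /= + <-].
  by rewrite in_itv/= => /andP[_ /ltW]; exact: nH.
have h : jpos F x - jneg F x @[x --> t^'-] --> lim (jpos F x @[x --> t^'-]) - lim (jneg F x
  @[x --> t^'-]).
  apply: cvgB; apply: mono; [exact: (jneg_nondecreasing (bv_pathN gF))|exact: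
    (jneg_nondecreasing gF)].
apply/cvg_ex; eexists; apply: cvg_trans h; apply: near_eq_cvg; near=> x.
rewrite -(jpos_jneg gF)//; near: x; apply: nbhs_left_ge.
by rewrite (lt_le_trans _ t0)// ltrN10.
Unshelve. all: by end_near. Qed.

(** The intervals ]t - 1/(n+1), t] shrink to the point t, and their integrals are increments whose
    limit is the jump. For t = 0 and n = 0 the left end is exactly -1, the earliest point that
    [stint_itv] allows. *)
Lemma stint_kdiag C F t : bv_path C F -> 0 <= t <= T -> stint T F (kdiag t) = jump F t.
Proof.
move=> gF /andP[t0 tT].
have h1 : stint T F (\1_(`]t - n.+1%:R^-1, t]%classic : set mR))
  @[n --> \oo] --> stint T F (kdiag t).
  apply: (stint_cvg (M := 1) gF T0).
  - by move=> n; apply: measurable_indic; exact: measurable_itv.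
  - by move=> n s _; rewrite indicE; case: (_ \in _); rewrite ?normr1 ?normr0.
  - move=> s _; rewrite /kdiag; apply: (@cvg_near_cst _ _ _ _ _ _) => /=.
    have E n : \1_(`]t - n.+1%:R^-1, t]%classic : set mR) s = (t - n.+1%:R^-1 < s <= t)%R%:R :> R.
      by rewrite indicE mem_setE in_itv.
    case: (ltgtP s t) => [st|ts|->].
    + have ts0 : 0 < t - s by rewrite subr_gt0.
      have H := near_infty_natSinv_lt (PosNum ts0).
      near=> n; rewrite E (ltW st) andbT (_ : (_ < _) = false)//.
      apply/negbTE; rewrite -leNgt lerBrDr -lerBrDl.
      by rewrite ltW//; near: n; exact: H.
    + by apply: nearW => n; rewrite E [s <= t]leNgt ts andbF.
    + by apply: nearW => n; rewrite indicE mem_setE in_itv/= lexx andbT ltrBlDr ltrDl invr_gt0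
        ltr0n.
have h2 : F t - F (t - n.+1%:R^-1) @[n --> \oo] --> jump F t.
  apply: cvgB; first exact: cvg_cst.
  have := bv_path_left_cvg gF t0; move=> /cvg_at_leftP; apply; split.
    by move=> n; rewrite ltrBlDr ltrDl invr_gt0 ltr0n.
  rewrite -[X in _ --> X](subr0 t); apply: cvgB; first exact: cvg_cst.
  exact: cvg_harmonic.
apply: (cvg_unique_ext h1 h2) => n.
rewrite (stint_itv gF)//; first by rewrite lerBrDr -lerBrDl opprK (le_trans _
  (_ : 1 <= _))// ?invf_le1 ?ler1n// lerDr.
by rewrite gerBl invr_ge0 ler0n.
Unshelve. all: by end_near. Qed.

(** Used twice: as the Cauchy-Schwarz argument for null vectors of a nonnegative form, and as the
    vanishing of the first variation at a minimum. *)
Lemma quad_ge0_lin (A B : R) : (forall c, 0 <= c ^+ 2 * A + 2 * c * B) -> B = 0.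
Proof.
(* With 1 + |A| in the denominator the case A = 0 needs no separate treatment, and the quadratic
   becomes a negative multiple of B^2. *)
move=> h; pose c := - B / (1 + `|A|).
have n0 : 0 < 1 + `|A| by rewrite ltr_pwDl.
have := h c; rewrite /c => hc.
have : 0 <= - (B ^+ 2 * (2 * (1 + `|A|) - A)).
  have e : - (B ^+ 2 * (2 * (1 + `|A|) - A)) =
     (1 + `|A|) ^+ 2 * ((- B / (1 + `|A|)) ^+ 2 * A + 2 * (- B / (1 + `|A|)) * B).
    by field; rewrite gt_eqF.
  by rewrite e mulr_ge0 ?sqr_ge0.
rewrite oppr_ge0 => h2; apply/eqP; rewrite -sqrf_eq0; apply/eqP.
have p : 0 < 2 * (1 + `|A|) - A by have := ler_norm A; have := normr_ge0 A; lra.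
by apply/eqP; rewrite eq_le sqr_ge0 andbT -(pmulr_lle0 _ p).
Qed.

Lemma dint_quad C C' K F G c : bv_path C F -> bv_path C' G -> kernel_regular K ->
  (forall t s, K t s = K s t) ->
  dint K (fun t => c * F t + G t) (fun t => c * F t + G t) =
  c ^+ 2 * dint K F F + 2 * c * dint K F G + dint K G G.
Proof.
move=> gF gG rK sK; have gL := bv_path_lin c gF gG.
rewrite (dint_linl T0 c gF gG gL rK) (dint_linr T0 c gF gF gG rK) (dint_linr T0 c gG gF gG rK).
have -> : dint K G F = dint K F G.
  rewrite -(dint_swap T0 gG gF rK); congr (dint _ _ _).
  by apply: funext => t; apply: funext => s.
by move: (dint K F F) (dint K F G) (dint K G G) => p q r; ring.
Qed.

(** A null vector of a nonnegative form is orthogonal to everything, in particular to [step b], and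
    pairing with [step b] is the potential at [b]. *)
Lemma dint_kabs_eq0 C F b : bv_path C F -> dint kabs F F = 0 -> 0 <= b <= T ->
  stint T F (kabs b) = 0.
Proof.
move=> gF F0 Db; have gS := bv_path_step (proj1 (andP Db)).
rewrite -(dint_step T0 Db gF (kabs_regular T rho0)).
apply: (@quad_ge0_lin (dint kabs (step b) (step b))) => c.
have := dint_kabs_ge0 T0 rho0 (bv_path_lin c gS gF).
by rewrite (dint_quad c gS gF (kabs_regular T rho0) (kabs_sym rho)) F0 addr0.
Qed.

Lemma dint_kdiag_step C F b : bv_path C F -> 0 <= b <= T -> dint kdiag (step b) F = jump F b.
Proof.
move=> gF Db; rewrite (dint_step T0 Db gF (kdiag_regular T)).
exact: (stint_kdiag gF Db).
Qed.

(** A Bessel inequality: expand the nonnegative form at [F] with its jump at [b] removed, which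
    leaves the form of [F] minus the squared jump. *)
Lemma jump_sq_le C F b : bv_path C F -> 0 <= b <= T -> jump F b ^+ 2 <= dint kdiag F F.
Proof.
move=> gF Db; have gS := bv_path_step (proj1 (andP Db)).
have := dint_kdiag_ge0 T0 (bv_path_lin (- jump F b) gS gF).
rewrite (dint_quad _ gS gF (kdiag_regular T) (@kdiag_sym R)) (dint_kdiag_step gS Db).
rewrite (dint_kdiag_step gF Db) jump_step eqxx.
by move: (dint kdiag F F) (jump F b) => p q /=; nra.
Qed.

(** The exponential seen from the left of [b], the point [b] included; its differences will isolate
    single cells. *)
Definition kle b s : R := klow b s + kdiag b s.

Lemma kleE b s : kle b s = (s <= b)%R%:R * expR (- rho * (b - s)).
Proof.
rewrite /kle /klow /kdiag; case: (ltgtP s b) => [sb|bs|->].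
- by rewrite addr0.
- by rewrite !mul0r add0r.
- by rewrite subrr mulr0 expR0 mul0r add0r mul1r.
Qed.

Lemma kle_bm b : 0 <= b <= T -> bm D (kle b).
Proof.
move=> Db; have h := kernel_bm (kernel_regular_lin 1 (klow_regular T rho0) (kdiag_regular T)) Db.
rewrite (_ : kle b = (fun s => 1 * klow b s + kdiag b s))//.
by apply: funext => s; rewrite mul1r.
Qed.

(** The combination of the potentials at b and b + h in which the parts to the right of b + h cancel
    is, once normalized, equal to e^(-rho (b - s)) for s <= b. As h tends to 0 it converges
    boundedly to [kle b]. *)
Lemma stint_kle_eq0 C F b : bv_path C F -> dint kabs F F = 0 -> 0 <= b <= T ->
  stint T F (kle b) = 0.
Proof.
move=> gF F0 /[dup] Db /andP[b0 bT].
(* There is no room to the right of T, but on [0, T] the kernels [kle] and [kabs] at T coincide. *)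
have [->|bT'] := eqVneq b T.
  rewrite -[RHS](dint_kabs_eq0 gF F0 (b := T)) ?lexx ?T0//.
  apply: eq_stj => s /andP[s0 sT].
  by rewrite kleE sT mul1r /kabs ger0_norm ?subr_ge0.
have {}bT' : 0 < T - b by rewrite subr_gt0 lt_neqAle bT' bT.
pose h n := (T - b) / n.+1%:R.
have h0 n : 0 < h n by rewrite divr_gt0.
have hT n : 0 <= b + h n <= T.
  rewrite addr_ge0 ?(ltW (h0 n))//= -lerBrDl /h ler_pdivrMr// ler_peMr ?ler1n//.
  exact: ltW.
(* For s <= b the combination equals e^(-rho (b - s)) (1 - e^(-2 rho h)), whence this
   normalization. *)
pose c n := (1 - expR (- rho * (2 * h n)))^-1.
have c0 n : 0 < 1 - expR (- rho * (2 * h n)).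
  by rewrite subr_gt0 -expR0 ltr_expR mulNr oppr_lt0 !mulr_gt0.
pose g n s := c n * (- expR (- rho * h n) * kabs (b + h n) s + kabs b s).
have bK u : 0 <= u <= T -> bm D (kabs u).
  by move=> Du; exact: (kernel_bm (kabs_regular T rho0) Du).
have bg0 n : bm D (fun s => - expR (- rho * h n) * kabs (b + h n) s + kabs b s).
  by apply: bm_lin; apply: bK.
have sg n : stint T F (g n) = 0.
  have -> : g n = (fun s => c n * (- expR (- rho * h n) * kabs (b + h n) s + kabs b s) + 0).
    by apply: funext => s; rewrite addr0.
  rewrite (stint_lin gF T0 (c n) (bg0 n) (_ : bm D (fun=> 0))); last first.
    exact: bm_cst.
  rewrite stint0 addr0 (stint_lin gF T0 _ (bK _ (hT n)) (bK _ Db)).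
  by rewrite (dint_kabs_eq0 gF F0 (hT n)) (dint_kabs_eq0 gF F0 Db) mulr0 addr0 mulr0.
have gl n s : s <= b -> g n s = expR (- rho * (b - s)).
  move=> sb; rewrite /g /kabs (ger0_norm (_ : 0 <= b - s)) ?subr_ge0//.
  rewrite ger0_norm; last by rewrite subr_ge0 (le_trans sb)// lerDl ltW.
  have -> : - rho * (b + h n - s) = - rho * h n + - rho * (b - s) by ring.
  rewrite expRD mulrA; have -> : - expR (- rho * h n) * expR (- rho * h n) =
    - expR (- rho * (2 * h n)).
    by rewrite mulNr -expRD; congr (- expR _); ring.
  rewrite -{2}[expR (- rho * (b - s))]mul1r -mulrDl addrC mulrA mulVf ?mul1r//.
  by rewrite gt_eqF.
have gr n s : b + h n <= s -> g n s = 0.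
  move=> sb; rewrite /g /kabs ler0_norm ?subr_le0// ler0_norm; last first.
    by rewrite subr_le0 (le_trans _ sb)// lerDl ltW.
  rewrite mulNr -expRD (_ : - rho * h n + _ = - rho * - (b - s)); last by ring.
  by rewrite addNr mulr0.
have gm n s : b <= s <= b + h n -> 0 <= g n s <= 1.
  move=> /andP[bs sb].
  have -> : g n s = c n * (expR (- rho * (s - b)) * (1 - expR (- rho * (2 * (b + h n - s))))).
    rewrite /g /kabs ger0_norm ?subr_ge0// distrC ger0_norm ?subr_ge0//.
    congr (_ * _); rewrite [RHS]mulrBr mulr1 [LHS]addrC [X in _ + X = _]mulNr; congr (_ - _).
    by rewrite -!expRD; congr expR; ring.
  have e1 : expR (- rho * (2 * (b + h n - s))) <= 1.
    by rewrite expN_le1// mulr_ge0// subr_ge0.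
  rewrite mulr_ge0 ?invr_ge0 ?(ltW (c0 n))//=; last first.
    by rewrite mulr_ge0 ?expR_ge0// subr_ge0.
  rewrite mulrC ler_pdivrMr// mul1r.
  apply: (@le_trans _ _ (1 * (1 - expR (- rho * (2 * (b + h n - s)))))).
    by rewrite ler_wpM2r ?subr_ge0// expN_le1// subr_ge0.
  by rewrite mul1r lerD2l lerN2 ler_expR !mulNr lerN2 ler_wpM2l ?(ltW rho0)//; lra.
have h1 : stint T F (g n) @[n --> \oo] --> stint T F (kle b).
  apply: (stint_cvg (M := 1) gF T0).
  - move=> n; have [] : bm D (g n) => //.
    rewrite (_ : g n = (fun s => c n * (- expR (- rho * h n) * kabs (b + h n) s + kabs b s) + 0)).
      apply: bm_lin; first exact: bg0.
      exact: bm_cst.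
    by apply: funext => s; rewrite addr0.
  - move=> n s _; have [sb|bs] := leP s b.
      by rewrite gl// ger0_norm ?expR_ge0// expN_le1// subr_ge0.
    have [sb|sb] := leP s (b + h n).
      by have /andP[g0 g1] := gm n s (introT andP (conj (ltW bs) sb)); rewrite ger0_norm.
    by rewrite gr ?normr0// ltW.
  - move=> s _; rewrite kleE; apply: (@cvg_near_cst _ _ _ _ _ _) => /=.
    have [sb|bs] := leP s b; first by apply: nearW => n; rewrite gl// mul1r.
    have bs0 : 0 < s - b by rewrite subr_gt0.
    have H := cvgr_le _ (mesh_cvg0 (T - b)) _ bs0.
    near=> n; rewrite gr ?mul0r// -lerBrDl.
    by near: n; exact: H.
apply: (cvg_unique_ext h1 (cvg_cst 0)) => n; exact: sg.
Unshelve. all: by end_near. Qed.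

End definiteness.

Section constancy.
Context {R : realType}.
Implicit Types (a b s t M C : R) (F G g h : R -> R) (K : R -> R -> R).
Variables rho T : R.
Hypothesis T0 : 0 <= T.
Hypothesis rho0 : 0 < rho.
Local Notation mR := (measurableTypeR R).
Local Notation D := (`[0, T]%classic : set mR).
Local Notation dint := (@dint R T).
Local Notation kabs := (@kabs R rho).
Local Notation kdiag := (@kdiag R).
Local Notation kle := (@kle R rho).

Lemma kle_lt0 b s : b < 0 -> 0 <= s -> kle b s = 0.
Proof. by move=> b0 s0; rewrite kleE leNgt (lt_le_trans b0 s0) mul0r. Qed.

(** The difference [f] of two discounted kernels [kle] lives on one cell. Summed over the cells of
    ]-1, b], these converge to the indicator of that interval, whose integral is F b - F (-1). *)
Lemma dint_kabs_eq0_const C F b : bv_path C F -> dint kabs F F = 0 -> 0 <= b <= T ->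
  F b = F (-1).
Proof.
move=> gF F0 /andP[b0 bT]; have b1 : -1 < b by rewrite (lt_le_trans _ b0)// ltrN10.
have kbm u : u <= T -> bm D (kle u).
  move=> uT; have [u0|u0] := leP 0 u; first by apply: (kle_bm rho0); rewrite u0 uT.
  apply: (bm_cvg (g_ := fun _ _ => 0) (M := 0)).
  - by move=> _; exact: measurable_cst.
  - by move=> _ t _; rewrite normr0.
  - by move=> s; rewrite /= in_itv/= => /andP[s0 _]; rewrite kle_lt0//; exact: cvg_cst.
(* The grid starts at -1, so nodes may be negative; there [kle u] vanishes on [0, T]. *)
have k0 u : u <= T -> stint T F (kle u) = 0.
  move=> uT; have [u0|u0] := leP 0 u; first by apply: (stint_kle_eq0 T0 rho0 gF F0); rewrite u0 uT.
  rewrite -(stint0 T F); apply: eq_stj => s /andP[s0 _].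
  by rewrite kle_lt0.
pose u N k := grid (-1) b N k.
have uT N k : (k <= N.+1)%N -> u N k <= T.
  move=> kN; rewrite (le_trans _ bT)// -[leRHS](gridN (-1) b N).
  by apply: le_grid => //; exact: ltW.
pose f N k s := - expR (- rho * (u N k.+1 - u N k)) * kle (u N k) s + kle (u N k.+1) s.
have fE N k s : f N k s = expR (- rho * (u N k.+1 - s)) * \1_(`]u N k, u N k.+1]%classic) s.
  rewrite /f !kleE indicE mem_setE in_itv/=.
  have uu : u N k <= u N k.+1 by apply: le_grid => //; exact: ltW.
  have -> : - expR (- rho * (u N k.+1 - u N k)) * ((s <= u N k)%R%:R * expR (- rho * (u N k - s)))
     = - ((s <= u N k)%R%:R * expR (- rho * (u N k.+1 - s))).
    rewrite mulNr mulrCA -expRD; congr (- (_ * expR _)); ring.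
  have [su|us] := leP s (u N k).
    by rewrite (le_trans su uu) !mul1r mulr0 addNr.
  by rewrite mul0r oppr0 add0r mulrC.
have bf N k : (k <= N)%N -> bm D (f N k).
  by move=> kN; apply: bm_lin; apply: kbm; apply: uT; rewrite // ltnW.
have sf N : stint T F (fun s => \sum_(k < N.+1) f N k s) = 0.
  rewrite (stint_sum T0 gF (f := fun k : 'I_N.+1 => f N k) (fun k => bf N k
    (ltn_ord k))) big1// => k _.
  have kN := ltn_ord k.
  rewrite (stint_lin gF T0); [|by apply: kbm; apply: uT; rewrite ltnW..|by apply: kbm; apply: uT].
  by rewrite !k0 ?uT ?mulr0 ?addr0// ltnW.
have val N s : 0 <= s -> \sum_(k < N.+1) f N k s =
    if s <= b then expR (- rho * (grid_ceil (-1) b N s - s)) else 0.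
  move=> s0; under eq_bigr do rewrite fE.
  have [sb|bs] := leP s b.
    rewrite (sum_grid_ceil N (fun v => expR (- rho * (v - s))))// sb andbT.
    by rewrite (lt_le_trans _ s0)// ltrN10.
  rewrite (sum_cell_out N (fun k => expR (- rho * (grid (-1) b N k.+1 - s))))//.
    exact: ltW.
  by rewrite [s <= b]leNgt bs andbF.
have h1 : stint T F (fun s => \sum_(k < N.+1) f N k s) @[N --> \oo] -->
    stint T F (\1_(`]-1, b]%classic : set mR)).
  apply: (stint_cvg (M := 1) gF T0).
  - move=> N; apply: measurable_sum => k.
    by case: (bf N k (ltn_ord k)).
  - move=> N s; rewrite /= in_itv/= => /andP[s0 _]; rewrite val//.
    case: ifPn => [sb|_]; last by rewrite normr0.
    rewrite ger0_norm ?expR_ge0// (expN_le1 rho0)// subr_ge0 grid_ceil_ge// sb andbT.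
    by rewrite (lt_le_trans _ s0)// ltrN10.
  - move=> s; rewrite /= in_itv/= => /andP[s0 _].
    under eq_fun do rewrite (val _ _ s0).
    have s1 : -1 < s by rewrite (lt_le_trans _ s0)// ltrN10.
    rewrite indicE mem_setE in_itv/= s1/=.
    have [sb|bs] := leP s b; last exact: cvg_cst.
    rewrite (_ : true%:R = expR (- rho * (s - s))); last by rewrite subrr mulr0 expR0.
    by apply: exp_cvg; apply: cvgB; [apply: grid_ceil_cvg; rewrite s1 sb|exact: cvg_cst].
have : stint T F (\1_(`]-1, b]%classic : set mR)) = 0.
  by apply: (cvg_unique_ext h1 (cvg_cst 0)) => N; exact: sf.
by rewrite (stint_itv gF (lexx _) (ltW b1) bT) => /subr0_eq.
Qed.

(** * Jump sums as integrals against the diagonal kernel *)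

Lemma stint_seq C F (s : seq R) (c : R -> R) : bv_path C F -> {in s, forall t, 0 <= t <= T} ->
  bm D (fun u => \sum_(t <- s) c t * kdiag t u) /\
  stint T F (fun u => \sum_(t <- s) c t * kdiag t u) = \sum_(t <- s) c t * jump F t.
Proof.
move=> gF; elim: s => [_|t s IH ts].
  have -> : (fun u => \sum_(t <- [::]) c t * kdiag t u) = (fun=> 0).
    by apply: funext => u; rewrite big_nil.
  rewrite stint0 big_nil; split=> //; exact: bm_cst.
have [b1 s1] := IH (fun u us => ts u (mem_behead (s := t :: s) us)).
have Dt : 0 <= t <= T by apply: ts; rewrite mem_head.
have bt := kernel_bm (kdiag_regular T) Dt.
have -> : (fun u => \sum_(i <- t :: s) c i * kdiag i u) =
  (fun u => c t * kdiag t u + \sum_(i <- s) c i * kdiag i u).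
  by apply: funext => u; rewrite big_cons.
split; first exact: bm_lin.
by rewrite (stint_lin gF T0)// s1 (stint_kdiag T0 gF Dt) big_cons.
Qed.

Lemma sum_kdiag (s : seq R) (c : R -> R) u : uniq s ->
  \sum_(t <- s) c t * kdiag t u = c u * (u \in s)%:R.
Proof.
move=> us; have [uin|unin] := boolP (u \in s).
  rewrite (bigD1_seq u)//= big1 ?addr0 /kdiag ?eqxx// => t tu.
  by rewrite eq_sym (negbTE tu) mulr0.
rewrite mulr0 big_seq big1// => t ts; rewrite /kdiag.
by case: eqP => [e|_]; rewrite ?mulr0//; move: unin; rewrite e ts.
Qed.

(** Attach to each chosen point the sign of the jump: the sum of absolute jumps is then the integral
    of a function bounded by 1, so [stint_bound] applies. *)
Lemma sum_jump_bound C F : bv_path C F -> exists B : R, forall s : seq R, uniq s ->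
  {in s, forall t, 0 <= t <= T} -> \sum_(t <- s) `|jump F t| <= B.
Proof.
move=> gF; have [B hB] := stint_bound gF T0; exists B => s us sD.
have [b1 s1] := stint_seq (fun t => Num.sg (jump F t)) gF sD.
have := hB _ b1; rewrite s1 => h.
apply: (le_trans _ (h _)); last first.
  move=> u _; rewrite sum_kdiag// normrM mulr_ile1//.
    by rewrite normr_sg; case: eqP.
  by case: (u \in s); rewrite ?normr1 ?normr0.
rewrite (le_trans _ (ler_norm _))// le_eqVlt; apply/orP; left; apply/eqP.
by apply: eq_bigr => t _; rewrite -normrEsg.
Qed.

(** Each of these jumps exceeds 1/(n+1), so at most B (n+1) of them fit under the bound [B] on the
    sum of absolute jumps. *)
Lemma fin_set_bigjump C F n : bv_path C F ->
  finite_set [set t | 0 <= t <= T /\ n.+1%:R^-1 < `|jump F t|].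
Proof.
move=> gF; have [B hB] := sum_jump_bound gF.
apply: contrapT => /(infinite_set_fset (Num.truncn (B * n.+1%:R)).+1)[X XA cX].
have XD : {in (X : seq R), forall t, 0 <= t <= T}.
  by move=> t tX; have [] := XA t tX.
have h := hB X (fset_uniq X) XD.
have : \sum_(t <- X) n.+1%:R^-1 <= \sum_(t <- X) `|jump F t|.
  rewrite big_seq [leRHS]big_seq; apply: ler_sum => t tX.
  by have [_ /ltW] := XA t tX.
rewrite big_const_seq count_predT iter_addr_0 => h2.
have B0 : 0 <= B by have := hB [::] isT; rewrite big_nil; apply.
have := le_trans h2 h; rewrite -(mulr_natl n.+1%:R^-1) ler_pdivrMr ?ltr0n//.
have := truncnS_gt (B * n.+1%:R); rewrite -(ler_nat R) in cX => h3 h4.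
by have := lt_le_trans h3 (le_trans cX h4); rewrite ltxx.
Qed.

(** An unordered sum over an uncountable interval becomes the limit of a sequence of finite sums:
    the sets of jumps above 1/(n+1) increase and exhaust every point where [f] is nonzero. *)
Lemma esum_bigjump_cvg C G (f : R -> R) B : bv_path C G -> (forall t, 0 <= f t) ->
  (forall t, jump G t = 0 -> f t = 0) ->
  (forall s : seq R, uniq s -> {in s, forall t, 0 <= t <= T} -> \sum_(t <- s) f t <= B) ->
  \sum_(t <- fset_set [set t | 0 <= t <= T /\ n.+1%:R^-1 < `|jump G t|]) f t
    @[n --> \oo] --> fine (\esum_(t in D) (f t)%:E).
Proof.
move=> gG f0 fG fB; pose A n := [set t | 0 <= t <= T /\ n.+1%:R^-1 < `|jump G t|].
have fA n : finite_set (A n) by exact: (fin_set_bigjump n gG).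
have AS m n : (m <= n)%N -> A m `<=` A n.
  move=> mn t [Dt h]; split=> //; apply: le_lt_trans h.
  by rewrite lef_pV2 ?posrE ?ltr0n// ler_nat.
pose p n := \sum_(t <- fset_set (A n)) f t.
have pE n : (p n)%:E = (\sum_(t \in A n) (f t)%:E)%E.
  by rewrite fsbig_finite// sumEFin.
have le_sub X Y : finite_set X -> finite_set Y -> X `<=` Y ->
    (\sum_(t \in X) (f t)%:E <= \sum_(t \in Y) (f t)%:E)%E.
  move=> fX fY XY; apply: lee_fsum_nneg_subset => //.
    by move=> t /set_mem/XY/mem_set.
  by move=> t _; rewrite lee_fin.
have p_nd : nondecreasing_seq p.
  by move=> m n mn; rewrite -lee_fin !pE; apply: le_sub => //; exact: AS.
have pB n : p n <= B.
  apply: fB; first exact: fset_uniq.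
  by move=> t; rewrite in_fset_set// inE => -[].
have pcv : cvgn p.
  by apply: nondecreasing_is_cvgn => //; exists B => _ [n _ <-].
suff -> : (\esum_(t in D) (f t)%:E)%E = (limn p)%:E by exact: pcv.
have le1 : (\esum_(t in D) (f t)%:E <= (limn p)%:E)%E.
  apply: ge_ereal_sup => _ [X [fX XD] <-].
  have [n Xn] : exists n, X `<=` A n `|` [set t | f t = 0].
    have : forall s : seq R, {in s, forall t, 0 <= t <= T} ->
        exists n, {in s, forall t, (A n `|` [set t | f t = 0]) t}.
      elim=> [|t s IH] sD; first by exists 0%N.
      have [n hn] := IH (fun u us => sD u (mem_behead (s := t :: s) us)).
      have [jt|jt] := eqVneq (jump G t) 0.
        exists n => u; rewrite inE => /predU1P[->|us]; last exact: hn.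
        by right; exact: fG.
      have j0 : 0 < `|jump G t| by rewrite normr_gt0.
      have [m _ /(_ m (leqnn _)) mj] := near_infty_natSinv_lt (PosNum j0).
      exists (maxn m n) => u; rewrite inE => /predU1P[->|us].
        left; apply: (AS m); first exact: leq_maxl.
        by split=> //; apply: sD; rewrite mem_head.
      have [h|h] := hn u us; [left|by right].
      by apply: (AS n) => //; exact: leq_maxr.
    move=> /(_ (fset_set X))[|n hn].
      by move=> t; rewrite in_fset_set// inE => /XD; rewrite /= in_itv.
    exists n => t Xt; apply: hn; rewrite in_fset_set//; exact: mem_set.
  apply: (@le_trans _ _ (p n)%:E); last first.
    by rewrite lee_fin; exact: nondecreasing_cvgn_le.
  have fXA : finite_set (X `|` A n) by rewrite finite_setU.
  rewrite pE; apply: (le_trans (le_sub X (X `|` A n) fX fXA (@subsetUl _ _ _))).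
  rewrite le_eqVlt; apply/orP; left; apply/eqP/esym.
  apply: fsbig_widen; first exact: subsetUr.
  move=> t [[Xt|At] nA] /=; last by [].
  by have [//|->] := Xn t Xt.
have pl n : ((p n)%:E <= \esum_(t in D) (f t)%:E)%E.
  apply: ereal_sup_ubound; exists (A n); last by rewrite pE.
  by split=> // t [Dt _]; rewrite /= in_itv.
have fin : (\esum_(t in D) (f t)%:E)%E \is a fin_num.
  rewrite ge0_fin_numE ?(le_lt_trans le1) ?ltry//.
  by apply: esum_ge0 => t _; rewrite lee_fin.
apply/eqP; rewrite eq_le le1/= -(fineK fin) lee_fin.
apply: limr_le => //; apply: nearW => n.
by rewrite -lee_fin fineK.
Qed.

(** Keep only the jumps of [G] above 1/(n+1). Integrating this finite function against [F] gives the
    truncated jump sum, and dominated convergence gives the integral of the full jump function,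
    which is the inner integral of [kdiag]. *)
Lemma rsum_jump C C' F G : bv_path C F -> bv_path C' G ->
  rsum `[0, T]%classic (fun t => jump F t * jump G t) = dint kdiag F G.
Proof.
move=> gF gG; have [BF hF] := sum_jump_bound gF; have [BG hG] := sum_jump_bound gG.
have jG t : 0 <= t <= T -> `|jump G t| <= BG.
  move=> Dt; have := hG [:: t] isT; rewrite big_seq1; apply.
  by move=> u; rewrite inE => /eqP ->.
have BG0 : 0 <= BG by apply: le_trans (jG 0 _); rewrite ?lexx.
pose A n := [set t | 0 <= t <= T /\ n.+1%:R^-1 < `|jump G t|].
have fA n : finite_set (A n) by exact: (fin_set_bigjump n gG).
have AD n : {in (fset_set (A n) : seq R), forall t, 0 <= t <= T}.
  by move=> t; rewrite in_fset_set// inE => -[].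
have lim (f : R -> R) : (forall t, 0 <= f t) ->
    (forall t, f t <= `|jump F t| * `|jump G t|) ->
    \sum_(t <- fset_set (A n)) f t @[n --> \oo] --> fine (\esum_(t in D) (f t)%:E).
  move=> f0 fle; apply: (esum_bigjump_cvg (B := BF * BG) gG) => //.
    move=> t jt; apply/eqP; rewrite eq_le f0 andbT.
    by rewrite (le_trans (fle t))// jt normr0 mulr0.
  move=> s us sD; apply: (@le_trans _ _ (\sum_(t <- s) `|jump F t| * BG)).
    rewrite big_seq [leRHS]big_seq; apply: ler_sum => t ts.
    by rewrite (le_trans (fle t))// ler_wpM2l// jG// sD.
  by rewrite -mulr_suml ler_wpM2r// hF.
pose a t := jump F t * jump G t.
have lp : \sum_(t <- fset_set (A n)) Num.max (a t) 0 @[n --> \oo] -->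
    fine (\esum_(t in D) (Num.max (a t) 0)%:E).
  apply: lim => t; first by rewrite le_max lexx orbT.
  by rewrite ge_max -normrM ler_norm normr_ge0.
have ln : \sum_(t <- fset_set (A n)) Num.max (- a t) 0 @[n --> \oo] -->
    fine (\esum_(t in D) (Num.max (- a t) 0)%:E).
  apply: lim => t; first by rewrite le_max lexx orbT.
  by rewrite ge_max -normrM -normrN ler_norm normr_ge0.
have h1 : \sum_(t <- fset_set (A n)) Num.max (a t) 0 -
    \sum_(t <- fset_set (A n)) Num.max (- a t) 0 @[n --> \oo] -->
    rsum `[0, T]%classic a by apply: cvgB.
pose g n u := \sum_(t <- fset_set (A n)) jump G t * kdiag t u.
have gE n u : g n u = jump G u * (u \in (fset_set (A n) : seq R))%:R.
  by rewrite /g sum_kdiag ?fset_uniq.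
have h2 : stint T F (g n) @[n --> \oo] --> stint T F (jump G).
  apply: (stint_cvg (M := BG) gF T0).
  - by move=> n; have [[]] := stint_seq (jump G) gF (@AD n).
  - move=> n u; rewrite /= in_itv/= => Du; rewrite gE normrM.
    case: (_ \in _); rewrite ?normr1 ?mulr1 ?normr0 ?mulr0//; exact: jG.
  - move=> u; rewrite /= in_itv/= => Du; apply: (@cvg_near_cst _ _ _ _ _ _) => /=.
    have [j0|j0] := eqVneq (jump G u) 0; first by apply: nearW => n; rewrite gE j0 mul0r.
    have j1 : 0 < `|jump G u| by rewrite normr_gt0.
    have H := near_infty_natSinv_lt (PosNum j1).
    near=> n; rewrite gE in_fset_set// mem_set ?mulr1//; split=> //.
    by near: n; exact: H.
have -> : dint kdiag F G = stint T F (jump G).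
  by rewrite dint.unlock; apply: eq_stj => t Dt; exact: (stint_kdiag T0 gG Dt).
apply: (cvg_unique_ext h1 h2) => n.
have [_ ->] := stint_seq (jump G) gF (@AD n).
rewrite -sumrB; apply: eq_bigr => t _; rewrite [RHS]mulrC -/(a t).
by case: (leP (a t) 0) => at0; [rewrite max_l ?oppr_ge0// sub0r opprK|rewrite max_r ?subr0//
  oppr_le0 ltW].
Unshelve. all: by end_near. Qed.

End constancy.

Definition pathcost (R : realType) (rho theta T : R) (F G : R -> R) : R :=
  2^-1 * dint T (kabs rho) F F + (dint T (klow rho) F G + 2^-1 * dint T (@kdiag R) F G)
  + theta * dint T (@kdiag R) F F.

Lemma pathcostE (R : realType) (rho theta T C C' : R) (F G : R -> R) : 0 <= T ->
  bv_path C F -> bv_path C' G ->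
  2^-1 * sint F (fun t => sint F (fun s => expR (- rho * `|t - s|)) `[0, T]%classic)
               `[0, T]%classic
  + sint F (fun t => sint G (fun s => expR (- rho * (t - s))) `[0, t[%classic) `[0, T]%classic
  + 2^-1 * rsum `[0, T]%classic (fun t => jump F t * jump G t)
  + theta * rsum `[0, T]%classic (fun t => jump F t ^+ 2) = pathcost rho theta T F G.
Proof.
move=> T0 gF gG.
have -> : (fun t => jump F t ^+ 2) = (fun t => jump F t * jump F t).
  by apply: funext => t; rewrite expr2.
rewrite (rsum_jump T0 gF gG) (rsum_jump T0 gF gF) /pathcost.
have e1 : sint F (fun t => sint F (fun s => expR (- rho * `|t - s|)) `[0, T]%classic)
    `[0, T]%classic = dint T (kabs rho) F F by rewrite dint.unlock stint.unlock.
have e2 : sint F (fun t => sint G (fun s => expR (- rho * (t - s))) `[0, t[%classic)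
    `[0, T]%classic = dint T (klow rho) F G.
  rewrite dint.unlock stint.unlock; apply: eq_sint => t /andP[t0 tT].
  exact: sint_co.
by rewrite -e1 -e2 [in RHS]addrA.
Qed.

Lemma costE (R : realType) d (Omega : measurableType d) (rho theta T x y C C' : R)
    (X Y : R -> Omega -> R) w : 0 <= T ->
  bv_path C (Defs.path x X w) -> bv_path C' (Defs.path y Y w) ->
  cost rho theta T x y X Y w = pathcost rho theta T (Defs.path x X w) (Defs.path y Y w).
Proof. by move=> T0 gX gY; exact (pathcostE rho theta T0 gX gY). Qed.

(** * First variation of the cost *)

Section first_order.
Context {R : realType}.
Implicit Types (a b s t M C c : R) (F G g h H X Y Z : R -> R) (K : R -> R -> R).
Variables rho T : R.
Hypothesis T0 : 0 <= T.
Hypothesis rho0 : 0 < rho.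
Local Notation mR := (measurableTypeR R).
Local Notation D := (`[0, T]%classic : set mR).
Local Notation dint := (@dint R T).
Local Notation kabs := (@kabs R rho).
Local Notation klow := (@klow R rho).
Local Notation kdiag := (@kdiag R).

(** The Gateaux derivative of a player's own cost at [X] in the direction [H], the opponent's path
    [Y] being held fixed. *)
Definition dpathcost theta H X Y : R :=
  dint kabs H X + (dint klow H Y + 2^-1 * dint kdiag H Y) + 2 * theta * dint kdiag H X.

Let rA := kabs_regular T rho0.
Let rL := klow_regular T rho0.
Let rD := @kdiag_regular R T.

Lemma pathcost_expand theta c C1 C2 C3 H X Y : bv_path C1 H -> bv_path C2 X -> bv_path C3 Y ->
  pathcost rho theta T (fun t => c * H t + X t) Y =
  pathcost rho theta T X Y + c * dpathcost theta H X Y +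
  c ^+ 2 * (2^-1 * dint kabs H H + theta * dint kdiag H H).
Proof.
move=> gH gX gY; rewrite /pathcost /dpathcost.
rewrite (dint_quad T0 c gH gX rA (kabs_sym rho)) (dint_quad T0 c gH gX rD (@kdiag_sym R)).
rewrite (dint_linl T0 c gH gX gY rL) (dint_linl T0 c gH gX gY rD).
move: (dint kabs H H) (dint kabs H X) (dint kabs X X) (dint klow H Y)
  (dint klow X Y) => a1 a2 a3 a4 a5.
move: (dint kdiag H H) (dint kdiag H X) (dint kdiag X X) (dint kdiag H Y)
  (dint kdiag X Y) => b1 b2 b3 b4 b5.
by field.
Qed.

(* The sum (sg = 1) and the difference (sg = -1) of the two players' first-order
   conditions decouple: they involve X + sg Y only, through this kernel. *)
Definition ksg sg theta t s : R :=
  sg * (klow t s + 2^-1 * kdiag t s) + (kabs t s + 2 * theta * kdiag t s).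

Lemma ksg_regular sg theta : kernel_regular T (ksg sg theta).
Proof.
have h1 : kernel_regular T (fun t s => 2^-1 * kdiag t s + klow t s).
  exact: kernel_regular_lin.
have h2 : kernel_regular T (fun t s => 2 * theta * kdiag t s + kabs t s).
  exact: kernel_regular_lin.
rewrite (_ : ksg sg theta = (fun t s => sg * (2^-1 * kdiag t s + klow t s) +
    (2 * theta * kdiag t s + kabs t s))); first exact: kernel_regular_lin.
by apply: funext => t; apply: funext => s; rewrite /ksg; ring.
Qed.

Lemma dint_ksg sg theta C1 C2 F G : bv_path C1 F -> bv_path C2 G ->
  dint (ksg sg theta) F G = sg * (dint klow F G + 2^-1 * dint kdiag F G) +
    (dint kabs F G + 2 * theta * dint kdiag F G).
Proof.
move=> gF gG.
have h1 : kernel_regular T (fun t s => 2^-1 * kdiag t s + klow t s).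
  exact: kernel_regular_lin.
have h2 : kernel_regular T (fun t s => 2 * theta * kdiag t s + kabs t s).
  exact: kernel_regular_lin.
have -> : dint (ksg sg theta) F G = dint (fun t s => sg * (2^-1 * kdiag t s + klow t s) +
    (2 * theta * kdiag t s + kabs t s)) F G.
  by apply: (eq_dint F G) => t s _ _; rewrite /ksg; ring.
rewrite (dint_linK T0 sg gF gG h1 h2) (dint_linK T0 _ gF gG rD rL) (dint_linK T0 _ gF gG rD rA).
by rewrite [2^-1 * _ + _]addrC [2 * theta * _ + _]addrC.
Qed.

(** The own-cost kernel acts on X and the cross kernel on Y, with the roles exchanged in the second
    summand. Writing the first cross term with the factor sg^2 = 1 makes both act on sg Y + X. *)
Lemma dpathcost_ksg sg theta C1 C2 C3 H X Y : sg ^+ 2 = 1 ->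
  bv_path C1 H -> bv_path C2 X -> bv_path C3 Y ->
  dpathcost theta H X Y + sg * dpathcost theta H Y X = dint (ksg sg theta) H (fun t => sg * Y t +
    X t).
Proof.
move=> sg2 gH gX gY; rewrite (dint_ksg _ _ gH (bv_path_lin sg gY gX)) /dpathcost.
rewrite (dint_linr T0 sg gH gY gX rL) (dint_linr T0 sg gH gY gX rD) (dint_linr T0 sg gH gY gX rA).
move: (dint kabs H X) (dint kabs H Y) (dint klow H X) (dint klow H Y) (dint kdiag H X)
  (dint kdiag H Y).
move=> a1 a2 a3 a4 a5 a6.
have -> : sg * (sg * a4 + a3 + 2^-1 * (sg * a6 + a5)) =
  sg ^+ 2 * (a4 + 2^-1 * a6) + sg * (a3 + 2^-1 * a5) by ring.
by rewrite sg2; ring.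
Qed.

Lemma dint_klow_diag C F : bv_path C F -> dint kabs F F = 2 * dint klow F F + dint kdiag F F.
Proof.
move=> gF; have rL' := kernel_regular_swap rL.
have r1 : kernel_regular T (fun t s => 1 * klow s t + kdiag t s) by exact: kernel_regular_lin.
have -> : dint kabs F F = dint (fun t s => 1 * klow t s + (1 * klow s t + kdiag t s)) F F.
  by apply: (eq_dint F F) => t s _ _; rewrite kabsE !mul1r.
rewrite (dint_linK T0 _ gF gF rL r1) (dint_linK T0 _ gF gF rL' rD) (dint_swap T0 gF gF rL).
by move: (dint klow F F) => p; ring.
Qed.

(** On the diagonal [klow] and its transpose agree, so [klow + kdiag / 2] contributes half of
    [kabs]. The coefficient 1 + sg / 2 is 3/2 or 1/2, positive for both signs. *)
Lemma dint_ksg_diag sg theta C F : bv_path C F ->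
  dint (ksg sg theta) F F = (1 + sg / 2) * dint kabs F F + 2 * theta * dint kdiag F F.
Proof.
move=> gF; rewrite (dint_ksg _ _ gF gF) (dint_klow_diag gF).
by move: (dint klow F F) (dint kdiag F F) => p q; field.
Qed.

Lemma dint_ksg_theta sg theta theta' C1 C2 F G : bv_path C1 F -> bv_path C2 G ->
  dint (ksg sg theta) F G = dint (ksg sg theta') F G + 2 * (theta - theta') * dint kdiag F G.
Proof.
move=> gF gG; rewrite !(dint_ksg _ _ gF gG).
by move: (dint klow F G) (dint kdiag F G) (dint kabs F G) => p q r; ring.
Qed.

Lemma jump_lin a C1 C2 F G b : bv_path C1 F -> bv_path C2 G -> 0 <= b <= T ->
  jump (fun t => a * F t + G t) b = a * jump F b + jump G b.
Proof.
move=> gF gG Db; have gS := bv_path_step (proj1 (andP Db)).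
rewrite -(dint_kdiag_step T0 (bv_path_lin a gF gG) Db) (dint_linr T0 a gS gF gG rD).
by rewrite (dint_kdiag_step T0 gF Db) (dint_kdiag_step T0 gG Db).
Qed.

Lemma stint_cst C F c : bv_path C F -> stint T F (fun=> c) = c * (F T - F (-1)).
Proof.
move=> gF; have T1 : -1 <= T by rewrite (le_trans _ T0)// lerN10.
rewrite -(stint_itv gF (lexx (-1)) T1 (lexx T)).
have b1 : bm D (\1_(`]-1, T]%classic : set mR) : R -> R).
  by apply: bm_indic; exact: measurable_itv.
have b0 : bm D (fun=> 0 : R).
  exact: bm_cst.
have := stint_lin gF T0 c b1 b0; rewrite stint0 addr0 => <-.
apply: eq_stj => t /andP[t0 tT]; rewrite indicE mem_setE in_itv/= tT (lt_le_trans _ t0) ?ltrN10//.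
by rewrite mulr1 addr0.
Qed.

End first_order.

(** * The equilibrium profiles *)

Section uniform_derivative.
Context {R : realType}.
Implicit Types (a b s t u v M C c : R) (F G f g h : R -> R).
Variable T : R.
Hypothesis T0 : 0 <= T.

(** A derivative on [0, T] with uniform quadratic remainder, so that errors summed over a grid are
    of the order of the mesh. It is taken at the right end [v], where the Riemann sums evaluate; a
    jump of [F] at 0 lies outside its scope. *)
Definition uderiv F f := exists M, forall u v, 0 <= u -> u <= v -> v <= T ->
  `|F v - F u - f v * (v - u)| <= M * (v - u) ^+ 2.

Lemma uderiv_lin a F f G g : uderiv F f -> uderiv G g ->
  uderiv (fun t => a * F t + G t) (fun t => a * f t + g t).
Proof.
move=> [M FM] [N GN]; exists (`|a| * M + N) => u v u0 uv vT.
have -> : a * F v + G v - (a * F u + G u) - (a * f v + g v) * (v - u) =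
  a * (F v - F u - f v * (v - u)) + (G v - G u - g v * (v - u)) by ring.
rewrite (le_trans (ler_normD _ _))// mulrDl lerD ?GN// normrM -mulrA ler_wpM2l//.
exact: FM.
Qed.

Lemma uderiv_id : uderiv id (fun=> 1).
Proof. by exists 0 => u v _ _ _; rewrite mul1r subrr normr0 mul0r. Qed.

Lemma uderiv_cst c : uderiv (fun=> c) (fun=> 0).
Proof. by exists 0 => u v _ _ _; rewrite mul0r !subrr normr0 mul0r. Qed.

(** Everything follows from 1 + z <= e^z, used at z and at -z; the latter gives e^z - 1 <= z e^z. *)
Lemma exp_taylor1 (z : R) : `|expR z - 1 - z| <= z ^+ 2 * expR `|z|.
Proof.
have h1 := expR_ge1Dx z; have h2 := expR_ge1Dx (- z).
have h3 : expR z - 1 <= z * expR z.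
  have : expR z * (1 - z) <= expR z * expR (- z) by rewrite ler_wpM2l ?expR_ge0.
  by rewrite expRxMexpNx_1; lra.
rewrite ger0_norm; last by lra.
have [z0|z0] := leP 0 z.
  have h4 : z * (expR z - 1) <= z * (z * expR z) by rewrite ler_wpM2l.
  by rewrite ger0_norm// expr2 -mulrA; lra.
have h4 : z * (expR z - 1) <= z * z by rewrite ler_wnM2l ?(ltW z0)//; lra.
have h5 : z ^+ 2 * 1 <= z ^+ 2 * expR `|z|.
  by rewrite ler_wpM2l ?sqr_ge0// -expR0 ler_expR.
by move: h5; rewrite mulr1 expr2; lra.
Qed.

Lemma uderiv_exp a : uderiv (fun t => expR (a * t)) (fun t => a * expR (a * t)).
Proof.
exists (expR (`|a| * T) * (a ^+ 2 * expR (`|a| * T))) => u v u0 uv vT.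
have -> : expR (a * v) - expR (a * u) - a * expR (a * v) * (v - u) =
    - (expR (a * v) * (expR (a * (u - v)) - 1 - a * (u - v))).
  have -> : expR (a * u) = expR (a * v) * expR (a * (u - v)).
    by rewrite -expRD; congr expR; ring.
  ring.
rewrite normrN normrM (ger0_norm (expR_ge0 _)) -mulrA.
have av w : 0 <= w -> w <= T -> `|a * w| <= `|a| * T.
  by move=> w0 wT; rewrite normrM ler_wpM2l// ger0_norm.
apply: ler_pM; rewrite ?expR_ge0//.
  by rewrite ler_expR (le_trans (ler_norm _))// av// (le_trans u0).
apply: (le_trans (exp_taylor1 _)).
rewrite [leRHS]mulrAC exprMn (_ : (u - v) ^+ 2 = (v - u) ^+ 2); last by ring.
apply: ler_wpM2l; first by apply: mulr_ge0; exact: sqr_ge0.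
rewrite ler_expR normrM distrC -normrM.
by rewrite av ?subr_ge0//; lra.
Qed.

(** On ]a, b] one has dF = f dt, and G is a primitive of g f. The increment of G telescopes over the
    grid, and on each cell it differs from g dF by a quadratic error. *)
Lemma stint_uderiv C F f g G a b M : bv_path C F -> uderiv F f ->
  uderiv G (fun t => g t * f t) -> 0 <= a -> a <= b -> b <= T ->
  (forall t, 0 <= t <= T -> `|g t| <= M) ->
  continuous g ->
  stint T F (fun t => g t * \1_(`]a, b]%classic) t) = G b - G a.
Proof.
move=> gF [MF hF] [MG hG] a0; rewrite le_eqVlt => /predU1P[->|ab] bT gM cg.
  rewrite subrr -[RHS](stint0 T F); apply: eq_stj => t _.
  rewrite indicE mem_setE in_itv/=.
  have -> : (b < t <= b) = false by apply/negbTE/negP => /andP[h1 h2]; lra.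
  by rewrite mulr0.
have M0 : 0 <= M by rewrite (le_trans _ (gM 0 _))// lexx.
(* [grid_cvg] asks for a bound on the whole line, while [g] is bounded on [0, T] only. *)
pose g' (N : nat) t : R := if 0 <= t <= T then g t else 0.
have g'M (N : nat) t : `|g' N t| <= M.
  by rewrite /g'; case: ifPn => [/gM//|_]; rewrite normr0.
have h1 : \sum_(k < N.+1) g' N (grid a b N k.+1) * dgrid a b N F k @[N --> \oo] -->
    stint T F (fun t => g t * \1_(`]a, b]%classic) t).
  apply: (grid_cvg T0 gF _ ab bT g'M) => [|t Dt tab]; first by rewrite (le_trans _ a0)// lerN10.
  have : g (grid_ceil a b N t) @[N --> \oo] --> g t.
    by apply: (@cvg_comp _ _ _ (fun N => grid_ceil a b N t) g _ (nbhs t));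
      [exact: grid_ceil_cvg|exact: cg].
  apply: cvg_trans; apply: near_eq_cvg; apply: nearW => N.
  have h := grid_ceil_ge N tab; have h' := grid_ceil_le N tab.
  by rewrite /g' ifT//; apply/andP; split; lra.
(* The cell error is the remainder of G minus g times the remainder of F. *)
pose MM := MG + M * MF.
have bnd N : `|G b - G a - \sum_(k < N.+1) g' N (grid a b N k.+1) * dgrid a b N F k|
    <= MM * (b - a) ^+ 2 / N.+1%:R.
  have tele : G b - G a = \sum_(k < N.+1) (G (grid a b N k.+1) - G (grid a b N k)).
    rewrite -(big_mkord xpredT (fun k => G (grid a b N k.+1) - G (grid a b N k))).
    by rewrite telescope_sumr// gridN grid0.
  rewrite tele -sumrB (le_trans (ler_norm_sum _ _ _))//.
  apply: (@le_trans _ _ (\sum_(k < N.+1) MM * ((b - a) / N.+1%:R) ^+ 2)); last first.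
    rewrite sumr_const card_ord -[leLHS]mulr_natr expr_div_n le_eqVlt; apply/orP; left; apply/eqP.
    have : N.+1%:R != 0 :> R by rewrite pnatr_eq0.
    by move: (N.+1%:R : R) => q q0; field.
  apply: ler_sum => k _; rewrite /dgrid.
  set u := grid a b N k; set v := grid a b N k.+1.
  have vu : v - u = (b - a) / N.+1%:R by rewrite /v gridS addrAC subrr add0r.
  have uv : u <= v by rewrite -subr_ge0 vu divr_ge0 ?subr_ge0// ltW.
  have u0 : 0 <= u by rewrite (le_trans a0)// -(grid0 a b N) le_grid// ltW.
  have vT : v <= T by rewrite (le_trans _ bT)// -[leRHS](gridN a b N) le_grid ?(ltW ab).
  have Dv : 0 <= v <= T by rewrite vT (le_trans u0 uv).
  rewrite /g' Dv -vu.
  have -> : G v - G u - g v * (F v - F u) =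
    (G v - G u - g v * f v * (v - u)) - g v * (F v - F u - f v * (v - u)) by ring.
  rewrite (le_trans (ler_normB _ _))// /MM mulrDl lerD//; first exact: hG.
  rewrite normrM -mulrA ler_pM//; [exact: gM|exact: hF].
apply: (cvg_unique_ext h1 _ (fun=> erefl)).
apply/cvgrPdist_le => e e0; near=> N.
apply: (le_trans (bnd N)).
near: N.
have := cvgr_le _ (mesh_cvg0 (MM * (b - a) ^+ 2)) _ e0.
by apply.
Unshelve. all: by end_near. Qed.

Lemma uderiv_jump F f t : uderiv F f -> 0 < t <= T -> jump F t = 0.
Proof.
move=> [M FM] /andP[t0 tT]; rewrite /jump.
suff -> : lim (F x @[x --> t^'-]) = F t by rewrite subrr.
apply/cvg_lim => //; apply/cvgrPdist_le => e e0.
(* A Lipschitz constant for F at t from the left; the added 1 makes it positive. *)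
pose c := `|f t| + `|M| * T + 1.
have c0 : 0 < c by rewrite /c ltr_pwDr// addr_ge0// mulr_ge0.
near=> u.
have ut : u <= t by near: u; exact: nbhs_left_le.
have u0 : 0 <= u by near: u; exact: nbhs_left_ge.
have ue : t - e / c <= u.
  by near: u; apply: nbhs_left_ge; rewrite ltrBlDr ltrDl divr_gt0.
have h := FM u t u0 ut tT.
have -> : F t - F u = (F t - F u - f t * (t - u)) + f t * (t - u) by ring.
rewrite (le_trans (ler_normD _ _))//.
have tu : 0 <= t - u by rewrite subr_ge0.
have h2 : M * (t - u) ^+ 2 <= `|M| * T * (t - u).
  rewrite expr2 mulrA ler_wpM2r// (le_trans (ler_norm _))// normrM ler_wpM2l//.
  by rewrite ger0_norm//; lra.
have h3 : `|f t * (t - u)| = `|f t| * (t - u) by rewrite normrM (ger0_norm tu).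
apply: (@le_trans _ _ (c * (t - u))); first by rewrite /c h3 !mulrDl mul1r; lra.
by rewrite mulrC -ler_pdivlMr//; lra.
Unshelve. all: by end_near. Qed.

Lemma jump_0 F : (forall t, t < 0 -> F t = F (-1)) -> jump F 0 = F 0 - F (-1).
Proof.
move=> cF; rewrite /jump; congr (_ - _); apply/cvg_lim => //.
apply: (@cvg_near_cst _ _ _ _ _ _) => /=; near=> u; apply: cF.
by near: u; exact: nbhs_left_lt.
Unshelve. all: by end_near. Qed.

End uniform_derivative.

Section clamp.
Context {R : realType}.
Implicit Types (a b s t u v M C c : R) (F G f g h : R -> R).
Variable T : R.
Hypothesis T0 : 0 <= T.

(** Composition with it extends a profile from [0, T] by constants, giving the continuous part of a
    path; jumps are added by multiples of [step]. *)
Definition clamp t : R := Num.max 0 (Num.min t T).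

Lemma clamp_id t : 0 <= t <= T -> clamp t = t.
Proof. by move=> /andP[t0 tT]; rewrite /clamp min_l// max_r. Qed.

Lemma clamp_lt0 t : t < 0 -> clamp t = 0.
Proof. by move=> t0; rewrite /clamp min_l ?max_l// ltW// (lt_le_trans t0). Qed.

Lemma clamp_ge t : T <= t -> clamp t = T.
Proof. by move=> tT; rewrite /clamp min_r// max_r. Qed.

Lemma clamp_itv t : 0 <= clamp t <= T.
Proof. by rewrite /clamp le_max lexx/= ge_max T0 ge_min lexx orbT. Qed.

Lemma clamp_homo s t : s <= t -> clamp s <= clamp t.
Proof.
move=> st; rewrite /clamp ge_max !le_max lexx /=; apply/orP; right.
rewrite le_min !ge_min lexx orbT andbT; apply/orP; left; exact: st.
Qed.

Lemma clamp_continuous : continuous clamp.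
Proof.
move=> t; rewrite /clamp.
apply: (@continuous_max _ _ (fun=> 0) (fun t => Num.min t T)); first exact: cvg_cst.
by apply: (@continuous_min _ _ id (fun=> T)); [exact: cvg_id|exact: cvg_cst].
Qed.

Lemma bv_path_cst c : bv_path 0 (fun=> c : R).
Proof.
apply: bv_path_nondecreasing => // [x|_]; first exact: cvg_cst.
by rewrite addr0.
Qed.

Lemma bv_path_clamp F : continuous F ->
  (forall s t, 0 <= s -> s <= t -> t <= T -> F t <= F s) ->
  bv_path (F 0 - F T) (fun t => F (clamp t)).
Proof.
move=> cF nF.
have ni s t : s <= t -> F (clamp t) <= F (clamp s).
  move=> st; have /andP[s0 _] := clamp_itv s; have /andP[_ tT] := clamp_itv t.
  by apply: nF => //; exact: clamp_homo.
suff g : bv_path (F 0 - F T) (\- (fun t => F (clamp t))).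
  by apply: bv_path_eq (bv_pathN g) => t /=; rewrite opprK.
have c1 : clamp (-1) = 0 by apply: clamp_lt0; rewrite ltrN10.
apply: bv_path_nondecreasing.
- by move=> t t0 /=; rewrite clamp_lt0// c1.
- apply: right_continuousW => t; apply: cvgN.
  by apply: (continuous_comp (@clamp_continuous t)); exact: cF.
- by move=> s t st /=; rewrite lerN2 ni.
- move=> t /=; rewrite c1 addrA addNr sub0r lerN2.
  have /andP[t0 tT] := clamp_itv t; exact: nF.
Qed.

Lemma uderiv_ext F f F' f' : (forall t, 0 <= t <= T -> F t = F' t) ->
  (forall t, 0 <= t <= T -> f t = f' t) -> uderiv T F f -> uderiv T F' f'.
Proof.
move=> FF ff [M h]; exists M => u v u0 uv vT.
have Du : 0 <= u <= T by rewrite u0 (le_trans uv).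
have Dv : 0 <= v <= T by rewrite vT (le_trans u0).
by rewrite -(FF _ Du) -(FF _ Dv) -(ff _ Dv) h.
Qed.

Lemma uderiv_scale a F f : uderiv T F f -> uderiv T (fun t => a * F t) (fun t => a * f t).
Proof.
move=> uF; have := uderiv_lin a uF (uderiv_cst T 0).
by apply: uderiv_ext => t _; rewrite addr0.
Qed.

Lemma exp_lin_continuous a : continuous (fun t : R => expR (a * t)).
Proof.
move=> t; apply: (@continuous_comp _ _ _ (fun t => a * t) expR).
  by apply: cvgM; [exact: cvg_cst|exact: cvg_id].
exact: continuous_expR.
Qed.

Local Notation mR := (measurableTypeR R).
Local Notation D := (`[0, T]%classic : set mR).

Lemma exp_lin_bound a t : 0 <= t <= T -> `|expR (a * t)| <= expR (`|a| * T).
Proof.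
move=> /andP[t0 tT]; rewrite ger0_norm ?expR_ge0// ler_expR (le_trans (ler_norm _))//.
by rewrite normrM ler_wpM2l// ger0_norm.
Qed.

Lemma exp_lin_bm a (u v : R) : bm D (fun t => expR (a * t) * \1_(`]u, v]%classic) t).
Proof.
split.
  apply: measurable_funM.
    apply: measurable_funTS.
    exact: (continuous_measurable_fun (exp_lin_continuous (a := a))).
  by apply: measurable_indic; exact: measurable_itv.
exists (expR (`|a| * T)) => t; rewrite /= in_itv/= => Dt.
rewrite normrM (le_trans _ (exp_lin_bound a Dt))// ler_piMr// indicE.
by case: (_ \in _); rewrite ?normr1 ?normr0.
Qed.

Lemma stint_exp_uderiv C F f G a u v : bv_path C F -> uderiv T F f ->
  uderiv T G (fun t => expR (a * t) * f t) -> 0 <= u -> u <= v -> v <= T ->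
  stint T F (fun t => expR (a * t) * \1_(`]u, v]%classic) t) = G v - G u.
Proof.
move=> gF uF uG u0 uv vT.
apply: (stint_uderiv T0 gF uF uG u0 uv vT (exp_lin_bound a)).
exact: exp_lin_continuous.
Qed.

End clamp.

Section profiles.
Context {R : realType}.
Implicit Types (a b s t u v M C c : R) (F G f g h : R -> R).
Variables rho T : R.
Hypothesis T0 : 0 < T.
Hypothesis rho0 : 0 < rho.
Local Notation mR := (measurableTypeR R).
Local Notation D := (`[0, T]%classic : set mR).
Local Notation kabs := (@kabs R rho).
Local Notation klow := (@klow R rho).
Local Notation kdiag := (@kdiag R).
Let T0' := ltW T0.

Definition Vpath t : R := if t < 0 then 1 else Vfun rho T t.
Definition Wpath t : R := if t < 0 then 1 else Wfun rho T t.

(** Exponentials are written as powers of [E] and of e^(rho t), so that the identities for V become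
    rational and are decided by [field]. *)
Let E := expR (rho * T).
Let den := 2 * E ^+ 3 * (3 * rho * T + 5) - 1.

Lemma expR_mul_nat (n : nat) a : expR (n%:R * rho * a) = expR (rho * a) ^+ n.
Proof. by rewrite -mulrA expRM_natl. Qed.

Let v t := (E ^+ 3 * (6 * rho * (T - t) + 4) - 4 * expR (3 * rho * t)) / den.

Let E1 : 1 < E. Proof. by rewrite /E -expR0 ltr_expR mulr_gt0. Qed.

Let den0 : 0 < den.
Proof.
have rT : 0 < rho * T by rewrite mulr_gt0.
have E3 : 1 < E ^+ 3 by rewrite exprn_egt1.
rewrite /den; nra.
Qed.

Lemma Vfun_le t : t <= T -> Vfun rho T t = v t.
Proof. by move=> tT; rewrite /Vfun tT /v /den /E -(expR_mul_nat 3). Qed.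

Let v_T : v T = 0.
Proof. by rewrite /v (expR_mul_nat 3) -/E subrr mulr0 add0r [E ^+ 3 * 4]mulrC subrr mul0r. Qed.

Let v_0 : 1 - v 0 = (6 * E ^+ 3 + 3) / den.
Proof.
rewrite /v mulr0 expR0; have := den0; rewrite /den => d0.
by field; rewrite gt_eqF.
Qed.

Lemma VpathE t : Vpath t = (v 0 - 1) * step 0 t + (v (clamp T t) + (1 - v 0)).
Proof.
rewrite /Vpath /step; have [t0|t0] := ltP t 0.
  by rewrite clamp_lt0// mulr0 add0r addrC subrK.
have [tT|Tt] := leP t T.
  by rewrite Vfun_le// clamp_id ?t0// mulr1; ring.
by rewrite /Vfun leNgt Tt /= clamp_ge ?ltW// v_T mulr1; ring.
Qed.

Let v_cont : continuous v.
Proof.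
move=> t; rewrite /v; apply: cvgM; last exact: cvg_cst.
apply: cvgB; apply: cvgM; try exact: cvg_cst.
  apply: cvgD; last exact: cvg_cst.
  by apply: cvgM; [exact: cvg_cst|apply: cvgB; [exact: cvg_cst|exact: cvg_id]].
exact: exp_lin_continuous.
Qed.

Let v_ni s t : s <= t -> v t <= v s.
Proof.
move=> st; rewrite /v ler_pM2r ?invr_gt0// lerB//.
  rewrite ler_pM2l ?exprn_gt0 ?(lt_trans ltr01)// lerD2r ler_pM2l ?lerD2l ?lerN2//.
  by rewrite mulr_gt0.
by rewrite ler_pM2l// ler_expR ler_pM2l// mulr_gt0.
Qed.

Lemma bv_path_Vpath : exists C, bv_path C Vpath.
Proof.
have g1 := bv_path_clamp T0' v_cont (fun s t _ st _ => v_ni st).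
have g2 := bv_path_lin 1 g1 (bv_path_cst (1 - v 0)).
have g3 := bv_path_lin (v 0 - 1) (bv_path_step (lexx 0)) g2.
eexists; apply: bv_path_eq g3 => t; by rewrite VpathE mul1r.
Qed.

Lemma Vpath_D t : 0 <= t <= T -> Vpath t = v t.
Proof. by move=> /andP[t0 tT]; rewrite /Vpath ltNge t0/= Vfun_le. Qed.

Let f t := - 6 * rho * E ^+ 3 / den + - 12 * rho / den * expR (3 * rho * t).

Lemma uderiv_Vpath : uderiv T Vpath f.
Proof.
have u1 := uderiv_lin (- 6 * rho * E ^+ 3 / den) (uderiv_id T)
  (uderiv_lin (- 4 / den) (uderiv_exp T (3 * rho)) (uderiv_cst T (E ^+ 3 * (6 * rho * T +
    4) / den))).
have d0 : den != 0 by rewrite gt_eqF.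
apply: uderiv_ext u1 => t Dt; last by rewrite /f; field.
by rewrite Vpath_D// /v; field.
Qed.

Lemma jump_Vpath t : 0 <= t <= T -> jump Vpath t = - ((6 * E ^+ 3 + 3) / den) * (t == 0)%:R.
Proof.
move=> /andP[]; rewrite le_eqVlt => /predU1P[<- _|t0 tT].
  rewrite eqxx mulr1 -v_0 jump_0; last by move=> s s0; rewrite /Vpath s0 ltrN10.
  by rewrite Vpath_D ?lexx// /Vpath ltrN10 opprB.
by rewrite gt_eqF// mulr0 (uderiv_jump T0' uderiv_Vpath)// t0.
Qed.

(** The first-order condition for V: its potential does not depend on t. The kernel is 2 e^(-rho (t
    - s)) for s < t, the value 2 at s = t, and e^(-rho (s - t)) for s > t; both branches integrate
    explicitly. *)
Lemma stint_Vpath t : 0 <= t <= T ->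
  stint T Vpath (ksg rho 1 4^-1 t) = - (18 * E ^+ 3 / den).
Proof.
move=> /[dup] Dt /andP[t0 tT]; have [C gV] := bv_path_Vpath.
have d0 : den != 0 by rewrite gt_eqF.
pose e := expR (rho * t).
have en0 : e != 0 by rewrite gt_eqF ?expR_gt0.
have En0 : E != 0 by rewrite gt_eqF ?expR_gt0.
have eN s : expR (- rho * s) = (expR (rho * s))^-1 by rewrite mulNr expRN.
(* At theta = 1/4 the diagonal value continues the left branch, so s = t is absorbed in ]0, t]. The
   point 0 is split off to carry the initial jump. *)
have -> : stint T Vpath (ksg rho 1 4^-1 t) = stint T Vpath (fun s => 2 * e^-1 * kdiag 0 s +
    (2 * e^-1 * (expR (rho * s) * \1_(`]0, t]%classic) s) +
     (e * (expR (- rho * s) * \1_(`]t, T]%classic) s) + 0))).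
  apply: eq_stj => s /andP[s0 sT].
  have x1 : expR (- rho * (t - s)) = e^-1 * expR (rho * s).
    by rewrite /e -expRN -expRD; congr expR; ring.
  have x2 : expR (- rho * (s - t)) = e * (expR (rho * s))^-1.
    by rewrite /e -expRN -expRD; congr expR; ring.
  rewrite /ksg kabsE /klow /kdiag !indicE !mem_setE !in_itv/= sT andbT x1 x2 eN.
  have q0 : expR (rho * s) != 0 by rewrite gt_eqF ?expR_gt0.
  have [st|ts|st] := ltgtP s t.
  - move: s0; rewrite le_eqVlt => /predU1P[s0|s0].
      by rewrite -s0 eqxx ltxx /= mulr0 expR0; field; rewrite ?en0 ?oner_neq0.
    by rewrite (gt_eqF s0) s0/=; field; rewrite en0 q0.
  - have s0' := le_lt_trans t0 ts.
    by rewrite (gt_eqF s0') s0'/=; field; rewrite en0 q0.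
  - move: s0; rewrite le_eqVlt => /predU1P[s0|s0].
      have e1 : e = 1 by rewrite /e -st -s0 mulr0 expR0.
      by rewrite -s0 eqxx ltxx /= mulr0 expR0 e1; field.
    by rewrite (gt_eqF s0) s0/= st -/e; field.
have bk : bm D (kdiag 0) by apply: (kernel_bm (kdiag_regular T)); rewrite lexx.
have b0 := bm_cst D (0 : R).
have b1 := exp_lin_bm T rho 0 t; have b2 := exp_lin_bm T (- rho) t T.
have b3 := bm_lin e b2 b0; have b4 := bm_lin (2 * e^-1) b1 b3.
rewrite (stint_lin gV T0' _ bk b4) (stint_lin gV T0' _ b1 b3) (stint_lin gV T0' _ b2 b0) stint0.
rewrite (stint_kdiag T0' gV); last by rewrite lexx.
rewrite jump_Vpath ?lexx// eqxx mulr1.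
have G1 : uderiv T (fun s => - 6 * E ^+ 3 / den * expR (rho * s) + - 3 / den * expR (4 * rho * s))
    (fun s => expR (rho * s) * f s).
  have := uderiv_lin (- 6 * E ^+ 3 / den) (uderiv_exp T rho)
    (uderiv_scale (- 3 / den) (uderiv_exp T (4 * rho))).
  apply: uderiv_ext => // s _; rewrite /f (expR_mul_nat 4) (expR_mul_nat 3).
  by move: (expR _) => q; field.
have G2 : uderiv T (fun s => 6 * E ^+ 3 / den * expR (- rho * s) + - 6 / den * expR (2 * rho * s))
    (fun s => expR (- rho * s) * f s).
  have := uderiv_lin (6 * E ^+ 3 / den) (uderiv_exp T (- rho))
    (uderiv_scale (- 6 / den) (uderiv_exp T (2 * rho))).
  apply: uderiv_ext => // s _; rewrite /f (expR_mul_nat 2) (expR_mul_nat 3) eN.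
  have : expR (rho * s) != 0 by rewrite gt_eqF ?expR_gt0.
  by move: (expR _) => q q0; field; rewrite d0 q0.
rewrite (stint_exp_uderiv T0' gV uderiv_Vpath G1 (lexx 0) t0 tT).
rewrite (stint_exp_uderiv T0' gV uderiv_Vpath G2 t0 tT (lexx T)).
rewrite !eN !(expR_mul_nat 4) !(expR_mul_nat 2) -/e -/E !mulr0 !expR0.
by field; rewrite d0 en0 En0.
Qed.

Let w t : R := (rho * (T - t) + 1) / (rho * T + 1).
Let rT0 : 0 < rho * T + 1. Proof. by rewrite ltr_wpDr// mulr_gt0. Qed.

Let L t := w (clamp T t).

Lemma WpathE t : Wpath t = - (rho * T + 1)^-1 * step T t + L t.
Proof.
have d0 : rho * T + 1 != 0 by rewrite gt_eqF.
rewrite /Wpath /step /L; have [t0|t0] := ltP t 0.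
  rewrite clamp_lt0// leNgt (lt_trans t0 T0)/= mulr0 add0r /w subr0 mulfV//.
rewrite /Wfun; have [tT|Tt] := ltP t T.
  by rewrite clamp_id ?t0 ?ltW// mulr0 add0r.
by rewrite clamp_ge// mulr1 /w subrr mulr0 add0r mul1r addNr.
Qed.

Let w_cont : continuous w.
Proof.
move=> t; rewrite /w; apply: cvgM; last exact: cvg_cst.
apply: cvgD; last exact: cvg_cst.
by apply: cvgM; [exact: cvg_cst|apply: cvgB; [exact: cvg_cst|exact: cvg_id]].
Qed.

Let w_ni s t : s <= t -> w t <= w s.
Proof.
by move=> st; rewrite /w ler_pM2r ?invr_gt0// lerD2r ler_pM2l// lerD2l lerN2.
Qed.

Let bv_path_L : bv_path (w 0 - w T) L.
Proof. exact: (bv_path_clamp T0' w_cont (fun s t _ st _ => w_ni st)). Qed.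

Lemma bv_path_Wpath : exists C, bv_path C Wpath.
Proof.
have g := bv_path_lin (- (rho * T + 1)^-1) (bv_path_step T0') bv_path_L.
by eexists; apply: bv_path_eq g => t; rewrite WpathE.
Qed.

Let l s : R := - rho / (rho * T + 1).

Let uderiv_L : uderiv T L l.
Proof.
have u1 := uderiv_lin (- rho / (rho * T + 1)) (uderiv_id T) (uderiv_cst T 1).
have d0 : rho * T + 1 != 0 by rewrite gt_eqF.
apply: uderiv_ext u1 => t Dt; last by rewrite /l mulr1 addr0.
by rewrite /L clamp_id// /w; field.
Qed.

Let jump_L t : 0 <= t <= T -> jump L t = 0.
Proof.
move=> /andP[]; rewrite le_eqVlt => /predU1P[<- _|t0 tT].
  have c s : s < 0 -> L s = w 0 by move=> s0; rewrite /L clamp_lt0.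
  rewrite jump_0 => [|s s0]; last by rewrite !c ?ltrN10.
  by rewrite (c (-1)) ?ltrN10// /L clamp_id ?lexx// subrr.
by rewrite (uderiv_jump T0' uderiv_L)// t0.
Qed.

Lemma jump_Wpath t : 0 <= t <= T -> jump Wpath t = - (rho * T + 1)^-1 * (t == T)%:R.
Proof.
move=> Dt; have -> : Wpath = (fun t => - (rho * T + 1)^-1 * step T t + L t).
  by apply: funext => s; rewrite WpathE.
by rewrite (jump_lin T0' _ (bv_path_step T0') bv_path_L Dt) jump_L// addr0 jump_step.
Qed.

(** At sg = -1 and theta = 1/4 the kernel is e^(-rho (s - t)) on s >= t and 0 before. The linear
    part contributes -(1 - e^(-rho (T - t))) / (rho T + 1), the final jump -e^(-rho (T - t)) / (rho
    T + 1), and the dependence on t cancels. *)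
Lemma stint_Wpath t : 0 <= t <= T ->
  stint T Wpath (ksg rho (-1) 4^-1 t) = - (rho * T + 1)^-1.
Proof.
move=> /[dup] Dt /andP[t0 tT].
pose Kw := ksg rho (-1) 4^-1; have rK : kernel_regular T Kw by exact: ksg_regular.
have d0 : rho * T + 1 != 0 by rewrite gt_eqF.
have DT : 0 <= T <= T by rewrite lexx T0'.
have -> : Wpath = (fun t => - (rho * T + 1)^-1 * step T t + L t).
  by apply: funext => s; rewrite WpathE.
have gS := bv_path_step T0'.
rewrite -(dint_step T0' Dt (bv_path_lin _ gS bv_path_L) rK).
rewrite (dint_linr T0' _ (bv_path_step t0) gS bv_path_L rK).
have KE u s : Kw u s = kdiag u s + klow s u.
  by rewrite /Kw /ksg kabsE; field.
have -> : dint T Kw (step t) (step T) = expR (- rho * (T - t)).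
  rewrite -(dint_swap T0' gS (bv_path_step t0) rK).
  rewrite (dint_step T0' DT (bv_path_step t0) (kernel_regular_swap rK)).
  have rk : regular T (kabs T).
    split; first by exists 1 => s; rewrite /kabs ger0_norm ?expR_ge0// (expN_le1 rho0).
    move=> s Ds; apply: exp_cvg; apply: cvg_norm; apply: cvgB; first exact: cvg_cst.
    exact: grid_ceil_cvgT.
  transitivity (kabs T t); last by rewrite /kabs ger0_norm ?subr_ge0.
  rewrite -(stint_step T0' Dt rk); apply: eq_stj => s /andP[s0 sT].
  rewrite KE kdiag_sym addrC -/(kle rho T s) kleE sT mul1r /kabs.
  by rewrite ger0_norm ?subr_ge0.
rewrite (dint_step T0' Dt bv_path_L rK).
have -> : stint T L (Kw t) = stint T L (fun s => 1 * kdiag t s +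
    (expR (rho * t) * (expR (- rho * s) * \1_(`]t, T]%classic) s) + 0)).
  apply: eq_stj => s /andP[s0 sT]; rewrite KE kdiag_sym mul1r addr0; congr (_ + _).
  rewrite /klow indicE mem_setE in_itv/= sT andbT mulrA [RHS]mulrC -expRD.
  by congr (_ * expR _); ring.
have bk : bm D (kdiag t) by apply: (kernel_bm (kdiag_regular T)).
have b0 := bm_cst D (0 : R).
have b1 := exp_lin_bm T (- rho) t T.
rewrite (stint_lin bv_path_L T0' _ bk (bm_lin _ b1 b0)) (stint_lin bv_path_L T0' _ b1 b0) stint0.
rewrite (stint_kdiag T0' bv_path_L Dt) jump_L//.
have G1 : uderiv T (fun s => (rho * T + 1)^-1 * expR (- rho * s)) (fun s => expR (- rho * s) * l s).
  have := uderiv_scale (rho * T + 1)^-1 (uderiv_exp T (- rho)).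
  by apply: uderiv_ext => // s _; rewrite /l; field.
rewrite (stint_exp_uderiv T0' bv_path_L uderiv_L G1 t0 tT (lexx T)).
have e1 : expR (- rho * (T - t)) = expR (rho * t) * expR (- rho * T).
  by rewrite -expRD; congr expR; ring.
have e2 : expR (rho * t) * expR (- rho * t) = 1 by rewrite mulNr expRxMexpNx_1.
rewrite e1; move: e2; move: (expR (rho * t)) (expR (- rho * t)) (expR (- rho * T)) => p q r pq.
have -> : p * ((rho * T + 1)^-1 * r - (rho * T + 1)^-1 * q) =
  (rho * T + 1)^-1 * (p * r) - (rho * T + 1)^-1 * (p * q) by ring.
by rewrite pq; ring.
Qed.

Lemma Vpath_lt0 t : t < 0 -> Vpath t = 1. Proof. by rewrite /Vpath => ->. Qed.

Lemma Wpath_lt0 t : t < 0 -> Wpath t = 1. Proof. by rewrite /Wpath => ->. Qed.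

Lemma Vpath_ge t : T <= t -> Vpath t = 0.
Proof.
move=> Tt; rewrite /Vpath ltNge (le_trans T0' Tt)/=.
have [tT|Tt'] := leP t T; last by rewrite /Vfun leNgt Tt'.
by rewrite Vfun_le// (_ : t = T) ?v_T//; apply/eqP; rewrite eq_le tT Tt.
Qed.

Lemma Wpath_ge t : T <= t -> Wpath t = 0.
Proof. by move=> Tt; rewrite /Wpath ltNge (le_trans T0' Tt)/= /Wfun ltNge Tt. Qed.

(** The explicit constants are hidden so that V and W enter the uniqueness argument in the same
    form: a constant potential and one nonzero jump. *)
Lemma Vpath_profile : exists C j c, [/\ bv_path C Vpath, j != 0,
  forall t, 0 <= t <= T -> jump Vpath t = j * kdiag 0 t &
  forall t, 0 <= t <= T -> stint T Vpath (ksg rho 1 4^-1 t) = c].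
Proof.
have [C gV] := bv_path_Vpath.
exists C, (- ((6 * E ^+ 3 + 3) / den)), (- (18 * E ^+ 3 / den)).
split=> //; [|exact: jump_Vpath|exact: stint_Vpath].
rewrite oppr_eq0 mulf_neq0 ?invr_eq0 ?gt_eqF//.
by rewrite addr_gt0// mulr_gt0// exprn_gt0// expR_gt0.
Qed.

Lemma Wpath_profile : exists C j c, [/\ bv_path C Wpath, j != 0,
  forall t, 0 <= t <= T -> jump Wpath t = j * kdiag T t &
  forall t, 0 <= t <= T -> stint T Wpath (ksg rho (-1) 4^-1 t) = c].
Proof.
have [C gW] := bv_path_Wpath; exists C, (- (rho * T + 1)^-1), (- (rho * T + 1)^-1).
split=> //; [|exact: jump_Wpath|exact: stint_Wpath].
by rewrite oppr_eq0 invr_eq0 gt_eqF.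
Qed.

End profiles.

(** * Admissible strategies and expected costs *)

Section ae_integral.
Local Open Scope ereal_scope.
Context d (U : measurableType d) (R : realType) (mu : {measure set U -> \bar R}).
Import HBNNSimple.

(* No measurability is assumed: the integral of a nonnegative function is the
   supremum of the integrals of the simple functions below it. *)
Lemma ae_le_integral_ge0 (f g : U -> \bar R) : (forall x, 0 <= f x) -> (forall x, 0 <= g x) ->
  {ae mu, forall x, f x <= g x} -> \int[mu]_x f x <= \int[mu]_x g x.
Proof.
move=> f0 g0 [N [mN muN fgN]].
rewrite !ge0_integralTE//; apply: ge_ereal_sup => _ [h hf <-].
(* Cut off on the null set, the simple function lies below [g] everywhere and keeps its integral. *)
pose h' := mul_nnsfun h (indic_nnsfun R (measurableC mN)).
have -> : sintegral mu h = sintegral mu h'.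
  have sE (k : {nnsfun U >-> R}) : sintegral mu k = \int[mu]_x (k x)%:E.
    by rewrite integral_nnsfun// patch_setT.
  rewrite (sE h) (sE h'); apply: ae_eq_integral => //.
  - exact/measurable_EFinP.
  - exact/measurable_EFinP.
  - exists N; split => // x /= nx; apply: contrapT => Nx; apply: nx => _.
    by rewrite /= mindicE mem_set//= mulr1.
apply: ereal_sup_ubound; exists h' => // x /=.
rewrite mindicE; have [xN|xN] := boolP (x \in ~` N).
  rewrite mulr1 (le_trans (hf x))//; apply: contrapT => nfg.
  by move: xN; rewrite inE => /(_ (fgN _ nfg)).
by rewrite mulr0.
Qed.

(** Off the good paths the cost is an uncontrolled function of omega. This allows replacing it by
    the cost of regular versions inside [expected_cost]. *)
Lemma ae_eq_integralT (f g : U -> \bar R) : {ae mu, forall x, f x = g x} ->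
  \int[mu]_x f x = \int[mu]_x g x.
Proof.
move=> fg; rewrite integralE [RHS]integralE; congr (_ - _); apply/eqP; rewrite eq_le.
  by apply/andP; split; apply: ae_le_integral_ge0 => //; apply: filterS fg => x;
    rewrite !funepos.unlock => ->.
by apply/andP; split; apply: ae_le_integral_ge0 => //; apply: filterS fg => x;
  rewrite !funeneg.unlock => ->.
Qed.

End ae_integral.

Section admissible.
Context {R : realType} d (Omega : measurableType d) (P : probability Omega R).
Variables (F : R -> set (set Omega)) (T : R).
Hypothesis filF : filtration P F.
Hypothesis T0 : 0 <= T.
Implicit Types (z t c C : R) (X Y Z H : R -> Omega -> R).

Lemma preimage_const (A : Omega -> R) (a : R) (B : set R) : (forall w, A w = a) ->
  A @^-1` B = setT \/ A @^-1` B = set0.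
Proof.
move=> Aa; have [Ba|nBa] := pselect (B a); [left|right]; apply/seteqP; split=> w //=.
  by rewrite Aa.
by rewrite Aa.
Qed.

Lemma admissible_det z (f : R -> R) Z C : (forall t w, 0 <= t -> Z t w = f t) ->
  bv_path C f -> (forall t, t < 0 -> f t = z) -> (forall t, T <= t -> f t = 0) ->
  admissible P F T z Z.
Proof.
move=> Zf gf fz fT; have [cf rf tv] := gf.
have pE w : Defs.path z Z w = f.
  apply: funext => t; rewrite /Defs.path; case: ltP => [/fz->//|t0]; exact: Zf.
split.
- move=> t t0 B mB; case: (filF) => sF _ _ _ _; have [s0 sC sU] := sF t t0.
  have [->|->] := preimage_const B (Zf t ^~ t0); last exact: s0.
  by have := sC _ s0; rewrite setD0.
- apply: aeW => w t t0; rewrite Zf//; apply: cvg_trans (rf t).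
  apply: near_eq_cvg; near=> u; rewrite Zf//.
  by rewrite (le_trans t0)//; near: u; exact: nbhs_right_ge.
- apply: aeW => w; exists (`|f (-1)| + C) => t t0; rewrite Zf//.
  have t1 : -1 <= t by rewrite (le_trans _ t0)// lerN10.
  have := le_trans (total_variation_ge f t1) (tv t); rewrite lee_fin => h.
  by rewrite -[f t](subrK (f (-1))) addrC (le_trans (ler_normD _ _))// lerD.
- by exists C; apply: aeW => w b; rewrite pE.
- by move=> t tT; apply: aeW => w; rewrite Zf ?fT// (le_trans T0).
Unshelve. all: by end_near. Qed.

Lemma path_lin z1 z2 c Z1 Z2 w :
  Defs.path (c * z1 + z2) (fun t w => c * Z1 t w + Z2 t w) w =
  (fun t => c * Defs.path z1 Z1 w t + Defs.path z2 Z2 w t).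
Proof. by apply: funext => t; rewrite /Defs.path; case: ifP. Qed.

(** Adaptedness refers to a bare family of sets. Regarding [S] as the measurable structure it
    generates makes the closure of measurable functions under sums and products available. *)
Lemma sub_measurable_lin (S : set (set Omega)) (f g : Omega -> R) c : sigma_algebra setT S ->
  (forall B : set R, measurable B -> S (f @^-1` B)) ->
  (forall B : set R, measurable B -> S (g @^-1` B)) ->
  forall B : set R, measurable B -> S ((fun w => c * f w + g w) @^-1` B).
Proof.
move=> sS mf mg B mB.
have SE : <<s S >> = S by exact: sigma_algebra_id.
have mS (h : Omega -> R) : (forall B : set R, measurable B -> S (h @^-1` B)) ->
    measurable_fun setT (h : g_sigma_algebraType S -> R).
  by move=> mh _ B' mB'; rewrite setTI /measurable/= SE; exact: mh.
have : measurable_fun setT ((fun w => c * f w + g w) : g_sigma_algebraType S -> R).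
  by apply: measurable_funD; [apply: measurable_funM => //; exact: mS|exact: mS].
by move=> /(_ measurableT B mB); rewrite setTI /measurable/= SE.
Qed.

Lemma admissible_lin z1 z2 c Z1 Z2 : admissible P F T z1 Z1 -> admissible P F T z2 Z2 ->
  admissible P F T (c * z1 + z2) (fun t w => c * Z1 t w + Z2 t w).
Proof.
move=> [m1 r1 b1 [C1 v1] e1] [m2 r2 b2 [C2 v2] e2]; split.
- move=> t t0 B mB; case: (filF) => sF _ _ _ _.
  exact: (sub_measurable_lin c (sF t t0) (m1 t t0) (m2 t t0) mB).
- apply: filterS2 r1 r2 => w h1 h2 t t0.
  by apply: cvgD; [apply: cvgM; [exact: cvg_cst|exact: h1]|exact: h2].
- apply: filterS2 b1 b2 => w [M1 h1] [M2 h2]; exists (`|c| * M1 + M2) => t t0.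
  rewrite (le_trans (ler_normD _ _))// lerD ?h2//.
  by rewrite normrM ler_wpM2l// h1.
- exists (`|c| * C1 + C2); apply: filterS2 v1 v2 => w h1 h2 b.
  rewrite path_lin; apply: total_variation_ub => s ps.
  have vle Z z C : (forall b, (total_variation (-1) b (Defs.path z Z w) <= C%:E)%E) ->
      variation (-1) b (Defs.path z Z w) s <= C.
    move=> h; rewrite -lee_fin (le_trans _ (h b))//.
    apply: ereal_sup_ubound; exists (variation (-1) b (Defs.path z Z w) s) => //.
    exact: variations_variation.
  apply: (le_trans (variation_le _ _ _ _ _)).
  by rewrite variationZ lerD ?ler_wpM2l// vle.
- move=> t tT; apply: filterS2 (e1 t tT) (e2 t tT) => w -> ->.
  by rewrite mulr0 addr0.
Qed.

(** A version with good paths for every omega. Changing paths on a null set may destroy adaptedness,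
    so versions serve to compute expectations, while competitors are built from the original
    strategies. *)
Definition regular_process C T z (zeta : Omega -> R -> R) :=
  [/\ forall w, bv_path C (zeta w), forall t, measurable_fun setT (fun w => zeta w t),
      forall w t, T <= t -> zeta w t = 0 & forall w t, t < 0 -> zeta w t = z].

Lemma bv_path_le C C' f : C <= C' -> bv_path C f -> bv_path C' (f : R -> R).
Proof.
by move=> CC [h1 h2 h3]; split=> // b; rewrite (le_trans (h3 b))// lee_fin.
Qed.

(** The null set in admissibility depends on t. One null set suffices for the countably many times T
    + m/(n+1), and right-continuity extends the conclusion to all t >= T. *)
Lemma ae_zero_after Z : {ae P, forall w, forall t, 0 <= t -> Z^~ w @ t^'+ --> Z t w} ->
  (forall t, T <= t -> {ae P, forall w, Z t w = 0}) ->
  {ae P, forall w, forall t, T <= t -> Z t w = 0}.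
Proof.
move=> rZ eZ.
have : {ae P, forall w, forall n m, Z (T + m%:R / n.+1%:R) w = 0}.
  apply: ae_foralln => n; apply: ae_foralln => m; apply: eZ.
  by rewrite lerDl divr_ge0.
apply: filterS2 rZ => w rw hw t tT.
have t0 : 0 <= t by rewrite (le_trans T0).
apply/eqP; apply: contrapT => /negP Zn0.
have nz : 0 < `|Z t w| by rewrite normr_gt0.
have /cvgrPdist_lt/(_ _ nz) [e /= e0 he] := rw t t0.
have [n _ /(_ n (leqnn _)) /= ne] := near_infty_natSinv_lt (PosNum e0).
(* The first multiple of 1/(n+1) after T that lies strictly to the right of t, hence within 1/(n+1)
   of it. *)
pose m := (Num.truncn ((t - T) * n.+1%:R)).+1.
have m1 := truncnS_gt ((t - T) * n.+1%:R).
have m2 : (Num.truncn ((t - T) * n.+1%:R))%:R <= (t - T) * n.+1%:R.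
  by rewrite truncn_le// mulr_ge0// subr_ge0.
have lo : t < T + m%:R / n.+1%:R.
  by rewrite -ltrBlDl ltr_pdivlMr.
have hi : T + m%:R / n.+1%:R <= t + n.+1%:R^-1.
  rewrite /m -natr1 mulrDl mul1r addrA lerD2r -lerBrDl ler_pdivrMr//.
have b : `|t - (T + m%:R / n.+1%:R)| < e.
  by rewrite distrC ger0_norm ?subr_ge0 1?ltW// ltrBlDl (le_lt_trans hi)// ltrD2l.
by have := he _ b lo; rewrite hw subr0 ltxx.
Qed.

Lemma admissible_regular z Z : admissible P F T z Z -> exists C zeta,
  regular_process C T z zeta /\ {ae P, forall w, Defs.path z Z w = zeta w}.
Proof.
move=> [mZ rZ _ [C vZ] eZ].
have := filterI rZ (filterI vZ (ae_zero_after rZ eZ)).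
move=> [N [mN PN sN]].
have gN w : ~ N w -> [/\ forall t, 0 <= t -> Z^~ w @ t^'+ --> Z t w,
    forall b, (total_variation (-1) b (Defs.path z Z w) <= C%:E)%E &
    forall t, T <= t -> Z t w = 0].
  by move=> nN; apply: contrapT => h; apply: nN; apply: sN => /= -[h1 [h2 h3]]; apply: h.
pose zeta w t := if t < 0 then z else if w \in N then 0 else Z t w.
(* On the null set the path is replaced by the immediate drop from z to 0, whose variation is |z|;
   one constant must serve for both kinds of paths. *)
have C0 : 0 <= `|C| + `|z| by rewrite addr_ge0.
exists (`|C| + `|z|), zeta; split; last first.
  exists N; split => // w /= h; apply: contrapT => nN; apply: h.
  by apply: funext => t; rewrite /zeta /Defs.path memNset.
split.
- move=> w; have [wN|wN] := boolP (w \in N).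
    have g := bv_path_lin (- z) (bv_path_step (lexx 0)) (bv_path_cst z).
    apply: (@bv_path_le (`|- z| * 1 + 0)); first by rewrite normrN mulr1 addr0 lerDr.
    apply: bv_path_eq g => t; rewrite /zeta wN /step; case: ltP => _; last by rewrite mulr1 addNr.
    by rewrite mulr0 add0r.
  have [rw vw _] := gN w (elimN (asboolP _) wN).
  have zE : zeta w = Defs.path z Z w.
    by apply: funext => t; rewrite /zeta (negbTE wN).
  apply: (@bv_path_le C); first by rewrite (le_trans (ler_norm _))// lerDl.
  rewrite zE; split=> //.
    by move=> t t0; rewrite /Defs.path t0 ltrN10.
  move=> t; rewrite /Defs.path; have [t0|t0] := ltP t 0.
    apply: (@cvg_near_cst _ _ _ _ _ _) => /=; near=> u.
    by rewrite ifT//; near: u; exact: nbhs_right_lt.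
  apply: cvg_trans (rw t t0); apply: near_eq_cvg; near=> u.
  have tu : t <= u by near: u; exact: nbhs_right_ge.
  by rewrite ltNge (le_trans t0 tu).
- move=> t; rewrite /zeta; have [t0|t0] := ltP t 0; first exact: measurable_cst.
  have mZt : measurable_fun setT (Z t).
    move=> _ B mB; rewrite setTI; case: (filF) => _ sub _ _ _.
    by apply: (sub t t0); exact: mZ.
  apply: measurable_fun_if => //.
  + apply: (measurable_fun_bool true).
    rewrite setTI (_ : _ @^-1` _ = N)//.
    by apply/seteqP; split => w /=; [move/set_mem|move/mem_set].
  + exact: measurable_funTS.
- move=> w t Tt; rewrite /zeta ltNge (le_trans T0 Tt)/=.
  have [//|wN] := boolP (w \in N).
  by have [_ _ ->] := gN w (elimN (asboolP _) wN).
- by move=> w t t0; rewrite /zeta t0.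
Unshelve. all: by end_near. Qed.

End admissible.

(** * Expected costs and optimality conditions *)

Section expectation.
Context {R : realType} d (Omega : measurableType d) (P : probability Omega R).
Variables (F : R -> set (set Omega)) (rho T : R).
Hypothesis filF : filtration P F.
Hypothesis T0 : 0 < T.
Hypothesis rho0 : 0 < rho.
Implicit Types (z t c C : R) (X Y Z H : R -> Omega -> R) (zeta xi eta : Omega -> R -> R).
Implicit Types (f g : Omega -> R) (K : R -> R -> R).
Let T0' := ltW T0.
Let rA := kabs_regular T rho0.
Let rL := klow_regular T rho0.
Let rD := @kdiag_regular R T.
Local Notation dint := (@dint R T).
Local Notation kabs := (@kabs R rho).
Local Notation kdiag := (@kdiag R).
Local Notation bmO := (@bm R d Omega setT).
Local Notation Ex := (Rintegral P setT).

Let PT : (P setT < +oo)%E. Proof. by rewrite probability_setT ltry. Qed.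

Lemma Ex_lin c f g : bmO f -> bmO g -> Ex (fun w => c * f w + g w) = c * Ex f + Ex g.
Proof. exact: (bm_Rint_lin measurableT PT). Qed.

Lemma Ex_ge0 f : (forall w, 0 <= f w) -> 0 <= Ex f.
Proof. by move=> f0; apply: Rintegral_ge0 => w _. Qed.

Lemma Ex_cst c : Ex (fun=> c) = c.
Proof.
transitivity (c * fine (P setT)); first exact: Rintegral_cst.
by rewrite probability_setT mulr1.
Qed.

Lemma bm_ext f g : f =1 g -> bmO f -> bmO g. Proof. by move=> /funext->. Qed.

Lemma Ex_eq0_ae f : bmO f -> (forall w, 0 <= f w) -> Ex f = 0 -> {ae P, forall w, f w = 0}.
Proof.
move=> bf f0 Ef; have If := bm_integrable measurableT PT bf.
have [mf _] := bf.
have : (\int[P]_(w in setT) `|(f w)%:E| = 0)%E.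
  have -> : (\int[P]_(w in setT) `|(f w)%:E| = \int[P]_(w in setT) (f w)%:E)%E.
    by apply: eq_integral => w _; rewrite gee0_abs// lee_fin.
  rewrite -[LHS]fineK; last exact: (integrable_fin_num measurableT If).
  by congr _%:E; exact: Ef.
move=> /(ae_eq_integral_abs P measurableT ((measurable_EFinP _ _).2 mf)).
by apply: filterS => w /(_ I) [].
Qed.

(** The double sums involve finitely many values of the paths, so they are measurable in omega, and
    [dsum_bound] is uniform in N. *)
Lemma bm_dint C C' zeta xi K : (forall w, bv_path C (zeta w)) ->
  (forall t, measurable_fun setT (fun w => zeta w t)) -> (forall w, bv_path C' (xi w)) ->
  (forall t, measurable_fun setT (fun w => xi w t)) ->
  kernel_regular T K -> bmO (fun w => dint K (zeta w) (xi w)).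
Proof.
move=> gz mz gx mx rK; have [[M KM] _] := rK.
apply: (bm_cvg (g_ := fun N w => dsum T N K (zeta w) (xi w)) (M := M * C * C')).
- move=> N; apply: measurable_sum => k; apply: measurable_funM.
    apply: measurable_sum => l; apply: measurable_funM; first exact: measurable_cst.
    by apply: measurable_funB; exact: mx.
  by apply: measurable_funB; exact: mz.
- by move=> N w _; apply: dsum_bound.
- by move=> w _; exact: (dint_cvg T0' (gz w) (gx w) rK).
Qed.

Lemma bm_dint_process C C' a b zeta xi K : regular_process C T a zeta ->
  regular_process C' T b xi -> kernel_regular T K -> bmO (fun w => dint K (zeta w) (xi w)).
Proof. by move=> [gz mz _ _] [gx mx _ _]; exact: (bm_dint gz mz gx mx). Qed.

Lemma bm_jump C a zeta b : regular_process C T a zeta -> 0 <= b <= T ->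
  bmO (fun w => jump (zeta w) b).
Proof.
move=> [gz mz _ _] Db; have gS := bv_path_step (proj1 (andP Db)).
apply: bm_ext (bm_dint (zeta := fun=> step b) (fun=> gS) (fun t => measurable_cst
  (step b t)) gz mz rD).
by move=> w; exact: (dint_kdiag_step T0' (gz w) Db).
Qed.

Lemma regular_process_lin c C C' a b zeta xi : regular_process C T a zeta ->
  regular_process C' T b xi ->
  regular_process (`|c| * C + C') T (c * a + b) (fun w t => c * zeta w t + xi w t).
Proof.
move=> [gz mz ez iz] [gx mx ex ix]; split.
- by move=> w; exact: bv_path_lin.
- by move=> t; apply: measurable_funD => //; apply: measurable_funM.
- by move=> w t Tt; rewrite ez// ex// mulr0 addr0.
- by move=> w t t0; rewrite iz// ix.
Qed.

Lemma regular_process_det C z (h : R -> R) : bv_path C h -> (forall t, T <= t -> h t = 0) ->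
  (forall t, t < 0 -> h t = z) -> regular_process C T z (fun _ : Omega => h).
Proof. by move=> gh h0 hz; split=> // t; exact: measurable_cst. Qed.

Lemma bm_pathcost theta C C' a b zeta xi : regular_process C T a zeta ->
  regular_process C' T b xi -> bmO (fun w => pathcost rho theta T (zeta w) (xi w)).
Proof.
move=> pz px.
have b1 := bm_lin (2^-1) (bm_dint_process pz px rD) (bm_lin theta (bm_dint_process pz pz rD)
  (bm_dint_process pz px rL)).
apply: bm_ext (bm_lin (2^-1) (bm_dint_process pz pz rA) b1) => w.
rewrite /pathcost; move: (dint _ _ _) (dint _ _ _) (dint _ _ _) (dint _ _ _) => p q r s; ring.
Qed.

Lemma expected_costE theta x y X Y C C' a b zeta xi :
  regular_process C T a zeta -> regular_process C' T b xi ->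
  {ae P, forall w, Defs.path x X w = zeta w} -> {ae P, forall w, Defs.path y Y w = xi w} ->
  expected_cost P rho theta T x y X Y = (Ex (fun w => pathcost rho theta T (zeta w) (xi w)))%:E.
Proof.
move=> pz px Xz Yx; have bp := bm_pathcost theta pz px.
rewrite fineK; last exact: (integrable_fin_num measurableT (bm_integrable measurableT PT bp)).
apply: ae_eq_integralT; apply: filterS2 Xz Yx => w Xw Yw.
have gz : bv_path C (Defs.path x X w) by rewrite Xw; case: pz.
have gx : bv_path C' (Defs.path y Y w) by rewrite Yw; case: px.
by rewrite (costE rho theta T0' gz gx) Xw Yw.
Qed.

(** A direction H that starts from 0 keeps X + c H admissible for every real c of either sign; the
    expected cost is quadratic in c with minimum at c = 0. *)
Lemma expected_dpathcost_eq0 theta x y X Y H C1 C2 C3 z1 z2 z3 zeta xi eta :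
  admissible P F T x X -> admissible P F T 0 H ->
  regular_process C1 T z1 zeta -> regular_process C2 T z2 xi ->
  regular_process C3 T z3 eta ->
  {ae P, forall w, Defs.path x X w = zeta w} -> {ae P, forall w, Defs.path y Y w = xi w} ->
  {ae P, forall w, Defs.path 0 H w = eta w} ->
  expected_cost P rho theta T x y X Y = ereal_inf [set expected_cost P rho theta T x y X' Y
                    | X' in admissible P F T x] ->
  bmO (fun w => dpathcost rho T theta (eta w) (zeta w) (xi w)) /\
  Ex (fun w => dpathcost rho T theta (eta w) (zeta w) (xi w)) = 0.
Proof.
move=> aX aH pz px pe Xz Yx He inf.
have bf : bmO (fun w => dpathcost rho T theta (eta w) (zeta w) (xi w)).
  have b1 := bm_lin (2^-1) (bm_dint_process pe px rD) (bm_lin (2 * theta)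
    (bm_dint_process pe pz rD) (bm_dint_process pe px rL)).
  apply: bm_ext (bm_lin 1 (bm_dint_process pe pz rA) b1) => w.
  rewrite /dpathcost; move: (dint _ _ _) (dint _ _ _) (dint _ _ _) (dint _ _ _) => p q r s; ring.
split=> //.
pose q w := 2^-1 * dint kabs (eta w) (eta w) + theta * dint kdiag (eta w) (eta w).
have bq : bmO q.
  apply: bm_ext (bm_lin (2^-1) (bm_dint_process pe pe rA) (bm_lin theta
    (bm_dint_process pe pe rD) (bm_cst _ 0))) => w.
  by rewrite addr0.
suff h c : 0 <= c ^+ 2 * Ex q + 2 * c * (2^-1 * Ex (fun w => dpathcost rho T theta (eta w)
  (zeta w) (xi w))).
  have := quad_ge0_lin h; move/eqP; rewrite mulf_eq0 invr_eq0 pnatr_eq0 /= => /eqP; exact.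
have aXH : admissible P F T x (fun t w => c * H t w + X t w).
  by have := admissible_lin filF c aH aX; rewrite mulr0 add0r.
have pc := regular_process_lin c pe pz.
have E1 := expected_costE theta pz px Xz Yx.
have XHz : {ae P, forall w, Defs.path x (fun t w => c * H t w + X t w) w =
    (fun t => c * eta w t + zeta w t)}.
  apply: filterS2 He Xz => w Hw Xw.
  by rewrite -{1}[x]add0r -{1}(mulr0 c) path_lin Hw Xw.
have E2 := expected_costE theta pc px XHz Yx.
have : (expected_cost P rho theta T x y X Y <=
    expected_cost P rho theta T x y (fun t w => c * H t w + X t w)%R Y)%E.
  by rewrite inf; apply: ereal_inf_lbound; exists (fun t w => c * H t w + X t w).
rewrite E1 E2 lee_fin.
have -> : (fun w => pathcost rho theta T (fun t => c * eta w t + zeta w t) (xi w)) =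
   (fun w => c * dpathcost rho T theta (eta w) (zeta w) (xi w) +
       (c ^+ 2 * q w + pathcost rho theta T (zeta w) (xi w))).
  apply: funext => w; case: pe pz px => [ge _ _ _] [gz _ _ _] [gx _ _ _].
  rewrite (pathcost_expand T0' rho0 theta c (ge w) (gz w) (gx w)) /q.
  by rewrite -addrA addrC -addrA.
have bp := bm_pathcost theta pz px.
rewrite (Ex_lin _ bf (bm_lin _ bq bp)) (Ex_lin _ bq bp).
move: (Ex q) (Ex _) (Ex _) => a b e; lra.
Qed.

(** The comparison holds path by path. For each omega the deviation from [f] is a path going from 0
    to 0, so the linear term vanishes and the quadratic term is nonnegative since theta >= 0. Random
    competitors are thereby covered. *)
Lemma best_response theta x y (f g : R -> R) C C' X Y : 0 <= theta ->
  bv_path C f -> (forall t, T <= t -> f t = 0) -> (forall t, t < 0 -> f t = x) ->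
  bv_path C' g -> (forall t, T <= t -> g t = 0) -> (forall t, t < 0 -> g t = y) ->
  (forall w, Defs.path x X w = f) -> (forall w, Defs.path y Y w = g) ->
  admissible P F T x X ->
  (forall C1 h, bv_path C1 h -> h T = 0 -> h (-1) = 0 -> dpathcost rho T theta h f g = 0) ->
  expected_cost P rho theta T x y X Y = ereal_inf [set expected_cost P rho theta T x y X' Y
                    | X' in admissible P F T x].
Proof.
move=> th0 gf fT fx gg gT gy Xf Yg aX foc0.
have pf := regular_process_det gf fT fx; have pg := regular_process_det gg gT gy.
have Xae : {ae P, forall w, Defs.path x X w = f} by apply: aeW => w; exact: Xf.
have Yae : {ae P, forall w, Defs.path y Y w = g} by apply: aeW => w; exact: Yg.
apply/eqP; rewrite eq_le; apply/andP; split; last first.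
  by apply: ereal_inf_lbound; exists X.
apply: le_ereal_inf_tmp => _ [X' aX' <-].
have [C1 [zeta [pz Xz]]] := admissible_regular filF T0' aX'.
rewrite (expected_costE theta pf pg Xae Yae) (expected_costE theta pz pg Xz Yae) lee_fin.
have i1 := bm_integrable measurableT PT (bm_pathcost theta pf pg).
have i2 := bm_integrable measurableT PT (bm_pathcost theta pz pg).
apply: (le_Rintegral measurableT i1 i2).
move=> w _; have pe := regular_process_lin (-1) pf pz; case: pe => [ge _ eT e0].
pose h t := -1 * f t + zeta w t.
have gh : bv_path (`|-1| * C + C1) h := ge w.
have -> : zeta w = (fun t => 1 * h t + f t).
  by apply: funext => t; rewrite /h; ring.
rewrite (pathcost_expand T0' rho0 theta 1 gh gf gg).
have h1 : h (-1) = 0 by rewrite /h (e0 w) ?ltrN10//; ring.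
rewrite (foc0 _ _ gh (eT w T (lexx T)) h1).
rewrite mulr0 addr0 expr1n mul1r lerDl; apply: addr_ge0; apply: mulr_ge0 => //.
  exact: (dint_kabs_ge0 T0' rho0 gh).
exact: (dint_kdiag_ge0 T0' gh).
Qed.

End expectation.

(** * Nash equilibria *)

Section kernel_limits.
Context {R : realType}.
Implicit Types (s t : R).
Variables rho T : R.
Hypothesis T0 : 0 < T.
Hypothesis rho0 : 0 < rho.

Let eps n : R := T / n.+1%:R.

Let eps_cvg : eps n @[n --> \oo] --> 0. Proof. exact: mesh_cvg0. Qed.

Let eps_near s : 0 < s -> \forall n \near \oo, eps n < s.
Proof. by move=> s0; exact: (cvgr_lt _ eps_cvg _ s0). Qed.

Let eps_gt0 n : 0 < eps n. Proof. by rewrite divr_gt0. Qed.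

(** One source of the value 1/4: at s = 0 the diagonal value 3/2 + 2 theta is compared with the
    limit 2 of the left branch. For s > 0 the two values merge by continuity. *)
Lemma ksg_cvg0 theta s : 0 <= s <= T ->
  ksg rho 1 theta 0 s - ksg rho 1 theta (eps n) s @[n --> \oo] -->
  2 * (theta - 4^-1) * kdiag 0 s.
Proof.
move=> /andP[]; rewrite le_eqVlt => /predU1P[<- _|s0 sT].
  have h : 2^-1 + 1 + 2 * theta - 2 * expR (- rho * eps n) @[n --> \oo] -->
      2^-1 + 1 + 2 * theta - 2 * expR (- rho * 0).
    by apply: cvgB; [exact: cvg_cst|apply: cvgM; [exact: cvg_cst|exact: exp_cvg]].
  have -> : 2 * (theta - 4^-1) * kdiag 0 0 = 2^-1 + 1 + 2 * theta - 2 * expR (- rho * 0) :> R.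
    by rewrite /kdiag eqxx mulr0 expR0 !mulr1; field.
  apply: cvg_trans h; apply: near_eq_cvg; apply: nearW => n.
  rewrite /ksg /klow /kdiag /kabs ltxx eqxx (eps_gt0 n) (lt_eqF (eps_gt0 n)) !subr0 normr0.
  by rewrite (gtr0_norm (eps_gt0 n)) !mulr0 expR0 /=; ring.
have h : expR (- rho * s) - expR (- rho * (s - eps n)) @[n --> \oo] -->
    expR (- rho * s) - expR (- rho * (s - 0)).
  apply: cvgB; first exact: cvg_cst.
  by apply: exp_cvg; apply: cvgB; [exact: cvg_cst|].
have -> : 2 * (theta - 4^-1) * kdiag 0 s = expR (- rho * s) - expR (- rho * (s - 0)).
  by rewrite /kdiag gt_eqF// mulr0 subr0 subrr.
apply: cvg_trans h; apply: near_eq_cvg; near=> n.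
have es : eps n < s by near: n; exact: eps_near.
rewrite /ksg /klow /kdiag /kabs (gt_eqF s0) (gt_eqF es) !ltNge (ltW s0) (ltW es)/=.
rewrite sub0r normrN (gtr0_norm s0) distrC (gtr0_norm (_ : 0 < s - eps n)) ?subr_gt0//.
ring.
Unshelve. all: by end_near. Qed.

(** For sg = -1 the kernel is [klow] transposed plus (1/2 + 2 theta) [kdiag]. At s = T its diagonal
    value meets the limit 1; for s < T both values are eventually 0. *)
Lemma ksg_cvgT theta s : 0 <= s <= T ->
  ksg rho (-1) theta T s - ksg rho (-1) theta (T - eps n) s @[n --> \oo] -->
  2 * (theta - 4^-1) * kdiag T s.
Proof.
have KE u v : ksg rho (-1) theta u v = klow rho v u + (2^-1 + 2 * theta) * kdiag u v.
  by rewrite /ksg kabsE; field.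
move=> /andP[s0]; rewrite le_eqVlt => /predU1P[->|sT].
  have h : 2^-1 + 2 * theta - expR (- rho * eps n) @[n --> \oo] -->
      2^-1 + 2 * theta - expR (- rho * 0).
    by apply: cvgB; [exact: cvg_cst|exact: exp_cvg].
  have -> : 2 * (theta - 4^-1) * kdiag T T = 2^-1 + 2 * theta - expR (- rho * 0) :> R.
    by rewrite /kdiag eqxx mulr0 expR0 !mulr1; field.
  apply: cvg_trans h; apply: near_eq_cvg; apply: nearW => n.
  have Te : T - eps n < T by rewrite ltrBlDr ltrDl.
  have eE : T - (T - eps n) = eps n by ring.
  by rewrite !KE /klow /kdiag ltxx eqxx Te (gt_eqF Te) eE mul0r mulr0 mulr1 mul1r add0r addr0.
have -> : 2 * (theta - 4^-1) * kdiag T s = 0 by rewrite /kdiag lt_eqF// mulr0.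
apply: (@cvg_near_cst _ _ _ _ _ _) => /=; near=> n.
have es : eps n < T - s by near: n; apply: eps_near; rewrite subr_gt0.
have sTe : s < T - eps n by lra.
rewrite !KE /klow /kdiag (lt_eqF sT) (lt_eqF sTe) !ltNge (ltW sT) (ltW sTe)/=.
ring.
Unshelve. all: by end_near. Qed.

End kernel_limits.

(** * Consequences of the signed first-order condition *)

Section equilibrium.
Context {R : realType} d (Omega : measurableType d) (P : probability Omega R).
Variables (F : R -> set (set Omega)) (rho T theta x y : R).
Hypothesis filF : filtration P F.
Hypothesis T0 : 0 < T.
Hypothesis rho0 : 0 < rho.
Hypothesis theta0 : 0 <= theta.
Implicit Types (z t c C : R) (X Y Z H : R -> Omega -> R) (zeta xi eta : Omega -> R -> R).
Implicit Types (K : R -> R -> R).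
Let T0' := ltW T0.
Local Notation dint := (@dint R T).
Local Notation kabs := (@kabs R rho).
Local Notation kdiag := (@kdiag R).
Local Notation ksg := (@ksg R rho).
Local Notation dpathcost := (@dpathcost R rho T theta).
Local Notation bmO := (@bm R d Omega setT).
Local Notation Ex := (Rintegral P setT).

(* For sg = 1 the profile U is V, with p = 0; for sg = -1 it is W, with p = T. *)
Variables (sg p : R) (q : nat -> R) (U : R -> R) (CU j c : R).
Hypothesis sg2 : sg ^+ 2 = 1.
Hypothesis sg0 : 0 < 1 + sg / 2.
Hypothesis Dp : 0 <= p <= T.
Hypothesis Dq : forall n, 0 <= q n <= T.
Hypothesis ksg_cvg : forall s, 0 <= s <= T ->
  ksg sg theta p s - ksg sg theta (q n) s @[n --> \oo] --> 2 * (theta - 4^-1) * kdiag p s.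
Hypothesis gU : bv_path CU U.
Hypothesis U_lt0 : forall t, t < 0 -> U t = 1.
Hypothesis U_geT : forall t, T <= t -> U t = 0.
Hypothesis stjU : forall t, 0 <= t <= T -> stint T U (ksg sg 4^-1 t) = c.
Hypothesis jumpU : forall t, 0 <= t <= T -> jump U t = j * kdiag p t.
Hypothesis j0 : j != 0.

(** A constant potential pairs to zero with any path whose total increment is zero. *)
Lemma dint_profile C (h : R -> R) : bv_path C h -> h T = 0 -> h (-1) = 0 ->
  dint (ksg sg 4^-1) h U = 0.
Proof.
move=> gh hT h1; rewrite dint.unlock.
have -> : stint T h (fun t => stint T U (ksg sg 4^-1 t)) = stint T h (fun=> c).
  by apply: eq_stj => t Dt; exact: stjU.
by rewrite (stint_cst T0' c gh) hT h1 subrr mulr0.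
Qed.

Lemma dint_kdiag_profile C (h : R -> R) : bv_path C h -> dint kdiag h U = j * jump h p.
Proof.
move=> gh; rewrite dint.unlock.
have -> : stint T h (fun t => stint T U (kdiag t)) = stint T h (fun t => j * kdiag p t + 0).
  by apply: eq_stj => t Dt; rewrite (stint_kdiag T0' gU Dt) jumpU// addr0.
have bk : bm (`[0, T]%classic : set (measurableTypeR R)) (kdiag p).
  by apply: (kernel_bm (kdiag_regular T)).
rewrite (stint_lin gh T0' j bk); last exact: bm_cst.
by rewrite stint0 addr0 (stint_kdiag T0' gh Dp).
Qed.

Lemma nash_signed X Y : nash P F rho theta T x y X Y ->
  (x + sg * y) * (theta - 4^-1) = 0 /\
  {ae P, forall w, forall t, 0 <= t -> X t w + sg * Y t w = (x + sg * y) * U t}.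
Proof.
move=> [aX aY eX eY].
have [C1 [zeta [pz Xz]]] := admissible_regular filF T0' aX.
have [C2 [xi [px Yx]]] := admissible_regular filF T0' aY.
pose Z w t := sg * xi w t + zeta w t.
have pZ := regular_process_lin sg px pz; rewrite -/Z in pZ.
(* The same direction is tested in both players' problems, and the conditions are added with weight
   [sg]. *)
have first_order H C3 z3 eta : admissible P F T 0 H -> regular_process C3 T z3 eta ->
    {ae P, forall w, Defs.path 0 H w = eta w} ->
    Ex (fun w => dint (ksg sg theta) (eta w) (Z w)) = 0.
  move=> aH pe He.
  have [b1 E1] := expected_dpathcost_eq0 filF T0 rho0 aX aH pz px pe Xz Yx He eX.
  have [b2 E2] := expected_dpathcost_eq0 filF T0 rho0 aY aH px pz pe Yx Xz He eY.
  rewrite (_ : (fun w => _) = (fun w => sg * dpathcost (eta w) (xi w) (zeta w) +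
      dpathcost (eta w) (zeta w) (xi w))); first by rewrite (Ex_lin P sg b2 b1) E1 E2 mulr0 addr0.
  apply: funext => w; case: pe pz px => [ge _ _ _] [gz _ _ _] [gx _ _ _].
  by rewrite addrC (dpathcost_ksg T0' rho0 theta sg2 (ge w) (gz w) (gx w)).
have bJ := bm_jump T0 pZ Dp.
have EJ : (theta - 4^-1) * Ex (fun w => jump (Z w) p) = 0.
  pose h n t := -1 * step (q n) t + step p t.
  have gh n : bv_path (`|-1| * 1 + 1) (h n).
    apply: bv_path_lin; apply: bv_path_step; [by case/andP: (Dq n)|by case/andP: Dp].
  have h0 n t : t < 0 -> h n t = 0.
    move=> t0; rewrite /h /step !leNgt.
    have /andP[qn _] := Dq n; have /andP[p0 _] := Dp.
    by rewrite (lt_le_trans t0 qn) (lt_le_trans t0 p0) mulr0 addr0.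
  have hT n t : T <= t -> h n t = 0.
    move=> tT; rewrite /h /step.
    have /andP[_ qn] := Dq n; have /andP[_ pT] := Dp.
    by rewrite (le_trans qn tT) (le_trans pT tT) mulr1 addNr.
  have En n : Ex (fun w => dint (ksg sg theta) (h n) (Z w)) = 0.
    apply: (first_order (fun t _ => h n t) _ _ (fun=> h n)).
    + by apply: (admissible_det filF T0' _ (gh n)) => // t; [exact: h0|exact: hT].
    + by exact: (regular_process_det Omega (gh n) (hT n) (h0 n)).
    + apply: aeW => w; apply: funext => t; rewrite /Defs.path; case: ltP => // t0.
      by rewrite h0.
  have [gZ mZ _ _] := pZ.
  have rK := ksg_regular T rho0 sg theta.
  have [[M KM] _] := rK.
  (* Dominated convergence is used twice: in s along each path, and in omega, where [dint_bound]
     does not depend on n. *)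
  have h1 : Ex (fun w => dint (ksg sg theta) (h n) (Z w)) @[n --> \oo] -->
      Ex (fun w => 2 * (theta - 4^-1) * jump (Z w) p + 0).
    have PT : (P setT < +oo)%E by rewrite probability_setT ltry.
    apply: (bm_Rint_cvg measurableT PT (M := M * (`|-1| * 1 + 1) * (`|sg| * C2 + C1))).
    * move=> n; have [] // := bm_dint T0 (zeta := fun=> h n) (fun=> gh n)
        (fun t => measurable_cst (h n t)) gZ mZ rK.
    * by move=> n w _; exact: (dint_bound T0' (gh n) (gZ w) rK KM).
    * move=> w _.
      have IIE n : dint (ksg sg theta) (h n) (Z w) =
          stint T (Z w) (fun s => -1 * ksg sg theta (q n) s + ksg sg theta p s).
        have gq := bv_path_step (proj1 (andP (Dq n))); have gp := bv_path_step (proj1 (andP Dp)).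
        rewrite (dint_linl T0' _ gq gp (gZ w) rK) (dint_step T0' (Dq n) (gZ w) rK).
        rewrite (dint_step T0' Dp (gZ w) rK).
        by rewrite (stint_lin (gZ w) T0' _ (kernel_bm rK (Dq n)) (kernel_bm rK Dp)).
      have bk := kernel_bm (kdiag_regular T) Dp.
      have b0 : bm (`[0, T]%classic : set (measurableTypeR R)) (fun=> 0 : R).
        exact: bm_cst.
      have e : 2 * (theta - 4^-1) * jump (Z w) p + 0 =
          stint T (Z w) (fun s => 2 * (theta - 4^-1) * kdiag p s + 0).
        by rewrite (stint_lin (gZ w) T0' _ bk b0) stint0 (stint_kdiag T0' (gZ w) Dp).
      rewrite e; under eq_fun do rewrite IIE.
      apply: (stint_cvg (M := M + M) (gZ w) T0').
      - by move=> n; have [] := bm_lin (-1) (kernel_bm rK (Dq n)) (kernel_bm rK Dp).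
      - move=> n s _; rewrite mulN1r addrC (le_trans (ler_normB _ _))// lerD//; exact: KM.
      - move=> s; rewrite /= in_itv/= => Ds; rewrite addr0.
        under eq_fun do rewrite mulN1r addrC; exact: ksg_cvg.
  have : Ex (fun w => 2 * (theta - 4^-1) * jump (Z w) p + 0) = 0.
    by apply: (cvg_unique_ext h1 (cvg_cst 0)) => n; exact: En.
  rewrite (Ex_lin P _ bJ (bm_cst _ 0)) Ex_cst addr0 -mulrA => /eqP.
  by rewrite mulf_eq0 pnatr_eq0/= => /eqP.
have pU := regular_process_det Omega gU U_geT U_lt0.
have aU : admissible P F T 1 (fun t _ => U t) by exact: (admissible_det filF T0' _ gU).
pose x0 := x + sg * y.
(* The deviation from the claimed solution is itself taken as direction. It is built from X and Y,
   so it is adapted, and it starts from 0. *)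
pose H t w := - x0 * U t + (sg * Y t w + X t w).
have aH : admissible P F T 0 H.
  have := admissible_lin filF (- x0) aU (admissible_lin filF sg aY aX).
  by rewrite (_ : - x0 * 1 + (sg * y + x) = 0)// /x0; ring.
pose eta w t := - x0 * U t + Z w t.
have pe := regular_process_lin (- x0) pU pZ; rewrite -/eta in pe.
have He : {ae P, forall w, Defs.path 0 H w = eta w}.
  apply: filterS2 Xz Yx => w Xw Yw.
  have -> : (0 : R) = - x0 * 1 + (sg * y + x) by rewrite /x0; ring.
  rewrite /H path_lin path_lin Xw Yw; apply: funext => t; rewrite /eta /Z; congr (_ * _ + _).
  by rewrite /Defs.path; case: ltP => // /U_lt0.
have E0 := first_order H _ _ eta aH pe He.
have [ge me eT e0] := pe; have [gZ mZ _ _] := pZ.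
pose J w := jump (eta w) p.
have bJe : bmO J by exact: (bm_jump T0 pe Dp).
have JZ w : jump (Z w) p = x0 * j + J w.
  have -> : Z w = (fun t => x0 * U t + eta w t) by apply: funext => t; rewrite /eta; ring.
  by rewrite (jump_lin T0' x0 gU (ge w) Dp) jumpU// /kdiag eqxx mulr1.
have {}EJ : (theta - 4^-1) * (x0 * j + Ex J) = 0.
  rewrite -EJ (_ : (fun w => jump (Z w) p) = (fun w => 1 * J w + x0 * j)).
    by rewrite (Ex_lin P 1 bJe (bm_cst _ _)) Ex_cst mul1r [x0 * j + _]addrC.
  by apply: funext => w; rewrite JZ mul1r addrC.
pose Q w := dint kabs (eta w) (eta w); pose Dg w := dint kdiag (eta w) (eta w).
have bQ : bmO Q by exact: (bm_dint_process T0 pe pe (kabs_regular T rho0)).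
have bD : bmO Dg by exact: (bm_dint_process T0 pe pe (kdiag_regular T)).
(* Insert Z = x0 U + eta. The profile is orthogonal to eta at theta = 1/4, so the cross term keeps
   only 2 (theta - 1/4) times the diagonal form of eta and U, which is j J. *)
have EQD : (1 + sg / 2) * Ex Q + (2 * theta * Ex Dg + 2 * (theta - 4^-1) * x0 * j * Ex J) = 0.
  rewrite -E0 (_ : (fun w => dint _ _ _) = (fun w => (1 + sg / 2) * Q w +
      (2 * theta * Dg w + (2 * (theta - 4^-1) * x0 * j * J w + 0)))); last first.
    apply: funext => w.
    have -> : Z w = (fun t => x0 * U t + eta w t) by apply: funext => t; rewrite /eta; ring.
    have rK := ksg_regular T rho0 sg theta.
    rewrite (dint_linr T0' x0 (ge w) gU (ge w) rK) (dint_ksg_diag T0' rho0 sg theta (ge w)).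
    rewrite (dint_ksg_theta T0' rho0 sg theta 4^-1 (ge w) gU) (dint_kdiag_profile (ge w)).
    rewrite (dint_profile (ge w)); last 2 first.
    - exact: eT.
    - rewrite (e0 w (-1)) ?ltrN10// /x0; ring.
    rewrite /Q /Dg /J; move: (dint _ _ _) (dint _ _ _) (jump _ _) => a b e; ring.
  have b0 := bm_cst [set: Omega] (0 : R).
  rewrite (Ex_lin P _ bQ (bm_lin _ bD (bm_lin _ bJe b0))).
  rewrite (Ex_lin P _ bD (bm_lin _ bJe b0)) (Ex_lin P _ bJe b0) Ex_cst.
  by rewrite addr0.
have Q0 : forall w, 0 <= Q w by move=> w; exact: (dint_kabs_ge0 T0' rho0 (ge w)).
have D0 : forall w, 0 <= Dg w by move=> w; exact: (dint_kdiag_ge0 T0' (ge w)).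
have EQ0 := Ex_ge0 P Q0; have ED0 := Ex_ge0 P D0.
(* Dg >= J^2 >= - 2 k J - k^2 with k = x0 j *)
have DJ : 0 <= 2 * (x0 * j) * Ex J + (Ex Dg + (x0 * j) ^+ 2).
  have -> : 2 * (x0 * j) * Ex J + (Ex Dg + (x0 * j) ^+ 2) =
     Ex (fun w => 2 * (x0 * j) * J w + (1 * Dg w + (x0 * j) ^+ 2)).
    have bc := bm_cst [set: Omega] ((x0 * j) ^+ 2).
    by rewrite (Ex_lin P _ bJe (bm_lin _ bD bc)) (Ex_lin P _ bD bc) Ex_cst mul1r.
  apply: Ex_ge0 => w; have h : J w ^+ 2 <= Dg w := jump_sq_le T0' (ge w) Dp.
  have := sqr_ge0 (J w + x0 * j); rewrite sqrrD mul1r -mulr_natl; move: h.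
  by move: (J w) (Dg w) => a b; lra.
(* Either theta = 1/4 and the cross term disappears, or [EJ] forces E J = -x0 j. Then (1 + sg / 2) E
   Q, 2 theta (E Dg - (x0 j)^2) and (x0 j)^2 / 2 are nonnegative with sum 0, so all three vanish. *)
have [EQ x00] : Ex Q = 0 /\ (theta - 4^-1 = 0 \/ x0 = 0).
  move/eqP: EJ; rewrite mulf_eq0 => /orP[/eqP th|/eqP J1].
    split; last by left.
    have th2 : 0 <= 2 * theta * Ex Dg by rewrite mulr_ge0// mulr_ge0.
    have : (1 + sg / 2) * Ex Q = 0.
      move: EQD; rewrite th mulr0 !mul0r addr0 => h.
      have : 0 <= (1 + sg / 2) * Ex Q by rewrite mulr_ge0// ltW.
      lra.
    by move/eqP; rewrite mulf_eq0 (gt_eqF sg0) => /eqP.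
  have JE : Ex J = - (x0 * j) by lra.
  rewrite JE in EQD DJ.
  have h1 : (x0 * j) ^+ 2 <= Ex Dg by move: DJ; rewrite expr2; lra.
  have h2 : theta * (x0 * j) ^+ 2 <= theta * Ex Dg by rewrite ler_wpM2l.
  have h3 : 0 <= (1 + sg / 2) * Ex Q by rewrite mulr_ge0// ltW.
  have h4 : (1 + sg / 2) * Ex Q + 2 * (theta * Ex Dg) - 2 * (theta * (x0 * j) ^+ 2) +
      2^-1 * (x0 * j) ^+ 2 = 0 by rewrite -EQD; field.
  have h5 := sqr_ge0 (x0 * j).
  have h6 : (1 + sg / 2) * Ex Q = 0 by lra.
  have h7 : (x0 * j) ^+ 2 = 0 by lra.
  split; first by move/eqP: h6; rewrite mulf_eq0 (gt_eqF sg0) => /eqP.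
  by right; move/eqP: h7; rewrite sqrf_eq0 mulf_eq0 (negbTE j0) orbF => /eqP.
split.
  by rewrite -/x0; case: x00 => ->; rewrite ?mulr0 ?mul0r.
have := Ex_eq0_ae bQ Q0 EQ; apply: filterS3 Xz Yx => w Xw Yw Qw t t0.
have -> : X t w + sg * Y t w = Z w t.
  by rewrite /Z -Xw -Yw /Defs.path ltNge t0/= addrC.
suff : eta w t = 0 by rewrite /eta -/x0 => h; lra.
have [tT|Tt] := leP t T; last by rewrite eT// ltW.
rewrite (dint_kabs_eq0_const T0' rho0 (ge w) Qw); last by rewrite t0 tT.
by rewrite (e0 w (-1)) ?ltrN10// /x0; ring.
Qed.

End equilibrium.

Lemma dint0r (R : realType) (T C : R) (K : R -> R -> R) (h : R -> R) : 0 <= T -> bv_path C h ->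
  kernel_regular T K -> dint T K h (fun=> 0) = 0.
Proof.
move=> T0 gh rK; have := dint_linr T0 1 gh (bv_path_cst 0) (bv_path_cst 0) rK.
rewrite (_ : (fun _ : R => 1 * 0 + 0) = (fun=> 0)); last first.
  by apply: funext => t; rewrite mulr0 addr0.
by rewrite mul1r => /eqP; rewrite eq_sym -subr_eq0 addrK => /eqP.
Qed.

Lemma dpathcost0r (R : realType) (rho T theta C : R) (h : R -> R) : 0 <= T -> 0 < rho ->
  bv_path C h ->
  dpathcost rho T theta h (fun=> 0) (fun=> 0) = 0.
Proof.
move=> T0 rho0 gh; rewrite /dpathcost.
have zL := dint0r T0 gh (klow_regular T rho0); have zA := dint0r T0 gh (kabs_regular T rho0).
have zD := dint0r T0 gh (@kdiag_regular R T).
by rewrite zL zA zD !mulr0 !addr0.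
Qed.

(** * Existence, and recovery of both strategies *)

Section equilibrium_path.
Context {R : realType} d (Omega : measurableType d) (P : probability Omega R).
Variables (F : R -> set (set Omega)) (rho T : R).
Hypothesis filF : filtration P F.
Hypothesis rho0 : 0 < rho.
Hypothesis T0 : 0 < T.
Let T0' := ltW T0.

(** With a the half sum and b the half difference of the initial values, exchanging the players is
    the change of sign of b. The trailing 0 fits the shape of [bv_path_lin]. *)
Let eq_path (a b : R) t := a * Vpath rho T t + (b * Wpath rho T t + 0).

Let bv_path_eq_path a b : exists C, bv_path C (eq_path a b).
Proof.
have [C1 g1] := bv_path_Vpath T0 rho0; have [C2 g2] := bv_path_Wpath T0 rho0.
by eexists; exact: (bv_path_lin a g1 (bv_path_lin b g2 (bv_path_cst 0))).
Qed.

Let eq_path_ge a b t : T <= t -> eq_path a b t = 0.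
Proof. by move=> Tt; rewrite /eq_path Vpath_ge// Wpath_ge// !mulr0 !addr0. Qed.

Let eq_path_lt0 a b t : t < 0 -> eq_path a b t = a + b.
Proof. by move=> t0; rewrite /eq_path Vpath_lt0// Wpath_lt0// !mulr1 addr0. Qed.

Let eq_strategy (a b : R) (t : R) (_ : Omega) := a * Vfun rho T t + b * Wfun rho T t.

Let path_eq a b w : Defs.path (a + b) (eq_strategy a b) w = eq_path a b.
Proof.
apply: funext => t; rewrite /Defs.path; case: ltP => [t0|t0]; first by rewrite eq_path_lt0.
by rewrite /eq_strategy /eq_path /Vpath /Wpath ltNge t0/= addr0.
Qed.

Let adm_eq a b : admissible P F T (a + b) (eq_strategy a b).
Proof.
have [C g] := bv_path_eq_path a b.
apply: (admissible_det filF T0' _ g) => [t w t0|t|t]; [|exact: eq_path_lt0|exact: eq_path_ge].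
by rewrite /eq_strategy /eq_path /Vpath /Wpath ltNge t0/= addr0.
Qed.

(** The sum of the two players' derivatives involves 2 a V only, their difference 2 b W only. Both
    vanish by [dint_profile], hence so does each derivative. *)
Let dpathcost_eq a b C h : bv_path C h -> h T = 0 -> h (-1) = 0 ->
  dpathcost rho T 4^-1 h (eq_path a b) (eq_path a (- b)) = 0.
Proof.
move=> gh hT h1; have [C1 g1] := bv_path_eq_path a b; have [C2 g2] := bv_path_eq_path a (- b).
have [CV [jV [cV [gV _ _ sV]]]] := Vpath_profile T0 rho0.
have [CW [jW [cW [gW _ _ sW]]]] := Wpath_profile T0 rho0.
have zV := dint_profile T0 sV gh hT h1; have zW := dint_profile T0 sW gh hT h1.
have fV : dpathcost rho T 4^-1 h (eq_path a b) (eq_path a (- b)) +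
    1 * dpathcost rho T 4^-1 h (eq_path a (- b)) (eq_path a b) = 0.
  rewrite (dpathcost_ksg T0' rho0 4^-1 (expr1n _ 2) gh g1 g2).
  rewrite (_ : (fun t => _) = (fun t => 2 * a * Vpath rho T t + 0)); last first.
    by apply: funext => t; rewrite /eq_path; ring.
  have rK := ksg_regular T rho0 1 4^-1.
  by rewrite (dint_linr T0' _ gh gV (bv_path_cst 0) rK) zV (dint0r T0' gh rK) mulr0 addr0.
have fW : dpathcost rho T 4^-1 h (eq_path a b) (eq_path a (- b)) +
    -1 * dpathcost rho T 4^-1 h (eq_path a (- b)) (eq_path a b) = 0.
  rewrite (dpathcost_ksg T0' rho0 4^-1 (sqrr_sign _ 1) gh g1 g2).
  rewrite (_ : (fun t => _) = (fun t => 2 * b * Wpath rho T t + 0)); last first.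
    by apply: funext => t; rewrite /eq_path; ring.
  have rK := ksg_regular T rho0 (-1) 4^-1.
  by rewrite (dint_linr T0' _ gh gW (bv_path_cst 0) rK) zW (dint0r T0' gh rK) mulr0 addr0.
by move: fV fW; move: (dpathcost _ _ _ _ _ _) (dpathcost _ _ _ _ _ _) => u v; lra.
Qed.

Lemma nash_profiles a b :
  nash P F rho 4^-1 T (a + b) (a - b) (eq_strategy a b) (eq_strategy a (- b)).
Proof.
have best u : expected_cost P rho 4^-1 T (a + u) (a - u) (eq_strategy a u) (eq_strategy a (- u)) =
    ereal_inf [set expected_cost P rho 4^-1 T (a + u) (a - u) X' (eq_strategy a (- u)) |
      X' in admissible P F T (a + u)].
  have [C1 g1] := bv_path_eq_path a u; have [C2 g2] := bv_path_eq_path a (- u).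
  apply: (best_response filF T0 rho0 _ g1 _ _ g2 _ _ (path_eq a u) (path_eq a (- u)) (adm_eq a u)).
  - by rewrite invr_ge0.
  - by move=> t; exact: eq_path_ge.
  - by move=> t; exact: eq_path_lt0.
  - by move=> t; exact: eq_path_ge.
  - by move=> t; exact: eq_path_lt0.
  - by move=> C1' h; exact: dpathcost_eq.
split; [exact: adm_eq|exact: adm_eq|exact: best|].
by have := best (- b); rewrite opprK.
Qed.

Lemma nash_zero theta : 0 <= theta ->
  nash P F rho theta T 0 0 (fun _ _ => 0) (fun _ _ => 0).
Proof.
move=> theta0.
have aZ : admissible P F T 0 (fun _ _ => 0) by apply: (admissible_det filF T0' _ (bv_path_cst 0)).
have pZ w : Defs.path 0 (fun (_ : R) (_ : Omega) => 0 : R) w = (fun=> 0).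
  by apply: funext => t; rewrite /Defs.path; case: ifP.
have g0 := bv_path_cst (0 : R).
have best : expected_cost P rho theta T 0 0 (fun _ _ => 0) (fun _ _ => 0) =
    ereal_inf [set expected_cost P rho theta T 0 0 X' (fun _ _ => 0) |
      X' in admissible P F T 0].
  apply: (best_response filF T0 rho0 theta0 g0 _ _ g0 _ _ pZ pZ aZ) => // C h gh _ _.
  exact: (dpathcost0r theta T0' rho0 gh).
by split.
Qed.

Lemma nash_sum_diff theta x y X Y : 0 <= theta -> nash P F rho theta T x y X Y ->
  [/\ (x + y) * (theta - 4^-1) = 0, (x - y) * (theta - 4^-1) = 0 &
    {ae P, forall w, forall t, 0 <= t ->
      X t w = 2^-1 * (x + y) * Vfun rho T t + 2^-1 * (x - y) * Wfun rho T t /\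
      Y t w = 2^-1 * (x + y) * Vfun rho T t - 2^-1 * (x - y) * Wfun rho T t}].
Proof.
move=> theta0 nXY.
have [CV [jV [cV [gV jV0 JV sV]]]] := Vpath_profile T0 rho0.
have [CW [jW [cW [gW jW0 JW sW]]]] := Wpath_profile T0 rho0.
have e0 n : 0 <= T / n.+1%:R by rewrite divr_ge0.
have eT n : T / n.+1%:R <= T by rewrite ler_pdivrMr// ler_peMr// ler1n.
have [||||||eV aeV] := nash_signed (sg := 1) (p := 0) (q := fun n => T / n.+1%:R) filF T0 rho0
  theta0 _ _ _ _ (@ksg_cvg0 R rho T T0 theta) gV _ _ sV JV jV0 nXY.
- by rewrite expr1n.
- by rewrite mul1r addr_gt0.
- by rewrite lexx T0'.
- by move=> n; rewrite e0 eT.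
- by move=> t; exact: Vpath_lt0.
- by move=> t; exact: Vpath_ge.
have [||||||eW aeW] := nash_signed (sg := -1) (p := T) (q := fun n => T - T / n.+1%:R) filF T0
  rho0 theta0 _ _ _ _ (@ksg_cvgT R rho T T0 theta) gW _ _ sW JW jW0 nXY.
- by rewrite sqrrN expr1n.
- lra.
- by rewrite lexx T0'.
- by move=> n; rewrite subr_ge0 eT gerBl e0.
- by move=> t; exact: Wpath_lt0.
- by move=> t; exact: Wpath_ge.
split; [by rewrite -eV mul1r|by rewrite -eW mulN1r|].
apply: filterS2 aeV aeW => w hV hW t t0; have := hV t t0; have := hW t t0.
by rewrite /Vpath /Wpath ltNge t0/= => h1 h2; split; lra.
Qed.

End equilibrium_path.

Unset Implicit Arguments.

Theorem theorem4p5 (R : realType) (d : measure_display)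
  (Omega : measurableType d) (P : probability Omega R)
  (F : R -> set (set Omega)) (rho T theta x y : R) :
  filtration P F -> 0 < rho -> 0 < T -> 0 <= theta ->
  (theta = 4^-1 ->
     let Xs := fun (t : R) (_ : Omega) =>
       2^-1 * (x + y) * Vfun rho T t + 2^-1 * (x - y) * Wfun rho T t in
     let Ys := fun (t : R) (_ : Omega) =>
       2^-1 * (x + y) * Vfun rho T t - 2^-1 * (x - y) * Wfun rho T t in
     nash P F rho theta T x y Xs Ys /\
     (forall X Y, nash P F rho theta T x y X Y -> indist P X Xs /\ indist P Y Ys))
  /\
  (theta <> 4^-1 ->
     ((exists X Y, nash P F rho theta T x y X Y) <-> x = 0 /\ y = 0) /\
     (x = 0 -> y = 0 ->
        nash P F rho theta T x y (fun _ _ => 0) (fun _ _ => 0) /\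
        (forall X Y, nash P F rho theta T x y X Y ->
           indist P X (fun _ _ => 0) /\ indist P Y (fun _ _ => 0)))).
Proof.
move=> filF rho0 T0 theta0; split.
  move=> -> Xs Ys; split.
    have := nash_profiles filF rho0 T0 (2^-1 * (x + y)) (2^-1 * (x - y)).
    have -> : 2^-1 * (x + y) + 2^-1 * (x - y) = x by field.
    have -> : 2^-1 * (x + y) - 2^-1 * (x - y) = y by field.
    have -> // : Ys = (fun t _ => 2^-1 * (x + y) * Vfun rho T t +
      - (2^-1 * (x - y)) * Wfun rho T t).
    by apply: funext => t; apply: funext => w; rewrite /Ys mulNr.
  move=> X Y /nash_sum_diff[]// _ _ ae; split; apply: filterS ae => w h t /h[]//.
move=> theta4.
have zero X Y : nash P F rho theta T x y X Y -> x = 0 /\ y = 0.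
  have th : (theta - 4^-1 == 0) = false by apply/negbTE; rewrite subr_eq0; apply/eqP.
  move=> /nash_sum_diff[]// /eqP; rewrite mulf_eq0 th orbF => /eqP h1.
  by move=> /eqP; rewrite mulf_eq0 th orbF => /eqP h2 _; split; lra.
split.
  split=> [[X [Y /zero]]//|[-> ->]].
  by exists (fun _ _ => 0), (fun _ _ => 0); exact: nash_zero.
move=> x0 y0; split; first by rewrite x0 y0; exact: nash_zero.
move=> X Y /nash_sum_diff[]// _ _; rewrite x0 y0 subrr addr0 mulr0 => ae.
by split; apply: filterS ae => w h t /h[]; rewrite !mul0r ?addr0 ?subr0.
Qed.
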